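(* Let $X_1,\ldots,X_n$ be independent random variables, let $T=T(X_1,\ldots,X_n)$ be a statistic, and write $T=W+\Delta$ with $$W=\sum_{i=1}^n g_i(X_i),\qquad \Delta=\Delta(X_1,\ldots,X_n)=T-W,$$ where the $g_i$ are Borel measurable functions with $\mathrm{E}(g_i(X_i))=0$ for $i=1,\ldots,n$ and $\sum_{i=1}^n \mathrm{E}(g_i^2(X_i))=1$. For each $1\le i\le n$, let $\Delta_i$ be a random variable such that $X_i$ and $(\Delta_i,\{X_j,\,j\ne i\})$ are independent. Then for every $\delta>0$ satisfying $$\sum_{i=1}^n \mathrm{E}|g_i(X_i)|\min(\delta,|g_i(X_i)|)\ge 1/2$$ and for every $z\in\mathbb{R}$, $$|P(T\le z)-P(W\le z)|\le \gamma_z+e^{-|z|/3}\tau,$$ where $$\gamma_z=P(|\Delta|>(|z|+1)/3)+\sum_{i=1}^n P(|g_i(X_i)|>(|z|+1)/3)+\sum_{i=1}^n P(|W-g_i(X_i)|>(|z|-2)/3)\,P(|g_i(X_i)|>1),$$ $$\tau=22\delta+8.5\|\Delta\|_2+3.6\sum_{i=1}^n\|g_i(X_i)\|_2\,\|\Delta-\Delta_i\|_2.$$ In particular, there is an absolute constant $C$ such that, if $\mathrm{E}|g_i(X_i)|^p<\infty$ for all $1\le i\le n$, where $2<p\le 3$, then for every $z\in\mathbb{R}$, $$|P(T\le z)-\Phi(z)|\le P(|\Delta|>(|z|+1)/3)+C(|z|+1)^{-p}\left(\|\Delta\|_2+\sum_{i=1}^n\|g_i(X_i)\|_2\,\|\Delta-\Delta_i\|_2+\sum_{i=1}^n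 \mathrm{E}|g_i(X_i)|^p\right).$$
   Context: $\Phi$ is the standard normal distribution function and $\|X\|_p=(\mathrm{E}|X|^p)^{1/p}$ for $p\ge1$. The random variables $\Delta_i$ are defined on the same probability space as $X_1,\ldots,X_n$. The functions $g_i$ may depend on $n$. An absolute constant is one not depending on any of the other quantities in the statement. *)

(* Defs.v *)
From HB Require Import structures.
From mathcomp Require Import all_boot all_order all_algebra.
From mathcomp Require Import all_classical all_reals all_analysis.

Set Implicit Arguments.
Unset Strict Implicit.
Unset Printing Implicit Defensive.

Import Order.TTheory GRing.Theory Num.Theory.
Import numFieldNormedType.Exports.

Local Open Scope classical_set_scope.
Local Open Scope ring_scope.

Definition mutually_independent d d' (Omega : measurableType d)
    (E : measurableType d') (R : realType) (P : probability Omega R)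
    (I : finType) (X : I -> Omega -> E) : Prop :=
  forall (J : {set I}) (A : I -> set E),
    (forall i, i \in J -> measurable (A i)) ->
    P (\bigcap_(i in [set` J]) (X i @^-1` A i)) =
    (\prod_(i in J) P (X i @^-1` A i))%E.

Definition independent2 d d1 d2 (Omega : measurableType d)
    (E1 : measurableType d1) (E2 : measurableType d2) (R : realType)
    (P : probability Omega R) (U : Omega -> E1) (V : Omega -> E2) : Prop :=
  forall (A : set E1) (B : set E2), measurable A -> measurable B ->
    P (U @^-1` A `&` V @^-1` B) = (P (U @^-1` A) * P (V @^-1` B))%E.

Section statistic.
Context d (Omega : measurableType d) (R : realType) (P : probability Omega R).
Context (n : nat) (X : 'I_n -> {RV P >-> R}).

Definition sample (w : Omega) : n.-tuple R := [tuple X i w | i < n].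

(* [lift i] enumerates the indices j != i. *)
Definition sample_but (i : 'I_n) (w : Omega) : n.-1.-tuple R :=
  [tuple X (lift i j) w | j < n.-1].

Context (T : {mfun n.-tuple R >-> R}) (g : 'I_n -> {mfun R >-> R}).

Definition stat (w : Omega) : R := T (sample w).

Definition gX (i : 'I_n) (w : Omega) : R := g i (X i w).

Definition linear_part (w : Omega) : R := \sum_(i < n) gX i w.

Definition remainder (w : Omega) : R := stat w - linear_part w.

Local Notation W := linear_part.
Local Notation Delta := remainder.
Local Open Scope ereal_scope.

Definition gammaz (z : R) : \bar R :=
  P [set w | (`|Delta w| > (`|z| + 1) / 3)%R]
  + \sum_(i < n) P [set w | (`|gX i w| > (`|z| + 1) / 3)%R]
  + \sum_(i < n) P [set w | (`|W w - gX i w| > (`|z| - 2) / 3)%R]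
                 * P [set w | (`|gX i w| > 1)%R].

(* These norms may be infinite; products use 0 * +oo = 0. *)
Definition L2remainder : \bar R := 'N[P]_2%:E[EFin \o Delta].

Definition L2coupling (Deltai : 'I_n -> {RV P >-> R}) : \bar R :=
  \sum_(i < n) 'N[P]_2%:E[EFin \o gX i]
               * 'N[P]_2%:E[EFin \o (fun w => Delta w - Deltai i w)%R].

Definition tau (Deltai : 'I_n -> {RV P >-> R}) (delta : R) : \bar R :=
  (22 * delta)%:E + (17 / 2)%:E * L2remainder + (18 / 5)%:E * L2coupling Deltai.

End statistic.

Definition Phi (R : realType) (z : R) : \bar R := normal_prob 0 1 `]-oo, z].

(* Main.v *)
Require Import Defs.
From HB Require Import structures.
From mathcomp Require Import all_boot all_order all_algebra.
From mathcomp Require Import all_classical all_reals all_analysis.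
From mathcomp Require Import measurable_realfun ring lra.

Set Implicit Arguments.
Unset Strict Implicit.
Unset Printing Implicit Defensive.

Import Order.TTheory GRing.Theory Num.Theory.
Import numFieldNormedType.Exports.

Local Open Scope classical_set_scope.
Local Open Scope ring_scope.

(* Throughout, [xi i = g_i(X_i)], [W] is the sum of the [xi i] and [x = (|z| + 1) / 3].

   Part 1. By symmetry, [z >= 0]; one must bound the probability that [W] lies in a window of
   random length [|Delta| <= x] at [z]. If some [xi i > 1] then, up to boundary ties, [xi i > x] or
   [W - xi i > x - 1], which gives gammaz. Otherwise all [xi i <= 1], and one tests the identity
   [E xi_i F(W - xi_i) = 0] with the function [F(w) = e^{w/2} clamp(w - a + delta, 0, b - a + 2 delta)]
   of the window [[a, b]]: the increments of [F] dominate [xi i * min(delta, xi i)] on the window,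
   the weight [e^{w/2}] produces [e^{-z/3}] and moment generating functions of the truncated sum
   are bounded by Bennett's inequality. Replacing [Delta] by [Delta_i] in the window makes the
   increments of [F] independent of [X_i]. Ties, where [W = 2 x - 1] and some [xi i = x], are
   handled by concentration of the remaining sum at one point.

   Part 2. Let [m = 1 + |z|] and let [theta] be the sum of [E xi_i^2 min(m, |xi i|)] over [m^3],
   which is at most [m^{-p}] times the sum of [E |xi i|^p]. If the sum [gamma] of
   [E xi_i^2 min(1, |xi i|)] is at least 1/10, all tails are of order [theta]. Otherwise part 1
   applies with [delta = 2 gamma], and the nonuniform Berry-Esseen bound for [W] follows from
   Stein's method applied to the sum of the [xi i] truncated at [|xi i| <= 1]: the derivatives of
   the Stein solution are weighted by [e^{-z/4} (e^{w/2} + e^{-w/2})], and the discontinuity is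
   absorbed by the same concentration argument on a window depending only on [X_i]. *)

(** * Expectation and independence *)

(** Two obstacles shape part 1. First, Delta need not be square integrable and the coupling norms
    may be infinite. The windows are therefore built from min(|Delta|, x) and min(|Delta_i|, x):
    nothing changes where |Delta| <= x, all integrands become bounded, and clipping is a
    contraction, so the L2 quantities only decrease. Second, the thresholds in gammaz are strict,
    and the configuration xi i = x, W - xi i = x - 1 escapes all of them. It is charged to delta:
    the constant 22 is 51/5 for the window plus 59/5 for the tie.

    The exponents fit together as follows. In the window W >= z - x = (2 z - 1) / 3, so e^{W/2} is
    at least e^{z/3} e^{-1/6}; Cauchy-Schwarz doubles the exponent 1/2 to 1, where Bennett's
    inequality gives e^{e - 2}.

    In part 2, W may lack exponential moments, which forces the truncation before Stein's method.
    The cap at m keeps third-moment tail bounds available with only two moments, and t^2 min(m, t)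
    <= m^{3 - p} t^p converts them to order p. *)

Section expectation.
Context d (Omega : measurableType d) (R : realType) (P : probability Omega R).
Implicit Types f g : Omega -> R.

Definition Mfun f := measurable_fun setT f.
Definition Int f := P.-integrable setT (EFin \o f).
Definition Ex f : R := \int[P]_w f w.

Lemma MfunD f g : Mfun f -> Mfun g -> Mfun (fun w => f w + g w).
Proof. exact: measurable_funD. Qed.
Lemma MfunB f g : Mfun f -> Mfun g -> Mfun (fun w => f w - g w).
Proof. exact: measurable_funB. Qed.
Lemma MfunN f : Mfun f -> Mfun (fun w => - f w).
Proof. exact: measurable_funN. Qed.
Lemma MfunM f g : Mfun f -> Mfun g -> Mfun (fun w => f w * g w).
Proof. exact: measurable_funM. Qed.
Lemma MfunX f n : Mfun f -> Mfun (fun w => f w ^+ n).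
Proof. exact: measurable_funX. Qed.
Lemma Mfun_min f g : Mfun f -> Mfun g -> Mfun (fun w => Num.min (f w) (g w)).
Proof. exact: measurable_minr. Qed.
Lemma Mfun_cst (c : R) : Mfun (fun=> c).
Proof. exact: measurable_cst. Qed.
Lemma Mfun_comp (h : R -> R) f : measurable_fun setT h -> Mfun f -> Mfun (fun w => h (f w)).
Proof. by move=> mh mf; apply: measurableT_comp. Qed.
Lemma Mfun_norm f : Mfun f -> Mfun (fun w => `|f w|).
Proof. by apply: Mfun_comp; exact: normr_measurable. Qed.
Lemma Mfun_exp f : Mfun f -> Mfun (fun w => expR (f w)).
Proof. by apply: Mfun_comp; exact: measurable_expR. Qed.
Lemma Mfun_sum (I : Type) (s : seq I) (Q : pred I) (F : I -> Omega -> R) :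
  (forall i, Q i -> Mfun (F i)) -> Mfun (fun w => \sum_(i <- s | Q i) F i w).
Proof.
move=> h; elim: s => [|i s ih].
  rewrite (_ : (fun w => _) = (fun=> 0)); first exact: Mfun_cst.
  by apply/funext => w; rewrite big_nil.
have [Qi|Qi] := boolP (Q i); last first.
  rewrite (_ : (fun w => _) = (fun w => \sum_(i <- s | Q i) F i w)) //.
  by apply/funext => w; rewrite big_cons (negbTE Qi).
rewrite (_ : (fun w => _) = (fun w => F i w + \sum_(i <- s | Q i) F i w)).
  by apply: MfunD => //; exact: h.
by apply/funext => w; rewrite big_cons Qi.
Qed.

Lemma Mfun_bool (b : Omega -> bool) : measurable_fun setT b ->
  Mfun (fun w => (b w)%:R).
Proof.
by move=> mb; apply: (@measurableT_comp _ _ _ _ _ _ (fun c : bool => c%:R : R)).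
Qed.

Lemma Mfun_ler f g : Mfun f -> Mfun g -> Mfun (fun w => (f w <= g w)%R%:R).
Proof. by move=> mf mg; apply: Mfun_bool; exact: measurable_fun_ler. Qed.
Lemma Mfun_ltr f g : Mfun f -> Mfun g -> Mfun (fun w => (f w < g w)%R%:R).
Proof. by move=> mf mg; apply: Mfun_bool; exact: measurable_fun_ltr. Qed.
Lemma Mfun_eqr f g : Mfun f -> Mfun g -> Mfun (fun w => (f w == g w)%R%:R).
Proof. by move=> mf mg; apply: Mfun_bool; exact: measurable_fun_eqr. Qed.

Lemma Int_Mfun f : Int f -> Mfun f.
Proof. by move=> /measurable_int/measurable_EFinP. Qed.

Lemma IntD f g : Int f -> Int g -> Int (fun w => f w + g w).
Proof. by move=> If Ig; apply: (integrableD measurableT If Ig). Qed.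
Lemma IntB f g : Int f -> Int g -> Int (fun w => f w - g w).
Proof. by move=> If Ig; apply: (integrableB measurableT If Ig). Qed.
Lemma IntN f : Int f -> Int (fun w => - f w).
Proof. by move=> If; rewrite (_ : (fun w => _) = (fun w => -1 * f w)); [exact: (integrableZl measurableT (-1) If)|by apply/funext => w; rewrite mulN1r]. Qed.
Lemma IntZl (c : R) f : Int f -> Int (fun w => c * f w).
Proof. by move=> If; apply: (integrableZl measurableT c If). Qed.
Lemma IntZr (c : R) f : Int f -> Int (fun w => f w * c).
Proof. by move=> If; apply: (integrableZr measurableT c If). Qed.
Lemma Int_sum (I : Type) (s : seq I) (Q : pred I) (F : I -> Omega -> R) :
  (forall i, Q i -> Int (F i)) -> Int (fun w => \sum_(i <- s | Q i) F i w).
Proof.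
move=> h; have := @integrable_sum _ _ _ P setT measurableT _ s Q (fun i => EFin \o F i) h.
by congr (integrable _ _ _); apply/funext => w /=; rewrite sumEFin.
Qed.
Lemma Int_le f g : Mfun f -> (forall w, `|f w| <= g w) -> Int g -> Int f.
Proof.
move=> mf fg Ig; apply: (@le_integrable _ _ _ _ _ measurableT _ (EFin \o g)) => //.
  exact/measurable_EFinP.
by move=> w _ /=; rewrite lee_fin (le_trans (fg w))// ler_norm.
Qed.
Lemma Int_cst (c : R) : Int (fun=> c).
Proof. exact: finite_measure_integrable_cst. Qed.
Lemma Int_bnd f (M : R) : Mfun f -> (forall w, `|f w| <= M) -> Int f.
Proof. by move=> mf fM; apply: (Int_le mf fM); exact: Int_cst. Qed.
Lemma IntMb f g (M : R) : Int f -> Mfun g -> (forall w, `|g w| <= M) ->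
  Int (fun w => f w * g w).
Proof.
move=> If mg gM; apply: (@Int_le _ (fun w => M * `|f w|)).
- by apply: MfunM => //; exact: Int_Mfun.
- by move=> w; rewrite normrM mulrC ler_wpM2r.
- apply: IntZl; apply: (@Int_le _ (fun w => `|f w|)) => //.
  + exact/Mfun_norm/Int_Mfun.
  + by move=> w; rewrite normr_id.
  + exact: integrable_norm.
Qed.
Lemma IntbM f g (M : R) : Int f -> Mfun g -> (forall w, `|g w| <= M) ->
  Int (fun w => g w * f w).
Proof.
move=> If mg gM; rewrite (_ : (fun w => _) = (fun w => f w * g w)).
  exact: IntMb gM.
by apply/funext => w; rewrite mulrC.
Qed.
Lemma Int_norm f : Int f -> Int (fun w => `|f w|).
Proof. exact: integrable_norm. Qed.

Lemma Int_mul2 f g : Mfun f -> Mfun g -> Int (fun w => f w ^+ 2) ->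
  Int (fun w => g w ^+ 2) -> Int (fun w => f w * g w).
Proof.
move=> mf mg If Ig; apply: (@Int_le _ (fun w => f w ^+ 2 + g w ^+ 2)).
- exact: MfunM.
- move=> w; rewrite normrM -(real_normK (num_real (f w))) -(real_normK (num_real (g w))).
  move: (normr_ge0 (f w)) (normr_ge0 (g w)); set a := `|f w|; set b := `|g w|.
  by move=> a0 b0; nra.
- exact: IntD.
Qed.

Lemma Int_of_sq f : Mfun f -> Int (fun w => f w ^+ 2) -> Int f.
Proof.
move=> mf If; apply: (@Int_le _ (fun w => 1 + f w ^+ 2)) => //.
- move=> w; rewrite -(real_normK (num_real (f w))).
  by move: (normr_ge0 (f w)); set a := `|f w| => a0; nra.
- by apply: IntD => //; exact: Int_cst.
Qed.

Lemma ExD f g : Int f -> Int g -> Ex (fun w => f w + g w) = Ex f + Ex g.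
Proof. by move=> If Ig; apply: RintegralD. Qed.
Lemma ExB f g : Int f -> Int g -> Ex (fun w => f w - g w) = Ex f - Ex g.
Proof. by move=> If Ig; apply: RintegralB. Qed.
Lemma ExZl (c : R) f : Int f -> Ex (fun w => c * f w) = c * Ex f.
Proof. by move=> If; apply: RintegralZl. Qed.
Lemma ExZr (c : R) f : Int f -> Ex (fun w => f w * c) = Ex f * c.
Proof. by move=> If; apply: RintegralZr. Qed.
Lemma Ex_cst (c : R) : Ex (fun=> c) = c.
Proof. by rewrite /Ex Rintegral_cst//= (_ : P setT = 1%E) ?mulr1//; exact: probability_setT. Qed.
Lemma ExN f : Int f -> Ex (fun w => - f w) = - Ex f.
Proof.
move=> If; rewrite -mulN1r -ExZl//; congr Ex; apply/funext => w; by rewrite mulN1r.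
Qed.
Lemma Ex_sum (I : Type) (s : seq I) (Q : pred I) (F : I -> Omega -> R) :
  (forall i, Q i -> Int (F i)) ->
  Ex (fun w => \sum_(i <- s | Q i) F i w) = \sum_(i <- s | Q i) Ex (F i).
Proof.
move=> h; elim: s => [|i s ih].
  rewrite big_nil -[RHS]Ex_cst; congr Ex; apply/funext => w; by rewrite big_nil.
rewrite big_cons -ih; have [Qi|Qi] := boolP (Q i).
  rewrite -ExD; [|exact: h|exact: Int_sum].
  by congr Ex; apply/funext => w; rewrite big_cons Qi.
by congr Ex; apply/funext => w; rewrite big_cons (negbTE Qi).
Qed.
Lemma Ex_le f g : Int f -> Int g -> (forall w, f w <= g w) -> Ex f <= Ex g.
Proof. by move=> If Ig fg; apply: le_Rintegral. Qed.
Lemma Ex_ge0 f : (forall w, 0 <= f w) -> 0 <= Ex f.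
Proof. by move=> f0; apply: Rintegral_ge0. Qed.
Lemma Ex_norm f : Int f -> `|Ex f| <= Ex (fun w => `|f w|).
Proof. by move=> If; apply: le_normr_Rintegral. Qed.
Lemma Ex_fin f : Int f -> (\int[P]_w (f w)%:E)%E = (Ex f)%:E.
Proof.
by move=> If; rewrite /Ex /Rintegral fineK//; exact: integrable_fin_num.
Qed.

Lemma Ex_bool (b : Omega -> bool) : measurable_fun setT b ->
  P [set w | b w] = (Ex (fun w => (b w)%:R))%:E.
Proof.
move=> mb; have mB : measurable [set w | b w].
  rewrite (_ : [set w | b w] = setT `&` b @^-1` [set true]); first exact: mb.
  by rewrite setTI; apply/seteqP; split => w /=.
rewrite -Ex_fin.
  rewrite -[RHS]/(\int[P]_w ((b w)%:R)%:E)%E -(@expectation_indic _ _ _ P _ mB) unlock.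
  apply: eq_integral => w _; rewrite indicE; congr (_%:R%:E).
  by case bw : (b w); [rewrite mem_set|rewrite memNset//= bw].
apply: (@Int_bnd _ 1); first exact: Mfun_bool.
by move=> w; case: (b w); rewrite ?normr1 ?normr0.
Qed.

Lemma Int_bool (b : Omega -> bool) : measurable_fun setT b -> Int (fun w => (b w)%:R).
Proof.
move=> mb; apply: (@Int_bnd _ 1); first exact: Mfun_bool.
by move=> w; case: (b w); rewrite ?normr1 ?normr0.
Qed.

Lemma Ex_CS f g : Mfun f -> Mfun g -> Int (fun w => f w ^+ 2) ->
  Int (fun w => g w ^+ 2) ->
  Ex (fun w => `|f w| * `|g w|) <=
  Num.sqrt (Ex (fun w => f w ^+ 2)) * Num.sqrt (Ex (fun w => g w ^+ 2)).
Proof.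
move=> mf mg If Ig; set A := Ex (fun w => f w ^+ 2); set B := Ex (fun w => g w ^+ 2).
set c := Ex _.
have A0 : 0 <= A by apply: Ex_ge0 => w; exact: sqr_ge0.
have B0 : 0 <= B by apply: Ex_ge0 => w; exact: sqr_ge0.
have Ifg : Int (fun w => `|f w| * `|g w|).
  apply: Int_mul2; [exact: Mfun_norm|exact: Mfun_norm| |].
    by rewrite (_ : (fun w => _) = (fun w => f w ^+ 2))//; apply/funext => w;
      rewrite real_normK ?num_real.
  by rewrite (_ : (fun w => _) = (fun w => g w ^+ 2))//; apply/funext => w;
      rewrite real_normK ?num_real.
have c0 : 0 <= c by apply: Ex_ge0 => w; exact: mulr_ge0.
(* Expectation of the square of s |f| - t |g|; below, s = sqrt B and t = sqrt A give the claim. *)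
have key (s t : R) : 2 * (s * t) * c <= s ^+ 2 * A + t ^+ 2 * B.
  rewrite -ExZl// -!ExZl// -ExD; [|exact: IntZl|exact: IntZl].
  apply: Ex_le; [exact: IntZl|by apply: IntD; exact: IntZl|move=> w].
  rewrite -(real_normK (num_real (f w))) -(real_normK (num_real (g w))).
  by move: (sqr_ge0 (s * `|f w| - t * `|g w|)); nra.
have [a0 b0] : 0 <= Num.sqrt A /\ 0 <= Num.sqrt B by rewrite !sqrtr_ge0.
have Aa := sqr_sqrtr A0; have Bb := sqr_sqrtr B0.
rewrite leNgt; apply/negP => cgt.
have c1 : 0 < c by apply: le_lt_trans cgt; exact: mulr_ge0.
(* When A = 0 the inequality [key] fails for large s: the chosen s turns it into 2 (B + 1) <= B. The
   case B = 0 is symmetric. *)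
have [a1|a1] := eqVneq (Num.sqrt A) 0.
  have := key ((B + 1) / c) 1.
  rewrite -Aa a1 mulr1 -mulrA mulfVK ?gt_eqF//; nra.
have [b1|b1] := eqVneq (Num.sqrt B) 0.
  have := key 1 ((A + 1) / c).
  rewrite -Bb b1 mul1r -mulrA mulfVK ?gt_eqF//; nra.
have ab0 : 0 < Num.sqrt A * Num.sqrt B by rewrite mulr_gt0 ?lt_neqAle ?a0 ?b0 1?eq_sym ?a1 ?b1.
have := key (Num.sqrt B) (Num.sqrt A).
have : 0 < Num.sqrt A * Num.sqrt B * (c - Num.sqrt A * Num.sqrt B) by rewrite mulr_gt0// subr_gt0.
move: (Num.sqrt A) (Num.sqrt B) Aa Bb => a b Aa Bb; rewrite -Aa -Bb; nra.
Qed.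

(** The law of the pair agrees with the product of the two laws on rectangles, hence everywhere, and
    the factorization becomes Fubini's theorem. Integrability of the product belongs to the
    conclusion because only first moments are assumed. *)
Lemma independent2_Ex d1 d2 (E1 : measurableType d1) (E2 : measurableType d2)
    (U : Omega -> E1) (V : Omega -> E2) (phi : E1 -> R) (psi : E2 -> R) :
  measurable_fun setT U -> measurable_fun setT V -> independent2 P U V ->
  measurable_fun setT phi -> measurable_fun setT psi ->
  Int (fun w => phi (U w)) -> Int (fun w => psi (V w)) ->
  Int (fun w => phi (U w) * psi (V w)) /\
  Ex (fun w => phi (U w) * psi (V w)) = Ex (fun w => phi (U w)) * Ex (fun w => psi (V w)).
Proof.
move=> mU mV UV mphi mpsi Iphi Ipsi.
pose U' : {mfun Omega >-> E1} := HB.pack U (isMeasurableFun.Build _ _ _ _ U mU).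
pose V' : {mfun Omega >-> E2} := HB.pack V (isMeasurableFun.Build _ _ _ _ V mV).
have mUV : measurable_fun setT (fun w => (U w, V w)) by exact: measurable_fun_pair.
pose UV' : {mfun Omega >-> (E1 * E2)%type} :=
  HB.pack (fun w => (U w, V w)) (isMeasurableFun.Build _ _ _ _ _ mUV).
pose PU : probability E1 R := distribution P U'.
pose PV : probability E2 R := distribution P V'.
pose PUV : probability (E1 * E2)%type R := distribution P UV'.
have joint (A : set (E1 * E2)) : measurable A -> (PU \x PV)%E A = PUV A.
  apply: product_measure_unique => A1 A2 mA1 mA2.
  by rewrite -[RHS]/(P (U @^-1` A1) * P (V @^-1` A2))%E -UV.
pose F (x : E1 * E2) : \bar R := (phi x.1 * psi x.2)%:E.
have mF : measurable_fun setT F.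
  apply/measurable_EFinP; apply: measurable_funM.
    by apply: measurableT_comp => //; exact: measurable_fst.
  by apply: measurableT_comp => //; exact: measurable_snd.
have IU : PU.-integrable setT (EFin \o phi).
  by apply: integrable_pushforward => //; exact/measurable_EFinP.
have IV : PV.-integrable setT (EFin \o psi).
  by apply: integrable_pushforward => //; exact/measurable_EFinP.
have EU : (\int[PU]_x (phi x)%:E = (Ex (fun w => phi (U w)))%:E)%E.
  by rewrite integral_pushforward//= ?Ex_fin//; exact/measurable_EFinP.
have EV : (\int[PV]_x (psi x)%:E = (Ex (fun w => psi (V w)))%:E)%E.
  by rewrite integral_pushforward//= ?Ex_fin//; exact/measurable_EFinP.
have IF : (PU \x PV)%E.-integrable setT F.
  apply/integrable12ltyP => //.
  have c0 : (\int[PV]_y `|(psi y)%:E| < +oo)%E by case/integrableP : IV.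
  under eq_integral => x _.
    rewrite /F /=.
    under eq_integral => y _ do rewrite normrM EFinM.
    rewrite ge0_integralZl//=; last by apply/measurable_EFinP; exact: measurableT_comp.
    over.
  have -> : (\int[PV]_y `|(psi y)%:E| = (fine (\int[PV]_y `|(psi y)%:E|))%:E)%E.
    by rewrite fineK// ge0_fin_numE// integral_ge0.
  rewrite ge0_integralZr//=; last 2 first.
    by apply/measurable_EFinP; exact: measurableT_comp.
    by rewrite lee_fin fine_ge0// integral_ge0.
  rewrite lte_mul_pinfty//; first exact: integral_ge0.
    by rewrite ge0_fin_numE ?integral_ge0//; case/integrableP : IU.
  exact: ltry.
have IFP : P.-integrable setT (F \o (fun w => (U w, V w))).
  apply/integrableP; split; first exact: measurableT_comp.
  rewrite -(@ge0_integral_pushforward _ _ _ _ _ _ mUV P setT (fun x => `|F x|)%E)//; last first.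
    by apply: measurableT_comp => //; exact: abse_measurable.
  rewrite (eq_measure_integral (PU \x PV)%E); last by move=> A mA _; apply/esym/joint.
  by case/integrableP : IF.
split; first by [].
apply: EFin_inj; rewrite -Ex_fin// -[LHS]/(\int[P]_x (F \o (fun w => (U w, V w))) x)%E.
rewrite -(@integral_pushforward _ _ _ _ _ (fun w => (U w, V w)) mUV P setT F)//.
rewrite (eq_measure_integral (PU \x PV)%E); last by move=> A mA _; apply/esym/joint.
rewrite -integral12_prod_meas1// /fubini_F /F /=.
under eq_integral => x _.
  under eq_integral => y _ do rewrite EFinM.
  rewrite integralZl// EV; over.
by rewrite integralZr//= EU.
Qed.

End expectation.

Section independence.
Context d (Omega : measurableType d) (R : realType) (P : probability Omega R).
Context (n : nat) (X D : 'I_n -> {RV P >-> R}).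
Hypothesis indep : forall i, independent2 P (X i) (fun w => (D i w, sample_but X i w)).

(** Measurability with respect to [D i] and the [X j], j <> i, encoded as a factorization instead of
    a sigma-algebra: closure properties are compositions, and independence from [X i] is read off
    [independent2_Ex]. *)
Definition off (i : 'I_n) (Z : Omega -> R) : Prop :=
  exists2 h : R * n.-1.-tuple R -> R, measurable_fun setT h &
    Z = fun w => h (D i w, sample_but X i w).

Lemma measurable_sample_but i : measurable_fun setT (sample_but X i).
Proof.
apply/measurable_fun_tnthP => j.
rewrite (_ : _ \o _ = X (lift i j))//; apply/funext => w /=.
by rewrite tnth_mktuple.
Qed.

Lemma off_Mfun i Z : off i Z -> Mfun Z.
Proof.
move=> [h mh ->]; apply: measurableT_comp => //.
by apply: measurable_fun_pair => //; exact: measurable_sample_but.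
Qed.

Lemma off_cst i (c : R) : off i (fun=> c).
Proof. by exists (fun=> c). Qed.

Lemma off_D i : off i (D i).
Proof. by exists fst. Qed.

Lemma off_X i j : j != i -> off i (X j).
Proof.
move=> ji; have [k jk] : exists k, j = lift i k.
  by case: (unlift_some (n:=n) (h:=i) (i:=j)); rewrite 1?eq_sym// => k jk _; exists k.
exists (fun x : R * n.-1.-tuple R => tnth x.2 k).
  by apply: (@measurableT_comp _ _ _ _ _ _ (fun t => tnth t k)) => //; exact: measurable_tnth.
by apply/funext => w /=; rewrite tnth_mktuple jk.
Qed.

Lemma off_comp i (f : R -> R) Z : measurable_fun setT f -> off i Z -> off i (fun w => f (Z w)).
Proof. by move=> mf [h mh ->]; exists (f \o h) => //; exact: measurableT_comp. Qed.

Lemma offD i Z1 Z2 : off i Z1 -> off i Z2 -> off i (fun w => Z1 w + Z2 w).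
Proof. by move=> [h1 mh1 ->] [h2 mh2 ->]; exists (fun x => h1 x + h2 x) => //; exact: measurable_funD. Qed.
Lemma offB i Z1 Z2 : off i Z1 -> off i Z2 -> off i (fun w => Z1 w - Z2 w).
Proof. by move=> [h1 mh1 ->] [h2 mh2 ->]; exists (fun x => h1 x - h2 x) => //; exact: measurable_funB. Qed.
Lemma offM i Z1 Z2 : off i Z1 -> off i Z2 -> off i (fun w => Z1 w * Z2 w).
Proof. by move=> [h1 mh1 ->] [h2 mh2 ->]; exists (fun x => h1 x * h2 x) => //; exact: measurable_funM. Qed.
Lemma off_sum i (Q : pred 'I_n) (F : 'I_n -> Omega -> R) :
  (forall j, Q j -> off i (F j)) -> off i (fun w => \sum_(j < n | Q j) F j w).
Proof.
move=> h; elim: (index_enum _) => [|j s ih].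
  rewrite (_ : (fun w => _) = (fun=> 0)); first exact: off_cst.
  by apply/funext => w; rewrite big_nil.
have [Qj|Qj] := boolP (Q j); last first.
  rewrite (_ : (fun w => _) = (fun w => \sum_(i <- s | Q i) F i w)) //.
  by apply/funext => w; rewrite big_cons (negbTE Qj).
rewrite (_ : (fun w => _) = (fun w => F j w + \sum_(i <- s | Q i) F i w)).
  by apply: offD => //; exact: h.
by apply/funext => w; rewrite big_cons Qj.
Qed.

Lemma off_indep i (phi : R -> R) Z : measurable_fun setT phi -> off i Z ->
  Int P (fun w => phi (X i w)) -> Int P Z ->
  Int P (fun w => phi (X i w) * Z w) /\
  Ex P (fun w => phi (X i w) * Z w) = Ex P (fun w => phi (X i w)) * Ex P Z.
Proof.
move=> mphi [h mh ->] Iphi Ih.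
apply: independent2_Ex => //.
by apply: measurable_fun_pair => //; exact: measurable_sample_but.
Qed.

End independence.

(** * Calculus and exponential inequalities *)

Section derivatives.
Context (R : realType).
Implicit Types (f g : R -> R) (x a b c : R).

Lemma derD f g x a b : is_derive x 1 f a -> is_derive x 1 g b ->
  is_derive x 1 (fun y => f y + g y) (a + b).
Proof. by move=> df dg; apply: is_deriveD. Qed.
Lemma derB f g x a b : is_derive x 1 f a -> is_derive x 1 g b ->
  is_derive x 1 (fun y => f y - g y) (a - b).
Proof. by move=> df dg; apply: is_deriveB. Qed.
Lemma derN f x a : is_derive x 1 f a -> is_derive x 1 (fun y => - f y) (- a).
Proof. by move=> df; apply: is_deriveN. Qed.
Lemma derM f g x a b : is_derive x 1 f a -> is_derive x 1 g b ->
  is_derive x 1 (fun y => f y * g y) (f x * b + g x * a).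
Proof. by move=> df dg; apply: is_deriveM. Qed.
Lemma derC c x : is_derive x 1 (fun=> c) 0.
Proof. exact: is_derive_cst. Qed.
Lemma derI x : is_derive x 1 (fun y => y) 1.
Proof. exact: is_derive_id. Qed.
Lemma derE f x a : is_derive x 1 f a ->
  is_derive x 1 (fun y => expR (f y)) (a * expR (f x)).
Proof. by move=> df; rewrite mulrC; apply: is_derive1_comp. Qed.
Lemma derX f x a n : is_derive x 1 f a ->
  is_derive x 1 (fun y => f y ^+ n.+1) (n.+1%:R * f x ^+ n * a).
Proof.
move=> df; elim: n => [|n ih].
  by rewrite expr0 mulr1 mul1r (_ : (fun y => _) = f)//; apply/funext => y; rewrite expr1.
rewrite (_ : (fun y => _) = (fun y => f y * f y ^+ n.+1)); last by apply/funext => y; rewrite exprS.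
have := derM df ih; congr (is_derive _ _ _ _).
by rewrite exprS -[n.+2%:R]natr1; ring.
Qed.

Lemma der_cast f x a b : is_derive x 1 f a -> a = b -> is_derive x 1 f b.
Proof. by move=> df <-. Qed.

Lemma mvt f f' a b : (forall x, is_derive x 1 f (f' x)) -> a <= b ->
  exists2 c, a <= c <= b & f b - f a = f' c * (b - a).
Proof.
move=> df ab; have cf : {within `[a, b], continuous f}.
  by apply: derivable_within_continuous => x _; have [] := df x.
have [c] := @MVT_segment R f f' a b ab (fun x _ => df x) cf.
by rewrite in_itv /= => cab ->; exists c.
Qed.

Lemma der_ge0_le f f' a b : (forall x, is_derive x 1 f (f' x)) ->
  (forall x, a <= x <= b -> 0 <= f' x) -> a <= b -> f a <= f b.
Proof.
move=> df f0 ab; have [c cab e] := mvt df ab.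
by rewrite -subr_ge0 e mulr_ge0 ?f0// subr_ge0.
Qed.

End derivatives.

Ltac der1 := first [ notypeclasses refine (derI _) | notypeclasses refine (derC _ _)
  | notypeclasses refine (is_derive_expR _)
  | notypeclasses refine (derD _ _) | notypeclasses refine (derB _ _)
  | notypeclasses refine (derN _) | notypeclasses refine (derX _ _)
  | notypeclasses refine (derM _ _) | notypeclasses refine (derE _) ].
(** Differentiates along the syntax of the function; [der_cast] leaves the equality with the
    announced derivative as one algebraic goal. *)
Ltac der := notypeclasses refine (der_cast _ _); [ repeat der1 | rewrite /= ].

Section exponential_inequalities.
Context (R : realType).
Implicit Types t u x : R.

(** Taylor polynomials of odd degree lie below exp(-x) for x >= 0: the derivative of the product is
    -e^x x^5 / 120. At a rational x where the polynomial is positive, this is the source of the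
    numerical upper bounds on exp. *)
Lemma expR_mul_Taylor5_le1 x : 0 <= x ->
  expR x * (1 - x + x ^+ 2 / 2 - x ^+ 3 / 6 + x ^+ 4 / 24 - x ^+ 5 / 120) <= 1.
Proof.
move=> x0.
have := @der_ge0_le R (fun x => - (expR x * (1 - x + x ^+ 2 / 2 - x ^+ 3 / 6 + x ^+ 4 / 24 - x ^+ 5 / 120)))
  (fun x => expR x * (x ^+ 5 / 120)) 0 x.
rewrite expR0 => h.
have {h}: - (1 * (1 - 0 + 0 ^+ 2 / 2 - 0 ^+ 3 / 6 + 0 ^+ 4 / 24 - 0 ^+ 5 / 120)) <=
  - (expR x * (1 - x + x ^+ 2 / 2 - x ^+ 3 / 6 + x ^+ 4 / 24 - x ^+ 5 / 120)).
  apply: h => //.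
  - move=> y; der; by field.
  - by move=> y /andP[y0 _]; rewrite mulr_ge0 ?expR_ge0// divr_ge0// exprn_ge0.
by rewrite !expr0n /=; lra.
Qed.

Lemma expR_ge_Taylor3 x : 0 <= x -> 1 + x + x ^+ 2 / 2 + x ^+ 3 / 6 <= expR x.
Proof.
move=> x0.
have := @der_ge0_le R (fun x => - (expR (- x) * (1 + x + x ^+ 2 / 2 + x ^+ 3 / 6)))
  (fun x => expR (- x) * (x ^+ 3 / 6)) 0 x.
rewrite oppr0 expR0 => h.
have {h}: - (1 * (1 + 0 + 0 ^+ 2 / 2 + 0 ^+ 3 / 6)) <=
  - (expR (- x) * (1 + x + x ^+ 2 / 2 + x ^+ 3 / 6)).
  apply: h => //.
  - move=> y; der; by field.
  - by move=> y /andP[y0 _]; rewrite mulr_ge0 ?expR_ge0// divr_ge0// exprn_ge0.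
rewrite !expr0n /= => h.
have : expR (- x) * (1 + x + x ^+ 2 / 2 + x ^+ 3 / 6) <= 1 by lra.
by rewrite expRN mulrC ler_pdivrMr ?expR_gt0// mul1r.
Qed.

Lemma expRN_le_Taylor2 x : 0 <= x -> expR (- x) <= 1 - x + x ^+ 2 / 2.
Proof.
move=> x0.
have := @der_ge0_le R (fun x => expR x * (1 - x + x ^+ 2 / 2))
  (fun x => expR x * (x ^+ 2 / 2)) 0 x.
rewrite expR0 => h.
have {h}: 1 * (1 - 0 + 0 ^+ 2 / 2) <= expR x * (1 - x + x ^+ 2 / 2).
  apply: h => //.
  - move=> y; der; by field.
  - by move=> y /andP[y0 _]; rewrite mulr_ge0 ?expR_ge0// divr_ge0// exprn_ge0.
rewrite !expr0n /= => h.
have {}h : 1 <= expR x * (1 - x + x ^+ 2 / 2) by lra.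
by rewrite expRN -div1r ler_pdivrMr ?expR_gt0// mulrC.
Qed.

(** The chord inequality for the convex function exp on [0, t]. Differentiating in [t] with [u]
    fixed reduces it to monotonicity of exp. *)
Lemma expRM_sub1_le t u : 0 <= t -> 0 <= u <= 1 -> expR (t * u) - 1 <= u * (expR t - 1).
Proof.
move=> t0 /andP[u0 u1].
have := @der_ge0_le R (fun t => u * (expR t - 1) - (expR (t * u) - 1))
  (fun t => u * expR t - u * expR (t * u)) 0 t.
rewrite mul0r expR0 => h.
suff : u * (1 - 1) - (1 - 1) <= u * (expR t - 1) - (expR (t * u) - 1) by lra.
apply: h => //.
- by move=> y; der; ring.
- move=> y /andP[y0 _]; rewrite -mulrBr mulr_ge0// subr_ge0 ler_expR.
  by rewrite ler_piMr.
Qed.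

(** The quotient (e^{tu} - 1 - tu) / u^2 is largest at u = 1. For u < 0 the second-order Taylor
    bound suffices, as e^t - 1 - t >= t^2 / 2; for u >= 0 the difference has a [t]-derivative that
    is nonnegative by the chord inequality. *)
Lemma Bennett_ineq t u : 0 <= t -> u <= 1 ->
  expR (t * u) <= 1 + t * u + (expR t - 1 - t) * u ^+ 2.
Proof.
move=> t0 u1; have [u0|/ltW u0] := leP 0 u; last first.
  have tu0 : 0 <= - (t * u) by rewrite -mulrN mulr_ge0// oppr_ge0.
  have := expRN_le_Taylor2 tu0; rewrite opprK => /le_trans; apply.
  have := expR_ge_Taylor3 t0.
  have t3 : 0 <= t ^+ 3 by rewrite exprn_ge0.
  move=> ht; have : (t ^+ 2 / 2) * u ^+ 2 <= (expR t - 1 - t) * u ^+ 2.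
    by apply: ler_wpM2r; [exact: sqr_ge0|lra].
  by rewrite sqrrN exprMn; lra.
have := @der_ge0_le R (fun t => u ^+ 2 * (expR t - 1 - t) - (expR (t * u) - 1 - t * u))
  (fun t => u * (u * (expR t - 1) - (expR (t * u) - 1))) 0 t.
rewrite mul0r expR0 => h.
suff : u ^+ 2 * (1 - 1 - 0) - (1 - 1 - 0) <= u ^+ 2 * (expR t - 1 - t) - (expR (t * u) - 1 - t * u).
  by lra.
apply: h => //.
- by move=> y; der; ring.
- move=> y /andP[y0 _]; rewrite mulr_ge0// subr_ge0.
  by apply: expRM_sub1_le => //; rewrite u0.
Qed.

Lemma mul_expR_sub1_le u : u <= 1 -> 0 <= u * (expR u - 1) <= (expR 1 - 1) * u ^+ 2.
Proof.
move=> u1; have [u0|/ltW u0] := leP 0 u.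
  have := @expRM_sub1_le 1 u ler01; rewrite mul1r u0 u1 => /(_ isT) h.
  by have := expR_ge1Dx u => h2; apply/andP; split; nra.
have e0 : expR u <= 1 by rewrite expR_le1.
have e1 := expR_ge1Dx u; have e2 := expR_ge1Dx (1 : R).
apply/andP; split; first by nra.
nra.
Qed.

Lemma expR1_lt : expR 1 < 2719 / 1000 :> R.
Proof.
have := @expR_mul_Taylor5_le1 (1 / 4); have -> : expR 1 = expR (1 / 4) ^+ 4 :> R by rewrite -expRM_natl; congr expR; field.
move=> /(_ ltac:(lra)); set y := expR _ => h.
have y0 : 0 < y by exact: expR_gt0.
have hy : y <= 113 / 88 by lra.
have y2 : y ^+ 2 <= 155 / 94 by nra.
have : (y ^+ 2) ^+ 2 < 2719 / 1000 by nra.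
by rewrite -exprM.
Qed.

Lemma expR1_gt : 27 / 10 < expR 1 :> R.
Proof.
have := @expR_ge_Taylor3 (1 / 2); have -> : expR 1 = expR (1 / 2) ^+ 2 :> R by rewrite -expRM_natl; congr expR; field.
by move=> /(_ ltac:(lra)); set y := expR _ => h; nra.
Qed.

End exponential_inequalities.

(** * Leave-one-out sums *)

Section window.
Context (R : realType).
Implicit Types lam dl a b s u v : R.

(** The clamp has slope one on all of [a - dl, b + dl]: the margin [dl] on either side lets a step
    of length at most [dl], taken from inside [a, b], be fully visible. *)
Definition Fw lam dl a b s :=
  expR (lam * s) * Num.min (Num.max (s - a + dl) 0) (b - a + 2 * dl).

Lemma clamp_ge0 dl a b s : 0 <= dl -> a <= b ->
  0 <= Num.min (Num.max (s - a + dl) 0) (b - a + 2 * dl).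
Proof. by move=> dl0 ab; rewrite le_min le_max lexx orbT/=; lra. Qed.

Lemma Fw_ge0 lam dl a b s : 0 <= dl -> a <= b -> 0 <= Fw lam dl a b s.
Proof. by move=> dl0 ab; rewrite mulr_ge0 ?expR_ge0 ?clamp_ge0. Qed.

Lemma Fw_le lam dl a b s : 0 <= dl -> a <= b ->
  Fw lam dl a b s <= expR (lam * s) * (b - a + 2 * dl).
Proof. by move=> dl0 ab; rewrite ler_wpM2l ?expR_ge0// ge_min lexx orbT. Qed.

Lemma Fw_nondecreasing lam dl a b u v : 0 <= lam -> 0 <= dl -> a <= b -> u <= v ->
  Fw lam dl a b u <= Fw lam dl a b v.
Proof.
move=> lam0 dl0 ab uv; apply: ler_pM; rewrite ?expR_ge0 ?clamp_ge0//.
  by rewrite ler_expR ler_wpM2l.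
rewrite le_min !ge_min lexx orbT andbT; apply/orP; left.
by rewrite ge_max !le_max lexx orbT andbT; apply/orP; left; lra.
Qed.

Lemma Fw_incr lam dl a b u v : 0 <= lam -> 0 <= dl -> a <= b ->
  a - dl <= u -> u <= v -> v <= b + dl ->
  (v - u) * expR (lam * v) <= Fw lam dl a b v - Fw lam dl a b u.
Proof.
move=> lam0 dl0 ab au uv vb; rewrite /Fw.
have -> : Num.min (Num.max (v - a + dl) 0) (b - a + 2 * dl) = v - a + dl.
  by rewrite max_l; [rewrite min_l//; lra|lra].
have -> : Num.min (Num.max (u - a + dl) 0) (b - a + 2 * dl) = u - a + dl.
  by rewrite max_l; [rewrite min_l//; lra|lra].
have : expR (lam * u) <= expR (lam * v) by rewrite ler_expR ler_wpM2l.
have := expR_ge0 (lam * u); move: (expR _) (expR _) => p q q0 qp; nra.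
Qed.

Lemma Fw_jump_ge0 lam dl a b s x h : 0 <= lam -> 0 <= dl -> a <= b ->
  h = 0 \/ h = x -> 0 <= x * (Fw lam dl a b s - Fw lam dl a b (s - h)).
Proof.
move=> lam0 dl0 ab [->|->]; first by rewrite subr0 subrr mulr0.
have [x0|/ltW x0] := leP 0 x.
  by rewrite mulr_ge0// subr_ge0 Fw_nondecreasing//; lra.
by rewrite mulr_le0// subr_le0 Fw_nondecreasing//; lra.
Qed.

(** Only the first min(dl, |x|) of the step is evaluated, where the clamp is linear; the rest of the
    step helps because [Fw] is nondecreasing. *)
Lemma Fw_jump lam dl a b s x h : 0 <= lam -> 0 <= dl -> a <= s -> s <= b ->
  h = 0 \/ h = x ->
  expR (lam * s) * (`|x| * Num.min dl `|h|) <= x * (Fw lam dl a b s - Fw lam dl a b (s - h)).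
Proof.
move=> lam0 dl0 sa sb hx; have ab : a <= b by exact: le_trans sb.
case: hx => ->; first by rewrite normr0 subr0 subrr mulr0 min_r// mulr0 mulr0.
set m := Num.min dl `|x|.
have m0 : 0 <= m by rewrite le_min dl0 normr_ge0.
have mdl : m <= dl by rewrite ge_min lexx.
have mx : m <= `|x| by rewrite ge_min lexx orbT.
have e0 := expR_ge0 (lam * s).
have [x0|/ltW x0] := leP 0 x.
  rewrite ger0_norm// mulrCA; apply: ler_wpM2l => //.
  rewrite ger0_norm// in mx.
  have h1 : Fw lam dl a b (s - x) <= Fw lam dl a b (s - m) by apply: Fw_nondecreasing => //; lra.
  have := @Fw_incr lam dl a b (s - m) s lam0 dl0 ab ltac:(lra) ltac:(lra) ltac:(lra).
  by rewrite mulrC; lra.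
rewrite ler0_norm// in mx *.
(* For negative [x] the step goes to the right of [s], where the exponential weight is even larger
   ([h3]). *)
have h1 : Fw lam dl a b (s + m) <= Fw lam dl a b (s - x) by apply: Fw_nondecreasing => //; lra.
have h2 := @Fw_incr lam dl a b s (s + m) lam0 dl0 ab ltac:(lra) ltac:(lra) ltac:(lra).
have h3 : expR (lam * s) <= expR (lam * (s + m)) by rewrite ler_expR ler_wpM2l//; lra.
have h4 : m * expR (lam * s) <= Fw lam dl a b (s - x) - Fw lam dl a b s.
  apply: le_trans (le_trans h2 _); last by lra.
  by rewrite (_ : s + m - s = m); [apply: ler_wpM2l|ring].
rewrite mulrCA -[leRHS]mulrNN opprB; apply: ler_wpM2l; first by lra.
by rewrite mulrC.
Qed.

Lemma measurable_Fw d (T : measurableType d) (lam dl : R) (a b s : T -> R) :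
  measurable_fun setT a -> measurable_fun setT b -> measurable_fun setT s ->
  measurable_fun setT (fun w => Fw lam dl (a w) (b w) (s w)).
Proof.
move=> ma mb ms; apply: measurable_funM.
  apply: (@measurableT_comp _ _ _ _ _ _ expR); first exact: measurable_expR.
  by apply: measurable_funM => //; exact: measurable_cst.
apply: measurable_minr.
  apply: measurable_maxr => //; apply: measurable_funD => //.
  exact: measurable_funB.
by apply: measurable_funD => //; exact: measurable_funB.
Qed.

End window.

Section sums.
Context d (Omega : measurableType d) (R : realType) (P : probability Omega R).
Context (n : nat) (X D : 'I_n -> {RV P >-> R}).
Hypothesis indep : forall i, independent2 P (X i) (fun w => (D i w, sample_but X i w)).
Local Notation off := (off X D).
Local Notation Ex := (Ex P).
Local Notation Int := (Int P).

Definition on (i : 'I_n) (Y : Omega -> R) : Prop :=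
  exists2 phi : R -> R, measurable_fun setT phi & Y = fun w => phi (X i w).

Lemma on_Mfun i Y : on i Y -> Mfun Y.
Proof. by move=> [phi mphi ->]; apply: measurableT_comp. Qed.
Lemma on_cst i (c : R) : on i (fun=> c).
Proof. by exists (fun=> c). Qed.
Lemma onD i Y Z : on i Y -> on i Z -> on i (fun w => Y w + Z w).
Proof. by move=> [f mf ->] [g mg ->]; exists (f \+ g) => //; exact: measurable_funD. Qed.
Lemma onB i Y Z : on i Y -> on i Z -> on i (fun w => Y w - Z w).
Proof. by move=> [f mf ->] [g mg ->]; exists (f \- g) => //; exact: measurable_funB. Qed.
Lemma onM i Y Z : on i Y -> on i Z -> on i (fun w => Y w * Z w).
Proof. by move=> [f mf ->] [g mg ->]; exists (f \* g) => //; exact: measurable_funM. Qed.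
Lemma on_comp i (f : R -> R) Y : measurable_fun setT f -> on i Y -> on i (fun w => f (Y w)).
Proof. by move=> mf [g mg ->]; exists (f \o g) => //; exact: measurableT_comp. Qed.
Lemma on_exp i Y : on i Y -> on i (fun w => expR (Y w)).
Proof. by apply: on_comp; exact: measurable_expR. Qed.
Lemma on_norm i Y : on i Y -> on i (fun w => `|Y w|).
Proof. by apply: on_comp; exact: normr_measurable. Qed.
Lemma onX i Y k : on i Y -> on i (fun w => Y w ^+ k).
Proof. by apply: (@on_comp _ (fun x => x ^+ k)); exact: exprn_measurable. Qed.
Lemma on_min i Y Z : on i Y -> on i Z -> on i (fun w => Num.min (Y w) (Z w)).
Proof. by move=> [f mf ->] [g mg ->]; exists (fun x => Num.min (f x) (g x)) => //; exact: measurable_minr. Qed.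
Lemma on_ler i Y Z : on i Y -> on i Z -> on i (fun w => (Y w <= Z w)%R%:R).
Proof. by move=> [f mf ->] [g mg ->]; exists (fun x => (f x <= g x)%R%:R) => //; exact: Mfun_ler. Qed.
Lemma on_ltr i Y Z : on i Y -> on i Z -> on i (fun w => (Y w < Z w)%R%:R).
Proof. by move=> [f mf ->] [g mg ->]; exists (fun x => (f x < g x)%R%:R) => //; exact: Mfun_ltr. Qed.
Lemma on_eqr i Y Z : on i Y -> on i Z -> on i (fun w => (Y w == Z w)%R%:R).
Proof. by move=> [f mf ->] [g mg ->]; exists (fun x => (f x == g x)%R%:R) => //; exact: Mfun_eqr. Qed.

Lemma on_off i j Y : j != i -> on j Y -> off i Y.
Proof. by move=> ji [f mf ->]; apply: off_comp => //; exact: off_X. Qed.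

Lemma on_indep i Y Z : on i Y -> off i Z -> Int Y -> Int Z ->
  Int (fun w => Y w * Z w) /\ Ex (fun w => Y w * Z w) = Ex Y * Ex Z.
Proof. by move=> [f mf ->] oZ IY IZ; exact: (off_indep indep mf oZ IY IZ). Qed.

Definition Sm (Q : pred 'I_n) (h : 'I_n -> Omega -> R) (w : Omega) : R :=
  \sum_(j < n | Q j) h j w.

Definition Qm (Q : pred 'I_n) (j : 'I_n) : pred 'I_n := [pred k | Q k && (k != j)].

Lemma Sm_D1 (Q : pred 'I_n) (h : 'I_n -> Omega -> R) j w : Q j -> Sm Q h w = h j w + Sm (Qm Q j) h w.
Proof. by move=> Qj; rewrite /Sm (bigD1 j). Qed.

Lemma off_Sm Q h i : ~~ Q i -> (forall j, on j (h j)) -> off i (Sm Q h).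
Proof.
move=> Qi oh; apply: off_sum => j Qj; apply: on_off (oh j).
by apply: contra Qi => /eqP <-.
Qed.

Lemma off_Qm Q h i : (forall j, on j (h j)) -> off i (Sm (Qm Q i) h).
Proof. by move=> oh; apply: off_Sm => //; rewrite /Qm /= eqxx andbF. Qed.

Lemma measurable_forall (b : 'I_n -> Omega -> bool) :
  (forall j, measurable_fun setT (b j)) -> measurable_fun setT (fun w => [forall j, b j w]).
Proof.
move=> mb; rewrite (_ : (fun w => _) = (fun w => \sum_(j < n) (~~ b j w)%:R <= 0 :> R)%R).
  apply: measurable_fun_ler; last exact: measurable_cst.
  by apply: Mfun_sum => j _; apply: Mfun_bool; exact: measurable_neg.
apply/funext => w; apply/forallP/idP => [h|h j].
  by rewrite big1// => j _; rewrite h.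
apply/negPn/negP => bj; move: h; rewrite leNgt => /negP; apply.
by rewrite (bigD1 j)//= bj ltr_pwDl// sumr_ge0.
Qed.

Lemma Mfun_Sm Q h : (forall j, on j (h j)) -> Mfun (Sm Q h).
Proof. by move=> oh; apply: Mfun_sum => j _; exact: on_Mfun (oh j). Qed.

Lemma Sm_le Q h w : (forall j, h j w <= 1) -> Sm Q h w <= n%:R.
Proof.
move=> h1; apply: (@le_trans _ _ (\sum_(j < n | Q j) 1)); first exact: ler_sum.
by rewrite sumr_const ler_nat (leq_trans (max_card _))// card_ord.
Qed.

Lemma expR_Sm_bnd Q h t w : 0 <= t -> (forall j, h j w <= 1) ->
  `|expR (t * Sm Q h w)| <= expR (t * n%:R).
Proof.
move=> t0 h1; rewrite ger0_norm ?expR_ge0// ler_expR ler_wpM2l//.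
exact: Sm_le.
Qed.

Lemma Mfun_expR_Sm Q h (t : R) : (forall j, on j (h j)) -> Mfun (fun w => expR (t * Sm Q h w)).
Proof. by move=> oh; apply/Mfun_exp/MfunM; [exact: Mfun_cst|exact: Mfun_Sm]. Qed.

Lemma Int_expR_Sm Q h t : 0 <= t -> (forall j, on j (h j)) -> (forall j w, h j w <= 1) ->
  Int (fun w => expR (t * Sm Q h w)).
Proof.
move=> t0 oh h1; apply: (@Int_bnd _ _ _ _ _ (expR (t * n%:R))).
  exact: Mfun_expR_Sm.
by move=> w; exact: expR_Sm_bnd.
Qed.

(** Bennett's inequality bounds each factor by 1 + v j <= e^{v j}, and independence multiplies the
    factors. The variables need not be centered: their means enter through [v]. *)
Lemma Ex_expR_Sm_le Q h (v : 'I_n -> R) t : 0 <= t -> (forall j, on j (h j)) ->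
  (forall j w, h j w <= 1) -> (forall j, Int (fun w => h j w ^+ 2)) ->
  (forall j, t * Ex (h j) + (expR t - 1 - t) * Ex (fun w => h j w ^+ 2) <= v j) ->
  Ex (fun w => expR (t * Sm Q h w)) <= expR (\sum_(j < n | Q j) v j).
Proof.
move=> t0 oh h1 Ih hv.
have one j : Ex (fun w => expR (t * h j w)) <= expR (v j).
  have Ihj : Int (h j) by apply: Int_of_sq => //; exact: on_Mfun (oh j).
  apply: (le_trans _ (expR_ge1Dx _)).
  apply: (@le_trans _ _ (Ex (fun w => 1 + t * h j w + (expR t - 1 - t) * h j w ^+ 2))).
    apply: Ex_le => [||w]; last exact: Bennett_ineq.
      apply: (@Int_bnd _ _ _ _ _ (expR t)).
        by apply/Mfun_exp/MfunM; [exact: Mfun_cst|exact: on_Mfun (oh j)].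
      move=> w; rewrite ger0_norm ?expR_ge0// ler_expR.
      by rewrite -[leRHS]mulr1 ler_wpM2l.
    apply: IntD; last exact: IntZl.
    by apply: IntD; [exact: Int_cst|exact: IntZl].
  rewrite ExD; [|by apply: IntD; [exact: Int_cst|exact: IntZl]|exact: IntZl].
  rewrite ExD; [|exact: Int_cst|exact: IntZl].
  by rewrite Ex_cst !ExZl// -addrA lerD2l.
(* Induction on the number of summands, for all index sets of that size at once, so that any index
   can be peeled off. *)
elim: {Q}#|Q| {-2}Q (erefl #|Q|) => [|k ih] Q cQ.
  have Q0 : Q =1 xpred0 by exact: card0_eq.
  rewrite (eq_bigl _ _ Q0) big_pred0_eq expR0.
  rewrite -[leRHS](Ex_cst P); apply: Ex_le; [exact: Int_expR_Sm|exact: Int_cst|move=> w].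
  by rewrite /Sm (eq_bigl _ _ Q0) big_pred0_eq mulr0 expR0.
have /card_gt0P[j Qj] : (0 < #|Q|)%N by rewrite cQ.
move: Qj; rewrite unfold_in => Qj.
rewrite (bigD1 j)//= expRD.
have -> : (fun w => expR (t * Sm Q h w)) =
    (fun w => expR (t * h j w) * expR (t * Sm (Qm Q j) h w)).
  by apply/funext => w; rewrite (Sm_D1 h w Qj) mulrDr expRD.
have [||||_ ->] := @on_indep j (fun w => expR (t * h j w)) (fun w => expR (t * Sm (Qm Q j) h w)).
- by apply/on_exp/onM => //; exact: on_cst.
- apply: off_comp; first exact: measurable_expR.
  by apply: offM; [exact: off_cst|exact: off_Qm].
- apply: (@Int_bnd _ _ _ _ _ (expR t)).
    by apply/Mfun_exp/MfunM; [exact: Mfun_cst|exact: on_Mfun (oh j)].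
  move=> w; rewrite ger0_norm ?expR_ge0// ler_expR.
  by rewrite -[leRHS]mulr1 ler_wpM2l.
- exact: Int_expR_Sm.
- apply: ler_pM; [by apply: Ex_ge0 => w; exact: expR_ge0|by apply: Ex_ge0 => w; exact: expR_ge0|exact: one|].
  have Qj' : j \in Q by exact: Qj.
  apply: ih; move: cQ; rewrite (cardD1 j) Qj' => -[<-].
  by apply: eq_card => i; exact: andbC.
Qed.

Lemma Int_Sm_sq Q h : (forall j, on j (h j)) -> (forall j, Int (fun w => h j w ^+ 2)) ->
  Int (fun w => Sm Q h w ^+ 2).
Proof.
move=> oh Ih; rewrite (_ : (fun w => _) = (fun w => \sum_(i < n | Q i) \sum_(j < n | Q j) h i w * h j w)).
  by apply: Int_sum => i _; apply: Int_sum => j _; apply: Int_mul2 => //; exact: on_Mfun.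
apply/funext => w; rewrite expr2 /Sm mulr_suml; apply: eq_bigr => i _.
by rewrite mulr_sumr.
Qed.

Lemma Ex_mul_off0 j Y Z : on j Y -> off j Z -> Int Y -> Int Z -> Ex Y = 0 ->
  Ex (fun w => Y w * Z w) = 0.
Proof. by move=> oY oZ IY IZ Y0; have [_ ->] := on_indep oY oZ IY IZ; rewrite Y0 mul0r. Qed.

Lemma Ex_Sm_sq Q h : (forall j, on j (h j)) -> (forall j, Int (fun w => h j w ^+ 2)) ->
  (forall j, Ex (h j) = 0) ->
  Ex (fun w => Sm Q h w ^+ 2) = \sum_(j < n | Q j) Ex (fun w => h j w ^+ 2).
Proof.
move=> oh Ih h0; have mh j := on_Mfun (oh j).
have mS Q' : Mfun (Sm Q' h) by exact: Mfun_Sm.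
have IS Q' : Int (fun w => Sm Q' h w ^+ 2) by exact: Int_Sm_sq.
have -> : (fun w => Sm Q h w ^+ 2) = (fun w => \sum_(j < n | Q j) h j w * Sm Q h w).
  by apply/funext => w; rewrite -mulr_suml expr2.
rewrite Ex_sum; last by move=> j _; exact: Int_mul2.
apply: eq_bigr => j Qj.
have -> : (fun w => h j w * Sm Q h w) = (fun w => h j w ^+ 2 + h j w * Sm (Qm Q j) h w).
  by apply/funext => w; rewrite (Sm_D1 h w Qj) mulrDr expr2.
rewrite ExD//; last exact: Int_mul2.
rewrite (@Ex_mul_off0 j) ?addr0//; [exact: off_Qm|exact: Int_of_sq|exact: Int_of_sq].
Qed.

(** The variance of an independent sum, each variance being at most the second moment. It serves to
    replace the random sum of capped squares by its mean in the concentration argument. *)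
Lemma Ex_Sm_dev_sq Q u : (forall j, on j (u j)) -> (forall j, Int (fun w => u j w ^+ 2)) ->
  Ex (fun w => (Sm Q u w - \sum_(j < n | Q j) Ex (u j)) ^+ 2) <=
  \sum_(j < n | Q j) Ex (fun w => u j w ^+ 2).
Proof.
move=> ou Iu; have mu j := on_Mfun (ou j).
have Iu1 j : Int (u j) by exact: Int_of_sq.
pose h j w := u j w - Ex (u j).
have Ih j : Int (fun w => h j w ^+ 2).
  rewrite (_ : (fun w => _) = (fun w => u j w ^+ 2 - (2 * Ex (u j)) * u j w + Ex (u j) ^+ 2)).
    by apply: IntD; [apply: IntB => //; exact: IntZl|exact: Int_cst].
  by apply/funext => w; rewrite /h; ring.
have Eh j : Ex (fun w => h j w ^+ 2) <= Ex (fun w => u j w ^+ 2).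
  rewrite (_ : (fun w => _) = (fun w => u j w ^+ 2 - (2 * Ex (u j)) * u j w + Ex (u j) ^+ 2)).
    rewrite ExD; [|by apply: IntB => //; exact: IntZl|exact: Int_cst].
    rewrite ExB//; last exact: IntZl.
    by rewrite Ex_cst ExZl//; have := sqr_ge0 (Ex (u j)); lra.
  by apply/funext => w; rewrite /h; ring.
rewrite (_ : (fun w => _) = (fun w => Sm Q h w ^+ 2)).
  rewrite Ex_Sm_sq//.
  - by apply: ler_sum => j _; exact: Eh.
  - by move=> j; apply: onB => //; exact: on_cst.
  - by move=> j; rewrite ExB//; [rewrite Ex_cst subrr|exact: Int_cst].
by apply/funext => w; rewrite /Sm -sumrB.
Qed.

End sums.

(** * Randomized concentration *)

Section concentration.
Context d (Omega : measurableType d) (R : realType) (P : probability Omega R).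
Context (n : nat) (X D : 'I_n -> {RV P >-> R}).
Hypothesis indep : forall i, independent2 P (X i) (fun w => (D i w, sample_but X i w)).
Local Notation off := (off X D).
Local Notation on := (on X).
Local Notation Ex := (Ex P).
Local Notation Int := (Int P).

Variables (xi hb : 'I_n -> Omega -> R).
Hypothesis oxi : forall j, on j (xi j).
Hypothesis ohb : forall j, on j (hb j).
Hypothesis Ixi : forall j, Int (fun w => xi j w ^+ 2).
Hypothesis xi0 : forall j, Ex (xi j) = 0.
Hypothesis hb_xi : forall j w, hb j w = 0 \/ hb j w = xi j w.

Let mxi j : Mfun (xi j). Proof. exact: on_Mfun (oxi j). Qed.
Let Ixi1 j : Int (xi j). Proof. exact: Int_of_sq. Qed.

Lemma Fw_Sm_bnd Q lam dl (a b c MB ME : R) w : expR (lam * Sm Q hb w) <= ME ->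
  0 <= dl -> a <= b -> b - a <= MB ->
  `|Fw lam dl a b (Sm Q hb w) - c| <= ME * (MB + 2 * dl) + `|c|.
Proof.
move=> eM dl0 ab bM; apply: (le_trans (ler_normB _ _)); rewrite lerD2r.
rewrite ger0_norm ?Fw_ge0//; apply: (le_trans (Fw_le _ _ dl0 ab)).
by apply: ler_pM; rewrite ?expR_ge0//; lra.
Qed.

(* Stein-type identity for [xi] and the increasing function [Fw], whose growth on the window
   [[a, b]] produces the left-hand side. [Z j] is an approximation of the last term of the
   increment that does not depend on [X j]. *)
Lemma concentration (Q : pred 'I_n) (Y a b : Omega -> R) (A : Omega -> bool)
    (u Z : 'I_n -> Omega -> R) (lam dl c MY MB MZ ME theta : R) :
  0 <= lam -> 0 <= dl -> (forall Q' w, expR (lam * Sm Q' hb w) <= ME) ->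
  Mfun Y -> (forall w, 0 <= Y w <= MY) -> Mfun a -> Mfun b ->
  (forall w, a w <= b w) -> (forall w, b w - a w <= MB) ->
  measurable_fun setT A ->
  (forall w, A w -> a w <= Sm Q hb w <= b w) ->
  (forall j, on j (u j)) -> (forall j w, 0 <= u j w <= dl * `|xi j w|) ->
  (forall j w, A w -> Q j -> u j w <= `|xi j w| * Num.min dl `|hb j w|) ->
  (forall j, Q j -> off j (Z j)) -> (forall j w, Q j -> `|Z j w| <= MZ) ->
  theta <= \sum_(j < n | Q j) Ex (u j) ->
  theta * Ex (fun w => Y w * (A w)%:R * expR (lam * Sm Q hb w)) <=
  Ex (fun w => Y w * (Fw lam dl (a w) (b w) (Sm Q hb w) - c) * Sm Q xi w) +
  \sum_(j < n | Q j) Ex (fun w => `|xi j w| *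
     `|Y w * (Fw lam dl (a w) (b w) (Sm (Qm Q j) hb w) - c) - Z j w|) +
  Ex (fun w => Y w * (A w)%:R * expR (lam * Sm Q hb w) *
     `|Sm Q u w - \sum_(j < n | Q j) Ex (u j)|).
Proof.
move=> lam0 dl0 eM mY Y0 ma mb ab bM mA AS ou u0 uA oZ Zb th.
pose F Q' w := Fw lam dl (a w) (b w) (Sm Q' hb w) - c.
pose G Q' w := Y w * F Q' w.
pose MF := ME * (MB + 2 * dl) + `|c|.
have mS Q' : Mfun (Sm Q' hb) by exact: Mfun_Sm.
have mF Q' : Mfun (F Q') by apply: MfunB; [exact: (measurable_Fw lam dl ma mb (mS Q'))|exact: Mfun_cst].
have mG Q' : Mfun (G Q') by exact: MfunM.
have GM Q' w : `|G Q' w| <= MY * MF.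
  rewrite normrM; apply: ler_pM => //; last exact: Fw_Sm_bnd.
  by have /andP[y0 y1] := Y0 w; rewrite ger0_norm.
have mu j : Mfun (u j) by exact: on_Mfun (ou j).
have Iu j : Int (u j).
  apply: (@Int_le _ _ _ _ _ (fun w => dl * `|xi j w|)) => //.
    by move=> w; have /andP[h1 h2] := u0 j w; rewrite ger0_norm.
  by apply/IntZl/Int_norm.
have mAr : Mfun (fun w => (A w)%:R : R) by exact: Mfun_bool.
pose K w := Y w * (A w)%:R * expR (lam * Sm Q hb w).
have mK : Mfun K by apply: MfunM; [exact: MfunM|exact: Mfun_expR_Sm].
have K0 w : 0 <= K w.
  by have /andP[h1 _] := Y0 w; rewrite !mulr_ge0 ?expR_ge0.
have KM w : `|K w| <= MY * ME.
  rewrite ger0_norm//; have /andP[h1 h2] := Y0 w.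
  apply: ler_pM; rewrite ?mulr_ge0 ?expR_ge0//.
    by rewrite -[leRHS]mulr1; apply: ler_pM => //; case: (A w).
have IK : Int K by exact: Int_bnd KM.
have Isu : Int (Sm Q u) by apply: Int_sum => j _.
set EU := \sum_(j < n | Q j) Ex (u j).
have IUE : Int (fun w => `|Sm Q u w - EU|) by apply/Int_norm/IntB => //; exact: Int_cst.
have IxG j Q' : Int (fun w => xi j w * G Q' w) by exact: IntMb (GM _).
have EK0 : 0 <= Ex K by exact: Ex_ge0.
have step1 : theta * Ex K <= Ex (fun w => K w * Sm Q u w) + Ex (fun w => K w * `|Sm Q u w - EU|).
  apply: (le_trans (ler_wpM2r EK0 th)); rewrite -ExD; [|exact: IntbM KM|exact: IntbM KM].
  rewrite -ExZl//; apply: Ex_le; [exact: IntZl|by apply: IntD; exact: IntbM KM|move=> w].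
  rewrite -mulrDr mulrC ler_wpM2l// -/EU.
  by have := ler_norm (- (Sm Q u w - EU)); rewrite normrN; lra.
apply: (le_trans step1); rewrite -/EU lerD2r.
(* On [A] each summand is bounded below a jump of the test function by [Fw_jump]; outside [A] the
   left side vanishes and the jump is nonnegative. The constant [c] cancels in the difference. *)
have step2 : Ex (fun w => K w * Sm Q u w) <=
    Ex (fun w => \sum_(j < n | Q j) (xi j w * G Q w - xi j w * G (Qm Q j) w)).
  apply: Ex_le; [exact: IntbM KM|by apply: Int_sum => j _; exact: IntB|move=> w].
  rewrite /Sm mulr_sumr; apply: ler_sum => j Qj.
  have /andP[y0 _] := Y0 w.
  rewrite -mulrBr /G -mulrBr /F opprB addrA subrK.
  have -> : Sm (Qm Q j) hb w = Sm Q hb w - hb j w by rewrite (Sm_D1 hb w Qj); lra.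
  rewrite /K; have [Aw|_] := boolP (A w); last first.
    rewrite mulr0 !mul0r mulrCA mulr_ge0//.
    exact: Fw_jump_ge0.
  rewrite mulr1 -mulrA [leRHS]mulrCA; apply: ler_wpM2l => //.
  have /andP[aS Sb] := AS w Aw.
  apply: le_trans (Fw_jump lam0 dl0 aS Sb (hb_xi j w)).
  by apply: ler_wpM2l; [exact: expR_ge0|exact: uA].
apply: (le_trans step2).
have IxZ j : Q j -> Int (fun w => xi j w * Z j w).
  by move=> Qj; apply: (IntMb (Ixi1 j) (off_Mfun (oZ j Qj))) => w; exact: Zb.
have IGZ j : Q j -> Int (fun w => xi j w * (G (Qm Q j) w - Z j w)).
  move=> Qj; rewrite (_ : (fun w => _) = (fun w => xi j w * G (Qm Q j) w - xi j w * Z j w)).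
    by apply: IntB => //; exact: IxZ.
  by apply/funext => w; rewrite mulrBr.
have IGZn j : Q j -> Int (fun w => `|xi j w| * `|G (Qm Q j) w - Z j w|).
  move=> Qj; rewrite (_ : (fun w => _) = (fun w => `|xi j w * (G (Qm Q j) w - Z j w)|)).
    exact/Int_norm/IGZ.
  by apply/funext => w; rewrite normrM.
rewrite Ex_sum; last by move=> j _; exact: IntB.
have -> : Ex (fun w => Y w * (Fw lam dl (a w) (b w) (Sm Q hb w) - c) * Sm Q xi w) =
    \sum_(j < n | Q j) Ex (fun w => xi j w * G Q w).
  rewrite -Ex_sum//; congr Ex; apply/funext => w.
  by rewrite /Sm mulr_sumr; apply: eq_bigr => j _; rewrite mulrC.
rewrite -big_split; apply: ler_sum => j Qj /=.
rewrite ExB// lerD2l.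
(* [Z j] is independent of [xi j], which is centered, so it may be subtracted for free. *)
have -> : Ex (fun w => xi j w * G (Qm Q j) w) =
    Ex (fun w => xi j w * (G (Qm Q j) w - Z j w)).
  rewrite -[LHS]subr0 -(@Ex_mul_off0 _ _ _ P _ X D indep j (xi j) (Z j))//.
  - rewrite -ExB//; last exact: IxZ.
    by congr Ex; apply/funext => w; rewrite mulrBr.
  - exact: oZ.
  - apply: (@Int_bnd _ _ _ _ _ MZ); first exact: off_Mfun (oZ j Qj).
    by move=> w; exact: Zb.
rewrite -ExN; last exact: IGZ.
apply: Ex_le; [exact/IntN/IGZ|exact: IGZn|move=> w].
by rewrite -normrM -normrN; exact: ler_norm.
Qed.

End concentration.

(** * One-sided truncation *)

Section one_sided.
Context d (Omega : measurableType d) (R : realType) (P : probability Omega R).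
Context (n : nat) (X D : 'I_n -> {RV P >-> R}).
Hypothesis indep : forall i, independent2 P (X i) (fun w => (D i w, sample_but X i w)).
Local Notation off := (off X D).
Local Notation on := (on X).
Local Notation Ex := (Ex P).
Local Notation Int := (Int P).

Variables (xi : 'I_n -> Omega -> R).
Hypothesis oxi : forall j, on j (xi j).
Hypothesis Ixi : forall j, Int (fun w => xi j w ^+ 2).
Hypothesis xi0 : forall j, Ex (xi j) = 0.
Hypothesis sum_sig : \sum_(j < n) Ex (fun w => xi j w ^+ 2) = 1.

Definition second_moment j := Ex (fun w => xi j w ^+ 2).
(** One-sided on purpose: an upper bound on the values is all that Bennett's inequality needs for t
    >= 0, and discarding large positive values makes the mean nonpositive, so the linear term has
    the favourable sign. *)
Definition trunc_above j w := xi j w * (xi j w <= 1)%R%:R.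

Lemma sig_ge0 j : 0 <= second_moment j.
Proof. by apply: Ex_ge0 => w; exact: sqr_ge0. Qed.

Lemma sum_sig_le1 Q : \sum_(j < n | Q j) second_moment j <= 1.
Proof.
rewrite -sum_sig [leRHS](bigID Q)/= lerDl.
by apply: sumr_ge0 => j _; exact: sig_ge0.
Qed.

Lemma mxi j : Mfun (xi j). Proof. exact: on_Mfun (oxi j). Qed.
Lemma Ixi1 j : Int (xi j). Proof. by apply: Int_of_sq => //; exact: mxi. Qed.

Lemma otr j : on j (trunc_above j).
Proof. by apply: onM => //; apply: on_ler => //; exact: on_cst. Qed.

Lemma tr_or j w : trunc_above j w = 0 \/ trunc_above j w = xi j w.
Proof. by rewrite /trunc_above; case: (_ <= _); rewrite ?mulr1 ?mulr0; [right|left]. Qed.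

Lemma tr_le1 j w : trunc_above j w <= 1.
Proof. by rewrite /trunc_above; case: (leP (xi j w) 1) => h; rewrite ?mulr1 ?mulr0. Qed.

Lemma tr_le j w : trunc_above j w <= xi j w.
Proof. by rewrite /trunc_above; case: (leP (xi j w) 1) => h; rewrite ?mulr1 ?mulr0//; lra. Qed.

Lemma tr_sq_le j w : trunc_above j w ^+ 2 <= xi j w ^+ 2.
Proof. by case: (tr_or j w) => -> //; rewrite expr0n sqr_ge0. Qed.

Lemma Itr2 j : Int (fun w => trunc_above j w ^+ 2).
Proof.
apply: (Int_le _ _ (Ixi j)); first by apply/MfunX/on_Mfun/otr.
by move=> w; rewrite ger0_norm ?sqr_ge0// tr_sq_le.
Qed.

Lemma Itr j : Int (trunc_above j).
Proof. by apply: Int_of_sq; [apply/on_Mfun/otr|exact: Itr2]. Qed.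

Lemma mgf_tr Q t : 0 <= t -> Ex (fun w => expR (t * Sm Q trunc_above w)) <= expR (expR t - 1 - t).
Proof.
move=> t0; have c0 : 0 <= expR t - 1 - t by have := expR_ge1Dx t; lra.
apply: (@le_trans _ _ (expR (\sum_(j < n | Q j) (expR t - 1 - t) * second_moment j))).
  apply: (Ex_expR_Sm_le indep Q t0 otr tr_le1 Itr2) => j.
  have h1 : Ex (trunc_above j) <= 0 by rewrite -(xi0 j); apply: Ex_le; [exact: Itr|exact: Ixi1|exact: tr_le].
  have h2 : Ex (fun w => trunc_above j w ^+ 2) <= second_moment j by apply: Ex_le; [exact: Itr2|exact: Ixi|exact: tr_sq_le].
  by have := ler_wpM2l t0 h1; have := ler_wpM2l c0 h2; lra.
rewrite ler_expR -mulr_sumr -[leRHS]mulr1.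
by apply: ler_wpM2l => //; exact: sum_sig_le1.
Qed.

(** The value of the bound in [mgf_tr] at t = 1, where e^t - 1 - t = e - 2. *)
Definition mgf_const : R := expR (expR 1 - 2).

Lemma mgf_tr1 Q : Ex (fun w => expR (Sm Q trunc_above w)) <= mgf_const.
Proof.
have -> : (fun w => expR (Sm Q trunc_above w)) = (fun w => expR (1 * Sm Q trunc_above w)).
  by apply/funext => w; rewrite mul1r.
by apply: (le_trans (mgf_tr Q ler01)); rewrite ler_expR; lra.
Qed.

Lemma Int_expR_tr Q : Int (fun w => expR (Sm Q trunc_above w)).
Proof.
have -> : (fun w => expR (Sm Q trunc_above w)) = (fun w => expR (1 * Sm Q trunc_above w)).
  by apply/funext => w; rewrite mul1r.
by apply: (Int_expR_Sm (X := X)) => //; [exact: otr|exact: tr_le1].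
Qed.

Let mer Q : Mfun (fun w => expR (Sm Q trunc_above w)).
Proof. exact: Int_Mfun (Int_expR_tr Q). Qed.

Let er_bnd Q w : `|expR (Sm Q trunc_above w)| <= expR n%:R.
Proof. by have := expR_Sm_bnd Q ler01 (tr_le1 ^~ w); rewrite !mul1r. Qed.

Let q j := Ex (fun w => xi j w * expR (trunc_above j w)).

Let etr_bnd j w : `|expR (trunc_above j w)| <= expR 1.
Proof. by rewrite ger0_norm ?expR_ge0// ler_expR tr_le1. Qed.

Let metr j : Mfun (fun w => expR (trunc_above j w)).
Proof. by apply/Mfun_exp/on_Mfun/otr. Qed.

(** Centering replaces e^{tr} by e^{tr} - 1, which makes the tilted first moment a second-order
    quantity. *)
Let q_bnd j : 0 <= q j <= (expR 1 - 1) * second_moment j.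
Proof.
have Ixe : Int (fun w => xi j w * expR (trunc_above j w)) by exact: IntMb (Ixi1 j) (metr j) (etr_bnd j).
have -> : q j = Ex (fun w => xi j w * (expR (trunc_above j w) - 1)).
  rewrite -[LHS]subr0 -(xi0 j) /q -ExB//; last exact: Ixi1.
  by congr Ex; apply/funext => w; rewrite mulrBr mulr1.
have Ie : Int (fun w => xi j w * (expR (trunc_above j w) - 1)).
  rewrite (_ : (fun w => _) = (fun w => xi j w * expR (trunc_above j w) - xi j w)).
    by apply: IntB => //; exact: Ixi1.
  by apply/funext => w; rewrite mulrBr mulr1.
have pw w : 0 <= xi j w * (expR (trunc_above j w) - 1) <= (expR 1 - 1) * xi j w ^+ 2.
  case: (tr_or j w) => trj; last first.
    by rewrite trj; apply: mul_expR_sub1_le; rewrite -trj tr_le1.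
  by rewrite trj expR0 subrr mulr0 lexx mulr_ge0 ?sqr_ge0//.
rewrite Ex_ge0//=; last by move=> w; have /andP[] := pw w.
by rewrite /second_moment -ExZl//; apply: Ex_le => //; [exact: IntZl|move=> w; have /andP[] := pw w].
Qed.

Let split_e (Q : pred 'I_n) j w : Q j -> expR (Sm Q trunc_above w) = expR (trunc_above j w) * expR (Sm (Qm Q j) trunc_above w).
Proof. by move=> Qj; rewrite (Sm_D1 trunc_above w Qj) expRD. Qed.

Let Iqe j : Int (fun w => xi j w * expR (trunc_above j w)).
Proof. exact: IntMb (Ixi1 j) (metr j) (etr_bnd j). Qed.

Let ox_e j : on j (fun w => xi j w * expR (trunc_above j w)).
Proof. by apply: onM => //; apply/on_exp/otr. Qed.

Let off_e Q j : off j (fun w => expR (Sm (Qm Q j) trunc_above w)).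
Proof. by apply: off_comp; [exact: measurable_expR|apply: off_Qm; exact: otr]. Qed.

Let IS1 Q : Int (Sm Q xi).
Proof. by apply: Int_sum => j _; exact: Ixi1. Qed.

Let IWe Q : Int (fun w => Sm Q xi w * expR (Sm Q trunc_above w)).
Proof. exact: IntMb (IS1 Q) (mer Q) (er_bnd Q). Qed.

Let Ex_We Q : 0 <= Ex (fun w => Sm Q xi w * expR (Sm Q trunc_above w)) <= (expR 1 - 1) * mgf_const.
Proof.
have m10 : 0 <= mgf_const by exact: expR_ge0.
have -> : Ex (fun w => Sm Q xi w * expR (Sm Q trunc_above w)) =
    \sum_(j < n | Q j) q j * Ex (fun w => expR (Sm (Qm Q j) trunc_above w)).
  have -> : (fun w => Sm Q xi w * expR (Sm Q trunc_above w)) =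
      (fun w => \sum_(j < n | Q j) (xi j w * expR (trunc_above j w)) * expR (Sm (Qm Q j) trunc_above w)).
    apply/funext => w; rewrite {1}/Sm mulr_suml; apply: eq_bigr => j Qj.
    by rewrite (split_e _ Qj) mulrA.
  rewrite Ex_sum => [|j Qj].
    by apply: eq_bigr => j Qj; have [_ ->] := on_indep indep (ox_e j) (off_e Q j) (Iqe j) (Int_expR_tr _).
  by have [] := on_indep indep (ox_e j) (off_e Q j) (Iqe j) (Int_expR_tr (Qm Q j)).
apply/andP; split.
  apply: sumr_ge0 => j _; rewrite mulr_ge0//; first by have /andP[] := q_bnd j.
  by apply: Ex_ge0 => w; exact: expR_ge0.
apply: (@le_trans _ _ (\sum_(j < n | Q j) ((expR 1 - 1) * mgf_const) * second_moment j)).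
  apply: ler_sum => j Qj; have /andP[q0 q1] := q_bnd j.
  rewrite mulrAC; apply: ler_pM => //; last exact: mgf_tr1.
  by apply: Ex_ge0 => w; exact: expR_ge0.
rewrite -mulr_sumr -[leRHS]mulr1; apply: ler_wpM2l; last exact: sum_sig_le1.
by rewrite mulr_ge0//; have := expR_ge1Dx (1 : R); lra.
Qed.

(** Expand one factor of W^2. The diagonal part contributes e times the variance; off the diagonal,
    the tilted first moment of [xi j] contributes e - 1 and the same expansion of the remaining sum
    contributes another e - 1. *)
Lemma Ex_W2e Q : Ex (fun w => Sm Q xi w ^+ 2 * expR (Sm Q trunc_above w)) <=
  mgf_const * (expR 1 + (expR 1 - 1) ^+ 2).
Proof.
have m10 : 0 <= mgf_const by exact: expR_ge0.
have e1 : 0 <= expR 1 - 1 :> R by have := expR_ge1Dx (1 : R); lra.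
pose B j w := xi j w ^+ 2 * expR (trunc_above j w).
have IB j : Int (B j) by exact: IntMb (Ixi j) (metr j) (etr_bnd j).
have oB j : on j (B j) by apply: onM; [exact: onX|exact/on_exp/otr].
pose Z j w := Sm (Qm Q j) xi w * expR (Sm (Qm Q j) trunc_above w).
have oZ j : off j (Z j) by apply: offM; [exact: off_Qm|exact: off_e].
have IZ j : Int (Z j) by exact: IWe.
have sB j : Ex (B j) <= expR 1 * second_moment j.
  rewrite /second_moment -ExZl//; apply: Ex_le => //; [exact: IntZl|move=> w].
  by rewrite /B mulrC; apply: ler_wpM2r; [exact: sqr_ge0|rewrite ler_expR tr_le1].
have B0 j : 0 <= Ex (B j) by apply: Ex_ge0 => w; rewrite mulr_ge0 ?sqr_ge0 ?expR_ge0.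
have -> : (fun w => Sm Q xi w ^+ 2 * expR (Sm Q trunc_above w)) =
    (fun w => \sum_(j < n | Q j) (B j w * expR (Sm (Qm Q j) trunc_above w) + (xi j w * expR (trunc_above j w)) * Z j w)).
  apply/funext => w; rewrite expr2 -mulrA {1}/Sm mulr_suml; apply: eq_bigr => j Qj.
  by rewrite (split_e _ Qj) (Sm_D1 xi w Qj) /B /Z; ring.
rewrite Ex_sum => [|j Qj]; last first.
  by apply: IntD; [have [] := on_indep indep (oB j) (off_e Q j) (IB j) (Int_expR_tr (Qm Q j))|
    have [] := on_indep indep (ox_e j) (oZ j) (Iqe j) (IZ j)].
apply: (@le_trans _ _ (\sum_(j < n | Q j) (mgf_const * (expR 1 + (expR 1 - 1) ^+ 2)) * second_moment j)); last first.
  rewrite -mulr_sumr -[leRHS]mulr1; apply: ler_wpM2l; last exact: sum_sig_le1.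
  by rewrite mulr_ge0// addr_ge0 ?expR_ge0 ?sqr_ge0.
apply: ler_sum => j Qj.
have [I1 E1] := on_indep indep (oB j) (off_e Q j) (IB j) (Int_expR_tr (Qm Q j)).
have [I2 E2] := on_indep indep (ox_e j) (oZ j) (Iqe j) (IZ j).
rewrite ExD// E1 E2.
have h1 : Ex (B j) * Ex (fun w => expR (Sm (Qm Q j) trunc_above w)) <= expR 1 * second_moment j * mgf_const.
  apply: ler_pM => //; last exact: mgf_tr1.
  by apply: Ex_ge0 => w; exact: expR_ge0.
have h2 : Ex (fun w => xi j w * expR (trunc_above j w)) * Ex (Z j) <=
    (expR 1 - 1) * second_moment j * ((expR 1 - 1) * mgf_const).
  have /andP[q0 q1] := q_bnd j; have /andP[z0 z1] := Ex_We (Qm Q j).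
  exact: ler_pM.
by apply: (le_trans (lerD h1 h2)); rewrite le_eqVlt; apply/orP; left; apply/eqP; ring.
Qed.

End one_sided.

Section Lipschitz.
Context (R : realType).

Lemma normX2_le (x y : R) : `|x| <= y -> `|x ^+ 2| <= y ^+ 2.
Proof. by move=> xy; rewrite normrX lerXn2r// nnegrE// (le_trans _ xy). Qed.

(** Both arguments of the clamp move by at most the change of the width [e]. The parameter [s]
    treats at once the window ending at [z] (s = 1) and the one starting at [z] (s = 0). *)
Lemma Fw_lip lam dl z s e e' S : 0 <= s <= 1 ->
  `|Fw lam dl (z - s * e) (z - s * e + e) S - Fw lam dl (z - s * e') (z - s * e' + e') S|
    <= expR (lam * S) * `|e - e'| :> R.
Proof.
move=> /andP[s0 s1]; rewrite /Fw -mulrBr normrM [`|expR _|]ger0_norm ?expR_ge0//.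
apply: ler_wpM2l; first exact: expR_ge0.
have max_lip (x y : R) : `|Num.max x 0 - Num.max y 0| <= `|x - y|.
  have := ler_norm (x - y); have := ler_norm (- (x - y)); rewrite normrN ler_norml.
  move: `|x - y| => N h1 h2.
  by case: (leP x 0) => hx; case: (leP y 0) => hy; apply/andP; split; lra.
have min_lip (x y u v M : R) : `|x - y| <= M -> `|u - v| <= M ->
    `|Num.min x u - Num.min y v| <= M.
  rewrite !ler_norml => /andP[h1 h2] /andP[h3 h4].
  by case: (leP x u) => h5; case: (leP y v) => h6; apply/andP; split; lra.
apply: min_lip.
  apply: (le_trans (max_lip _ _)).
  rewrite [X in `|X| <= _](_ : _ = s * (e - e')); last by ring.
  by rewrite normrM ger0_norm// -[leRHS]mul1r ler_wpM2r.
by rewrite [X in `|X| <= _](_ : _ = e - e'); last by ring.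
Qed.

End Lipschitz.

(** * Concentration on a window of random width *)

Section near_window_bound.
Context d (Omega : measurableType d) (R : realType) (P : probability Omega R).
Context (n : nat) (X D : 'I_n -> {RV P >-> R}).
Hypothesis indep : forall i, independent2 P (X i) (fun w => (D i w, sample_but X i w)).
Local Notation off := (off X D).
Local Notation on := (on X).
Local Notation Ex := (Ex P).
Local Notation Int := (Int P).

Variables (xi : 'I_n -> Omega -> R).
Hypothesis oxi : forall j, on j (xi j).
Hypothesis Ixi : forall j, Int (fun w => xi j w ^+ 2).
Hypothesis xi0 : forall j, Ex (xi j) = 0.
Hypothesis sum_sig : \sum_(j < n) Ex (fun w => xi j w ^+ 2) = 1.
Local Notation sig := (second_moment P xi).
Local Notation tr := (trunc_above xi).
Local Notation W := (Sm predT xi).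
Local Notation V := (Sm predT tr).

Definition capped_square (dl : R) j w := `|xi j w| * Num.min dl `|xi j w|.

Lemma ouu dl j : on j (capped_square dl j).
Proof. by apply: onM; [exact: on_norm|apply: on_min; [exact: on_cst|exact: on_norm]]. Qed.

Lemma uu_bnd dl j w : 0 <= dl -> 0 <= capped_square dl j w <= dl * `|xi j w|.
Proof.
move=> dl0; rewrite /capped_square mulr_ge0//= ?le_min ?dl0 ?normr_ge0//.
by rewrite mulrC ler_wpM2r// ge_min lexx.
Qed.

Lemma uu_sq dl j w : 0 <= dl -> capped_square dl j w ^+ 2 <= dl ^+ 2 * xi j w ^+ 2.
Proof.
move=> dl0; have /andP[h1 h2] := uu_bnd j w dl0.
rewrite -[xi j w ^+ 2]real_normK ?num_real// -exprMn.
by apply: lerXn2r => //; rewrite nnegrE// mulr_ge0.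
Qed.

Lemma Iuu2 dl j : 0 <= dl -> Int (fun w => capped_square dl j w ^+ 2).
Proof.
move=> dl0; apply: (@Int_le _ _ _ _ _ (fun w => dl ^+ 2 * xi j w ^+ 2)).
- by apply/MfunX/on_Mfun/ouu.
- by move=> w; rewrite ger0_norm ?sqr_ge0//; exact: uu_sq.
- exact: IntZl.
Qed.

Lemma Iuu dl j : 0 <= dl -> Int (capped_square dl j).
Proof. by move=> dl0; apply: Int_of_sq; [exact: on_Mfun (ouu dl j)|exact: Iuu2]. Qed.

Lemma Ex_uu_dev Q dl : 0 <= dl ->
  Ex (fun w => (Sm Q (capped_square dl) w - \sum_(j < n | Q j) Ex (capped_square dl j)) ^+ 2) <= dl ^+ 2.
Proof.
move=> dl0; apply: (le_trans (Ex_Sm_dev_sq indep Q (ouu dl) (fun j => Iuu2 j dl0))).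
apply: (@le_trans _ _ (\sum_(j < n | Q j) dl ^+ 2 * sig j)).
  apply: ler_sum => j _; rewrite /second_moment -ExZl//.
  by apply: Ex_le; [exact: Iuu2|exact: IntZl|move=> w; exact: uu_sq].
rewrite -mulr_sumr -[leRHS]mulr1; apply: ler_wpM2l; first exact: sqr_ge0.
exact: sum_sig_le1.
Qed.

Lemma Int_uu_dev Q dl : 0 <= dl ->
  Int (fun w => (Sm Q (capped_square dl) w - \sum_(j < n | Q j) Ex (capped_square dl j)) ^+ 2).
Proof.
move=> dl0; set c := \sum_(_ | _) _.
rewrite (_ : (fun w => _) = (fun w => Sm Q (capped_square dl) w ^+ 2 - 2 * c * Sm Q (capped_square dl) w + c ^+ 2)).
  apply: IntD; last exact: Int_cst.
  apply: IntB; first by apply: Int_Sm_sq (ouu dl) _ => j; exact: Iuu2.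
  by apply/IntZl/Int_sum => j _; exact: Iuu.
by apply/funext => w; ring.
Qed.

Lemma Ex_W2 Q : Ex (fun w => Sm Q xi w ^+ 2) <= 1.
Proof. by rewrite (Ex_Sm_sq indep)//; exact: sum_sig_le1. Qed.

Lemma Int_W2 Q : Int (fun w => Sm Q xi w ^+ 2).
Proof. exact: Int_Sm_sq oxi Ixi. Qed.

Lemma mW Q : Mfun (Sm Q xi). Proof. exact: Mfun_Sm oxi. Qed.

Definition sqrt_mgf_const : R := expR ((expR 1 - 2) / 2).

Lemma mm_sq : sqrt_mgf_const ^+ 2 = mgf_const R.
Proof. by rewrite /sqrt_mgf_const -expRM_natl; congr expR; field. Qed.

Lemma mm_gt0 : 0 < sqrt_mgf_const. Proof. exact: expR_gt0. Qed.

Let half_sq (x : R) : expR (2^-1 * x) ^+ 2 = expR x.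
Proof. by rewrite -expRM_natl; congr expR; field. Qed.

Let Ieh2 Q : Int (fun w => expR (2^-1 * Sm Q tr w) ^+ 2).
Proof.
rewrite (_ : (fun w => _) = (fun w => expR (Sm Q tr w))); first exact: Int_expR_tr.
by apply/funext => w; rewrite half_sq.
Qed.

Let meh Q : Mfun (fun w => expR (2^-1 * Sm Q tr w)).
Proof. by apply: Mfun_expR_Sm => j; exact: otr. Qed.

Let Ex_eh2 Q : Num.sqrt (Ex (fun w => expR (2^-1 * Sm Q tr w) ^+ 2)) <= sqrt_mgf_const.
Proof.
rewrite -[sqrt_mgf_const]ger0_norm ?expR_ge0// -sqrtr_sqr ler_wsqrtr// mm_sq.
rewrite (_ : (fun w => _) = (fun w => expR (Sm Q tr w))); first exact: (mgf_tr1 indep).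
by apply/funext => w; rewrite half_sq.
Qed.

Let CS_eh Q (f : Omega -> R) (c : R) : 0 <= c -> Mfun f -> Int (fun w => f w ^+ 2) ->
  Ex (fun w => f w ^+ 2) <= c ^+ 2 ->
  Ex (fun w => `|f w| * expR (2^-1 * Sm Q tr w)) <= c * sqrt_mgf_const.
Proof.
move=> c0 mf If fc; have := Ex_CS mf (meh Q) If (Ieh2 Q).
rewrite (_ : (fun w => _ * `|expR _|) = (fun w => `|f w| * expR (2^-1 * Sm Q tr w))); last first.
  by apply/funext => w; rewrite [`|expR _|]ger0_norm ?expR_ge0.
move=> /le_trans; apply; apply: ler_pM; rewrite ?sqrtr_ge0//.
by rewrite -[c]ger0_norm// -sqrtr_sqr ler_wsqrtr.
Qed.

(** [concentration] with Y = 1, c = 0 and exponent 1/2. On [A] no summand is truncated, so the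
    weight is e^{W/2} >= e^{l/2}. The [3] in front of [dl] collects two margins of the window ([T1])
    and the deviation of the capped squares ([T3]). *)
Lemma near_window_bound (eta : Omega -> R) (etaj : 'I_n -> Omega -> R) (x s z l dl : R) (A : Omega -> bool) :
  0 <= s <= 1 -> 0 <= dl -> Mfun eta -> (forall w, 0 <= eta w <= x) ->
  (forall j, off j (etaj j)) -> (forall j w, 0 <= etaj j w <= x) ->
  1 / 2 <= \sum_(j < n) Ex (capped_square dl j) ->
  measurable_fun setT A ->
  (forall w, A w -> forall j, xi j w <= 1) ->
  (forall w, A w -> z - s * eta w <= W w <= z - s * eta w + eta w) ->
  (forall w, A w -> l <= W w) ->
  1 / 2 * expR (l / 2) * Ex (fun w => (A w)%:R) <=
  3 * sqrt_mgf_const * dl +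
  Num.sqrt (mgf_const R * (expR 1 + (expR 1 - 1) ^+ 2)) * Num.sqrt (Ex (fun w => eta w ^+ 2)) +
  sqrt_mgf_const * \sum_(j < n) Num.sqrt (sig j) * Num.sqrt (Ex (fun w => (eta w - etaj j w) ^+ 2)).
Proof.
move=> s01 dl0 meta eta0 oetaj etaj0 EU mA Axi AW Al.
have WV w : A w -> V w = W w.
  by move=> Aw; apply: eq_bigr => j _; rewrite /trunc_above Axi// mulr1.
pose a w := z - s * eta w; pose b w := z - s * eta w + eta w.
pose Z j w := Fw 2^-1 dl (z - s * etaj j w) (z - s * etaj j w + etaj j w) (Sm (Qm predT j) tr w).
have ma : Mfun a by apply: MfunB; [exact: Mfun_cst|apply: MfunM => //; exact: Mfun_cst].
have mb : Mfun b by exact: MfunD.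
have lam0 : 0 <= 2^-1 :> R by rewrite invr_ge0.
have eS Q w : expR (2^-1 * Sm Q tr w) <= expR (2^-1 * n%:R).
  by rewrite ler_expR ler_wpM2l// Sm_le// => j; exact: tr_le1.
have oZ j : predT j -> off j (Z j).
  move=> _; have oa : off j (fun w => z - s * etaj j w).
    by apply: offB; [exact: off_cst|apply: offM => //; exact: off_cst].
  have ob : off j (fun w => z - s * etaj j w + etaj j w) by exact: offD.
  have [h1 mh1 e1] := oa; have [h2 mh2 e2] := ob.
  have [h3 mh3 e3] : off j (Sm (Qm predT j) tr) by apply: off_Qm => k; exact: otr.
  exists (fun y => Fw 2^-1 dl (h1 y) (h2 y) (h3 y)); first exact: measurable_Fw.
  apply/funext => w; rewrite /Z.
  have := congr1 (fun f => f w) e1; have := congr1 (fun f => f w) e2; have := congr1 (fun f => f w) e3.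
  by move=> /= -> -> ->.
have Zb j w : predT j -> `|Z j w| <= expR (2^-1 * n%:R) * (x + 2 * dl) + `|0 : R|.
  move=> _; rewrite -[Z j w]subr0 /Z; have /andP[h1 h2] := etaj0 j w.
  by apply: Fw_Sm_bnd; rewrite ?invr_ge0//; lra.
have := @concentration _ _ _ _ _ X D indep xi tr oxi (otr oxi) Ixi xi0 (tr_or xi)
  predT (fun=> 1) a b A (capped_square dl) Z 2^-1 dl 0 1 x _ (expR (2^-1 * n%:R)) (1 / 2) lam0 dl0 eS.
move=> /(_ _ (Mfun_cst _)) => h.
have {}h := h _ _ ma mb _ _ mA _ (ouu dl) (fun j w => uu_bnd j w dl0) _ oZ Zb EU.
have {}h : 1 / 2 * Ex (fun w => 1 * (A w)%:R * expR (2^-1 * V w)) <=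
  Ex (fun w => 1 * (Fw 2^-1 dl (a w) (b w) (V w) - 0) * W w) +
  \sum_(j < n) Ex (fun w => `|xi j w| * `|1 * (Fw 2^-1 dl (a w) (b w) (Sm (Qm predT j) tr w) - 0) - Z j w|) +
  Ex (fun w => 1 * (A w)%:R * expR (2^-1 * V w) * `|Sm predT (capped_square dl) w - \sum_(j < n) Ex (capped_square dl j)|).
  apply: h.
  - by move=> w; rewrite ler01 lexx.
  - by move=> w; rewrite /a /b; have /andP[h1 h2] := eta0 w; lra.
  - by move=> w; rewrite /a /b; have /andP[h1 h2] := eta0 w; lra.
  - by move=> w Aw; rewrite WV//; exact: AW.
  - by move=> j w Aw _; rewrite /trunc_above Axi// mulr1.
have mAr : Mfun (fun w => (A w)%:R : R) by exact: Mfun_bool.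
have eb Q w : `|expR (2^-1 * Sm Q tr w)| <= expR (2^-1 * n%:R).
  by apply: expR_Sm_bnd => // j; exact: tr_le1.
have IWe Q : Int (fun w => `|Sm Q xi w| * expR (2^-1 * Sm Q tr w)).
  apply: IntMb (meh Q) (eb Q); apply/Int_norm/Int_sum => j _; exact: Ixi1.
have eta_n w : `|eta w| <= x by have /andP[h1 h2] := eta0 w; rewrite ger0_norm.
have Ieta2 : Int (fun w => eta w ^+ 2).
  by apply: (@Int_bnd _ _ _ _ _ (x ^+ 2)) => [|w]; [exact: MfunX|exact: normX2_le].
(* The test function is at most e^{V/2} (eta + 2 dl). Cauchy-Schwarz pairs W e^{V/2} with eta in the
   first part, but |W| with e^{V/2} in the second, where E W^2 <= 1 gives the smaller constant. *)
have T1 : Ex (fun w => 1 * (Fw 2^-1 dl (a w) (b w) (V w) - 0) * W w) <=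
    Num.sqrt (mgf_const R * (expR 1 + (expR 1 - 1) ^+ 2)) * Num.sqrt (Ex (fun w => eta w ^+ 2)) +
    2 * dl * sqrt_mgf_const.
  apply: (@le_trans _ _ (Ex (fun w => `|W w| * expR (2^-1 * V w) * eta w + 2 * dl * (`|W w| * expR (2^-1 * V w))))).
    apply: Ex_le.
    - rewrite (_ : (fun w => _) = (fun w => W w * Fw 2^-1 dl (a w) (b w) (V w))).
        apply: (@IntMb _ _ _ _ _ _ (expR (2^-1 * n%:R) * (x + 2 * dl) + `|0 : R|)).
        + by apply: Int_sum => j _; exact: Ixi1.
        + by apply: measurable_Fw => //; apply: Mfun_Sm => j; exact: otr.
        + move=> w; rewrite -[Fw _ _ _ _ _]subr0; have /andP[h1 h2] := eta0 w.
          by apply: Fw_Sm_bnd; rewrite ?invr_ge0// /a /b; lra.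
      by apply/funext => w; rewrite subr0 mul1r mulrC.
    - by apply: IntD; [exact: IntMb (IWe predT) meta eta_n|exact: IntZl].
    - move=> w; rewrite subr0 mul1r; have /andP[h1 h2] := eta0 w.
      have ab : a w <= b w by rewrite /a /b; lra.
      have F0 := Fw_ge0 2^-1 (V w) dl0 ab; have := Fw_le 2^-1 (V w) dl0 ab.
      rewrite (_ : b w - a w = eta w) => [Fl|]; last by rewrite /a /b; ring.
      apply: (@le_trans _ _ (Fw 2^-1 dl (a w) (b w) (V w) * `|W w|)).
        by apply: ler_wpM2l => //; exact: ler_norm.
      apply: (@le_trans _ _ (expR (2^-1 * V w) * (eta w + 2 * dl) * `|W w|)); first exact: ler_wpM2r.
      by rewrite le_eqVlt; apply/orP; left; apply/eqP; ring.
  rewrite ExD; [|exact: IntMb (IWe predT) meta eta_n|exact: IntZl].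
  rewrite ExZl//; apply: lerD; last first.
    apply: ler_wpM2l; first by rewrite mulr_ge0.
    rewrite -[leRHS]mul1r.
    by apply: CS_eh => //; [exact: mW|exact: Int_W2|rewrite expr1n; exact: Ex_W2].
  have We2 : (fun w => (W w * expR (2^-1 * V w)) ^+ 2) = (fun w => W w ^+ 2 * expR (V w)).
    by apply/funext => w; rewrite exprMn half_sq.
  have IWe2 : Int (fun w => W w ^+ 2 * expR (V w)).
    apply: (@IntMb _ _ _ _ _ _ (expR (1 * n%:R))) => //.
    - exact: Int_W2.
    - by apply/Mfun_exp/Mfun_Sm => j; exact: otr.
    - by move=> w; rewrite -[V w]mul1r; apply: expR_Sm_bnd => // j; exact: tr_le1.
  have := @Ex_CS _ _ _ P (fun w => W w * expR (2^-1 * V w)) eta.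
  rewrite We2 => /(_ (MfunM (mW predT) (meh predT)) meta IWe2 Ieta2) hCS.
  apply: (@le_trans _ _ (Ex (fun w => `|W w * expR (2^-1 * V w)| * `|eta w|))).
    rewrite (_ : (fun w => _ * eta w) = (fun w => `|W w * expR (2^-1 * V w)| * `|eta w|))//.
    apply/funext => w; rewrite normrM [`|expR _|]ger0_norm ?expR_ge0//.
    by have /andP[h1 h2] := eta0 w; rewrite [`|eta w|]ger0_norm.
  apply: (le_trans hCS); apply: ler_wpM2r; first exact: sqrtr_ge0.
  by apply: ler_wsqrtr; exact: (Ex_W2e indep).
(* The Lipschitz bound leaves |xi j| e^{Vj/2} |eta - etaj|; after Cauchy-Schwarz the first square
   factorizes, since [Vj] omits the index j. *)
have T2 j : Ex (fun w => `|xi j w| * `|1 * (Fw 2^-1 dl (a w) (b w) (Sm (Qm predT j) tr w) - 0) - Z j w|) <=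
    sqrt_mgf_const * (Num.sqrt (sig j) * Num.sqrt (Ex (fun w => (eta w - etaj j w) ^+ 2))).
  set Vj := Sm (Qm predT j) tr.
  have metaj : Mfun (etaj j) by exact: off_Mfun (oetaj j).
  have mde : Mfun (fun w => eta w - etaj j w) by exact: MfunB.
  have de_n w : `|eta w - etaj j w| <= x.
    by have /andP[h1 h2] := eta0 w; have /andP[h3 h4] := etaj0 j w; rewrite ler_norml; apply/andP; split; lra.
  have Ide2 : Int (fun w => (eta w - etaj j w) ^+ 2).
    by apply: (@Int_bnd _ _ _ _ _ (x ^+ 2)) => [|w]; [exact: MfunX|exact: normX2_le].
  have mxe : Mfun (fun w => xi j w * expR (2^-1 * Vj w)) by apply: MfunM; [exact: on_Mfun (oxi j)|exact: meh].
  have xe2 : (fun w => (xi j w * expR (2^-1 * Vj w)) ^+ 2) = (fun w => xi j w ^+ 2 * expR (Vj w)).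
    by apply/funext => w; rewrite exprMn half_sq.
  have [Ixe2 Exe2] := @on_indep _ _ _ _ _ X D indep j (fun w => xi j w ^+ 2) (fun w => expR (Vj w))
    (onX 2 (oxi j)) (off_comp (@measurable_expR R) (@off_Qm _ _ _ _ _ X D predT tr j (otr oxi)))
    (Ixi j) (Int_expR_tr oxi (Qm predT j)).
  have := @Ex_CS _ _ _ P (fun w => xi j w * expR (2^-1 * Vj w)) (fun w => eta w - etaj j w) mxe mde.
  rewrite xe2 => /(_ Ixe2 Ide2); rewrite Exe2 => hCS.
  apply: (@le_trans _ _ (Ex (fun w => `|xi j w * expR (2^-1 * Vj w)| * `|eta w - etaj j w|))).
    have mFZ : Mfun (fun w => Fw 2^-1 dl (a w) (b w) (Vj w) - Z j w).
      apply: MfunB; last exact: off_Mfun (oZ j isT).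
      by apply: measurable_Fw => //; apply: Mfun_Sm => k; exact: otr.
    have pw w : `|Fw 2^-1 dl (a w) (b w) (Vj w) - Z j w| <= expR (2^-1 * Vj w) * `|eta w - etaj j w|.
      exact: Fw_lip.
    have Ixen : Int (fun w => `|xi j w * expR (2^-1 * Vj w)| * `|eta w - etaj j w|).
      apply: (@IntMb _ _ _ _ _ _ x); [|exact: Mfun_norm|by move=> w; rewrite normr_id].
      by apply/Int_norm; exact: IntMb (Ixi1 oxi Ixi j) (meh _) (eb _).
    have pw2 w : `|xi j w| * `|1 * (Fw 2^-1 dl (a w) (b w) (Vj w) - 0) - Z j w| <=
        `|xi j w * expR (2^-1 * Vj w)| * `|eta w - etaj j w|.
      rewrite subr0 mul1r normrM [`|expR _|]ger0_norm ?expR_ge0// -mulrA.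
      by apply: ler_wpM2l => //; exact: pw.
    apply: Ex_le => //; apply: (Int_le _ _ Ixen).
      apply: MfunM; first exact/Mfun_norm/mxi.
      by apply: Mfun_norm; rewrite (_ : (fun w => _) = (fun w => Fw 2^-1 dl (a w) (b w) (Vj w) - Z j w))//;
        apply/funext => w; rewrite subr0 mul1r.
    by move=> w; rewrite ger0_norm ?mulr_ge0//; exact: pw2.
  apply: (le_trans hCS); rewrite mulrA; apply: ler_wpM2r; first exact: sqrtr_ge0.
  rewrite sqrtrM; last exact: sig_ge0.
  rewrite mulrC; apply: ler_wpM2r; first exact: sqrtr_ge0.
  rewrite -[leRHS]ger0_norm ?(ltW mm_gt0)// -sqrtr_sqr ler_wsqrtr// mm_sq.
  exact: (mgf_tr1 indep).
(* The capped squares are at most dl |xi j|, so the standard deviation of their sum is at most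
   [dl]. *)
have T3 : Ex (fun w => 1 * (A w)%:R * expR (2^-1 * V w) * `|Sm predT (capped_square dl) w - \sum_(j < n) Ex (capped_square dl j)|) <= dl * sqrt_mgf_const.
  have mdev : Mfun (fun w => Sm predT (capped_square dl) w - \sum_(j < n) Ex (capped_square dl j)).
    by apply: MfunB; [exact: Mfun_Sm (ouu dl)|exact: Mfun_cst].
  have Idev : Int (fun w => `|Sm predT (capped_square dl) w - \sum_(j < n) Ex (capped_square dl j)|).
    by apply/Int_norm/Int_of_sq => //; exact: (Int_uu_dev predT dl0).
  apply: (@le_trans _ _ (Ex (fun w => `|Sm predT (capped_square dl) w - \sum_(j < n) Ex (capped_square dl j)| * expR (2^-1 * V w)))).
    apply: Ex_le.
    - apply: (IntbM Idev (M := expR (2^-1 * n%:R))).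
        by apply: MfunM => //; apply: MfunM => //; exact: Mfun_cst.
      move=> w; rewrite mul1r normrM -[leRHS]mul1r; apply: ler_pM => //.
      by case: (A w); rewrite ?normr1 ?normr0.
    - exact: IntMb Idev (meh predT) (eb predT).
    - move=> w; rewrite mul1r mulrC ler_wpM2l//.
      by case: (A w); rewrite ?mul1r ?mul0r ?expR_ge0.
  by apply: CS_eh => //; [exact: (Int_uu_dev predT dl0)|exact: (Ex_uu_dev predT dl0)].
have LHS : 1 / 2 * expR (l / 2) * Ex (fun w => (A w)%:R) <=
    1 / 2 * Ex (fun w => 1 * (A w)%:R * expR (2^-1 * V w)).
  rewrite -mulrA ler_wpM2l// -ExZl; last exact: Int_bool.
  have IAe : Int (fun w => 1 * (A w)%:R * expR (2^-1 * V w)).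
    apply: IntMb (meh predT) (eb predT); rewrite (_ : (fun w => _) = (fun w => (A w)%:R)); first exact: Int_bool.
    by apply/funext => w; rewrite mul1r.
  apply: Ex_le => //; first exact/IntZl/Int_bool.
  move=> w; rewrite mul1r; have [Aw|_] := boolP (A w); last by rewrite mulr0 mul0r.
  rewrite mulr1 mul1r ler_expR mulrC ler_wpM2l//.
  by rewrite WV//; exact: Al.
apply: (le_trans LHS); apply: (le_trans h).
have T2s := @ler_sum _ _ (index_enum _) predT _ _ (fun j _ => T2 j).
rewrite -mulr_sumr in T2s.
apply: (le_trans (lerD (lerD T1 T2s) T3)).
by rewrite le_eqVlt; apply/orP; left; apply/eqP; ring.
Qed.

End near_window_bound.

(** * Concentration on an independent window *)

Section independent_window.
Context d (Omega : measurableType d) (R : realType) (P : probability Omega R).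
Context (n : nat) (X D : 'I_n -> {RV P >-> R}).
Hypothesis indep : forall i, independent2 P (X i) (fun w => (D i w, sample_but X i w)).
Local Notation off := (off X D).
Local Notation on := (on X).
Local Notation Ex := (Ex P).
Local Notation Int := (Int P).

Variables (xi hb : 'I_n -> Omega -> R).
Hypothesis oxi : forall j, on j (xi j).
Hypothesis ohb : forall j, on j (hb j).
Hypothesis Ixi : forall j, Int (fun w => xi j w ^+ 2).
Hypothesis xi0 : forall j, Ex (xi j) = 0.
Hypothesis sum_sig : \sum_(j < n) Ex (fun w => xi j w ^+ 2) = 1.
Hypothesis hb_xi : forall j w, hb j w = 0 \/ hb j w = xi j w.

Variables (dl : R) (u : 'I_n -> Omega -> R).
Hypothesis dl0 : 0 <= dl.
Hypothesis ou : forall j, on j (u j).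
Hypothesis u_bnd : forall j w, 0 <= u j w <= dl * `|xi j w|.

Let u_sq j w : u j w ^+ 2 <= dl ^+ 2 * xi j w ^+ 2.
Proof.
have /andP[h1 h2] := u_bnd j w.
rewrite -[xi j w ^+ 2]real_normK ?num_real// -exprMn.
by apply: lerXn2r => //; rewrite nnegrE// mulr_ge0.
Qed.

Let Iu2 j : Int (fun w => u j w ^+ 2).
Proof.
apply: (@Int_le _ _ _ _ _ (fun w => dl ^+ 2 * xi j w ^+ 2)).
- by apply/MfunX/on_Mfun/ou.
- by move=> w; rewrite ger0_norm ?sqr_ge0//; exact: u_sq.
- exact: IntZl.
Qed.

Let Iu j : Int (u j).
Proof. by apply: Int_of_sq; [exact: on_Mfun (ou j)|exact: Iu2]. Qed.

Local Notation dev Q := (fun w => Sm Q u w - \sum_(j < n | Q j) Ex (u j)).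

Lemma Ex_dev_sq_le Q : Ex (fun w => (dev Q w) ^+ 2) <= dl ^+ 2.
Proof.
apply: (le_trans (Ex_Sm_dev_sq indep Q ou Iu2)).
apply: (@le_trans _ _ (\sum_(j < n | Q j) dl ^+ 2 * second_moment P xi j)).
  apply: ler_sum => j _; rewrite /second_moment -ExZl//.
  by apply: Ex_le => //; exact: IntZl.
rewrite -mulr_sumr -[leRHS]mulr1; apply: ler_wpM2l; first exact: sqr_ge0.
exact: sum_sig_le1.
Qed.

Lemma Int_dev_sq Q : Int (fun w => (dev Q w) ^+ 2).
Proof.
set c := \sum_(_ | _) _.
rewrite (_ : (fun w => _) = (fun w => Sm Q u w ^+ 2 - 2 * c * Sm Q u w + c ^+ 2)).
  apply: IntD; last exact: Int_cst.
  apply: IntB; first by apply: Int_Sm_sq ou _.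
  by apply/IntZl/Int_sum => j _.
by apply/funext => w; ring.
Qed.

Lemma Mfun_dev Q : Mfun (dev Q).
Proof. by apply: MfunB; [exact: Mfun_Sm ou|exact: Mfun_cst]. Qed.

Lemma Ex_abs_le (f : Omega -> R) (c : R) : 0 <= c -> Mfun f -> Int (fun w => f w ^+ 2) ->
  Ex (fun w => f w ^+ 2) <= c ^+ 2 -> Ex (fun w => `|f w|) <= c.
Proof.
move=> c0 mf If fc; have := Ex_CS mf (Mfun_cst 1) If (Int_cst _ _).
rewrite (_ : (fun w => _ * _) = (fun w => `|f w|)); last by apply/funext => w; rewrite normr1 mulr1.
rewrite Ex_cst expr1n sqrtr1 mulr1 => /le_trans; apply.
by rewrite -[leRHS]ger0_norm// -sqrtr_sqr ler_wsqrtr.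
Qed.

Lemma Ex_sq_Sm_le Q : Ex (fun w => Sm Q xi w ^+ 2) <= 1.
Proof. by rewrite (Ex_Sm_sq indep)//; exact: sum_sig_le1. Qed.

(** When the window is a function of [X i] and the sum omits i, nothing has to be decoupled: for j
    <> i the test function at the sum without j is already independent of [X j]. All remaining
    expectations factor into a part in [X i] and a part in the other variables. *)
Lemma independent_concentration (i : 'I_n) (Y a b : Omega -> R) (A : Omega -> bool)
    (lam MY MB ME theta M : R) :
  0 <= lam -> (forall Q w, expR (lam * Sm Q hb w) <= ME) ->
  on i Y -> (forall w, 0 <= Y w <= MY) -> on i a -> on i b ->
  (forall w, a w <= b w) -> (forall w, b w - a w <= MB) ->
  measurable_fun setT A ->
  (forall w, A w -> a w <= Sm (predC1 i) hb w <= b w) ->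
  (forall j w, A w -> j != i -> u j w <= `|xi j w| * Num.min dl `|hb j w|) ->
  theta <= \sum_(j < n | j != i) Ex (u j) ->
  0 <= M -> Ex (fun w => expR (lam * Sm (predC1 i) hb w) ^+ 2) <= M ^+ 2 ->
  theta * Ex (fun w => Y w * (A w)%:R * expR (lam * Sm (predC1 i) hb w)) <=
  Ex (fun w => Y w * (b w - a w + 3 * dl)) * M.
Proof.
move=> lam0 eM oY Y0 oa ob ab bM mA AS uA th M0 mgf.
set Q := predC1 i; set S := Sm Q hb.
have ma := on_Mfun oa; have mb := on_Mfun ob; have mY := on_Mfun oY.
pose Z j w := Y w * (Fw lam dl (a w) (b w) (Sm (Qm Q j) hb w) - 0).
have oZ j : Q j -> off j (Z j).
  move=> ji; have ij : i != j by rewrite eq_sym.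
  have [h1 mh1 e1] := on_off D ij oa; have [h2 mh2 e2] := on_off D ij ob.
  have [h3 mh3 e3] := off_Qm D Q j ohb.
  apply: offM; first exact: on_off ij oY.
  apply: offB; last exact: off_cst.
  exists (fun y => Fw lam dl (h1 y) (h2 y) (h3 y)); first exact: measurable_Fw.
  apply/funext => w.
  have := congr1 (fun f => f w) e1; have := congr1 (fun f => f w) e2; have := congr1 (fun f => f w) e3.
  by move=> /= -> -> ->.
have Zb j w : Q j -> `|Z j w| <= MY * (ME * (MB + 2 * dl) + `|0 : R|).
  move=> _; rewrite /Z normrM; have /andP[y0 y1] := Y0 w.
  apply: ler_pM => //; first by rewrite ger0_norm.
  exact: Fw_Sm_bnd.
have eb Q' w : `|expR (lam * Sm Q' hb w)| <= ME by rewrite ger0_norm ?expR_ge0.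
have me Q' : Mfun (fun w => expR (lam * Sm Q' hb w)) by exact: Mfun_expR_Sm ohb.
have Ie2 : Int (fun w => expR (lam * S w) ^+ 2).
  apply: (@Int_bnd _ _ _ _ _ (ME ^+ 2)) => [|w]; [exact: MfunX (me Q)|exact: normX2_le (eb Q w)].
have := concentration indep oxi ohb Ixi xi0 hb_xi 0 lam0 dl0 eM mY Y0 ma mb ab bM mA AS ou u_bnd uA oZ Zb th.
(* [Z j] is the leave-one-out test function itself, so the coupling error is zero. *)
rewrite [X in _ + X + _]big1 ?addr0; last first.
  move=> j ji; rewrite -[RHS](Ex_cst P); congr Ex; apply/funext => w.
  by rewrite /Z subrr normr0 mulr0.
move=> /le_trans; apply.
have CS (f : Omega -> R) (c : R) : 0 <= c -> Mfun f -> Int (fun w => f w ^+ 2) ->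
    Ex (fun w => f w ^+ 2) <= c ^+ 2 -> Ex (fun w => `|f w| * expR (lam * S w)) <= c * M.
  move=> c0 mf If fc; have := Ex_CS mf (me Q) If Ie2.
  rewrite (_ : (fun w => _ * `|expR _|) = (fun w => `|f w| * expR (lam * S w))); last first.
    by apply/funext => w; rewrite [`|expR _|]ger0_norm ?expR_ge0.
  move=> /le_trans; apply; apply: ler_pM; rewrite ?sqrtr_ge0//.
    by rewrite -[leRHS]ger0_norm// -sqrtr_sqr ler_wsqrtr.
  by rewrite -[leRHS]ger0_norm// -sqrtr_sqr ler_wsqrtr.
have Yn w : `|Y w| <= MY by have /andP[y0 y1] := Y0 w; rewrite ger0_norm.
have IY : Int Y by exact: Int_bnd Yn.
have iQ : ~~ Q i by rewrite /= eqxx.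
have offE (f : Omega -> R) : off i f -> off i (fun w => `|f w| * expR (lam * S w)).
  move=> of_; apply: offM; first by apply: off_comp of_; exact: normr_measurable.
  apply: off_comp; first exact: measurable_expR.
  by apply: offM; [exact: off_cst|exact: off_Sm].
have prod (G : Omega -> R) (f : Omega -> R) (c MG : R) : on i G -> (forall w, 0 <= G w <= MG) ->
    off i f -> 0 <= c -> Int (fun w => f w ^+ 2) -> Ex (fun w => f w ^+ 2) <= c ^+ 2 ->
    Int (fun w => G w * (`|f w| * expR (lam * S w))) /\
    Ex (fun w => G w * (`|f w| * expR (lam * S w))) <= Ex G * (c * M).
  move=> oG G0 of_ c0 If fc; have mf := off_Mfun of_.
  have IG : Int G.
    by apply: (@Int_bnd _ _ _ _ _ MG) => [|w]; [exact: on_Mfun oG|have /andP[g0 g1] := G0 w; rewrite ger0_norm].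
  have Ife : Int (fun w => `|f w| * expR (lam * S w)).
    by apply: (IntMb _ (me Q) (eb Q)); apply/Int_norm/Int_of_sq.
  have [I1 ->] := on_indep indep oG (offE f of_) IG Ife; split=> //.
  apply: ler_wpM2l; last exact: CS.
  by apply: Ex_ge0 => w; have /andP[] := G0 w.
have oYab : on i (fun w => Y w * (b w - a w + 2 * dl)).
  by apply: onM => //; apply: onD; [exact: onB|exact: on_cst].
have Yab0 w : 0 <= Y w * (b w - a w + 2 * dl) <= MY * (MB + 2 * dl).
  have /andP[y0 y1] := Y0 w; have := ab w; have := bM w => h1 h2.
  have d0 : 0 <= 2 * dl by rewrite mulr_ge0.
  by apply/andP; split; [rewrite mulr_ge0// addr_ge0// subr_ge0|apply: ler_pM => //; [rewrite addr_ge0// subr_ge0|rewrite lerD2r]].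
have offW : off i (Sm Q xi) by exact: off_Sm.
have offDev : off i (dev Q) by apply: offB; [exact: off_Sm|exact: off_cst].
have IW2 : Int (fun w => Sm Q xi w ^+ 2) by exact: Int_Sm_sq oxi Ixi.
have [I1 E1] := prod _ _ 1 _ oYab Yab0 offW ler01 IW2 ltac:(by rewrite expr1n; exact: Ex_sq_Sm_le).
have [I2 E2] := prod _ _ dl _ oY Y0 offDev dl0 (Int_dev_sq Q) (Ex_dev_sq_le Q).
have IS : Int (Sm Q xi) by apply: Int_of_sq => //; exact: Mfun_Sm oxi.
have mS : Mfun S by exact: Mfun_Sm ohb.
have T1 : Ex (fun w => Y w * (Fw lam dl (a w) (b w) (S w) - 0) * Sm Q xi w) <=
    Ex (fun w => Y w * (b w - a w + 2 * dl)) * (1 * M).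
  apply: le_trans E1; apply: Ex_le => //.
    apply: (@IntbM _ _ _ _ _ _ (MY * (ME * (MB + 2 * dl) + `|0 : R|))) => //.
      apply: MfunM => //; apply: MfunB; [exact: (measurable_Fw lam dl ma mb mS)|exact: Mfun_cst].
    move=> w; rewrite normrM; apply: ler_pM => //; exact: Fw_Sm_bnd.
  move=> w; have /andP[y0 y1] := Y0 w; rewrite subr0 -[leLHS]mulrA -[leRHS]mulrA; apply: ler_wpM2l => //.
  have F0 := Fw_ge0 lam (S w) dl0 (ab w); have Fl := Fw_le lam (S w) dl0 (ab w).
  apply: (@le_trans _ _ (Fw lam dl (a w) (b w) (S w) * `|Sm Q xi w|)).
    by apply: ler_wpM2l => //; exact: ler_norm.
  apply: (@le_trans _ _ (expR (lam * S w) * (b w - a w + 2 * dl) * `|Sm Q xi w|)); first exact: ler_wpM2r.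
  by rewrite le_eqVlt; apply/orP; left; apply/eqP; ring.
have T2 : Ex (fun w => Y w * (A w)%:R * expR (lam * S w) * `|dev Q w|) <= Ex Y * (dl * M).
  apply: le_trans E2; have mAr : Mfun (fun w => (A w)%:R : R) by exact: Mfun_bool.
  have pw w : Y w * (A w)%:R * expR (lam * S w) * `|dev Q w| <= Y w * (`|dev Q w| * expR (lam * S w)).
    have /andP[y0 y1] := Y0 w.
    rewrite -!mulrA ler_wpM2l// [leRHS]mulrC; case: (A w); first by rewrite mul1r.
    by rewrite mul0r mulr_ge0 ?expR_ge0.
  apply: Ex_le => //; apply: (Int_le _ _ I2).
    apply: MfunM; last exact/Mfun_norm/Mfun_dev.
    by apply: MfunM; [exact: MfunM|exact: me].
  move=> w; have /andP[y0 y1] := Y0 w.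
  by rewrite ger0_norm// !mulr_ge0 ?expR_ge0.
apply: (le_trans (lerD T1 T2)); rewrite mul1r mulrA -mulrDl ler_wpM2r//.
have Iab : Int (fun w => Y w * (b w - a w + 2 * dl)).
  apply: (@Int_bnd _ _ _ _ _ (MY * (MB + 2 * dl))); first exact: on_Mfun oYab.
  by move=> w; have /andP[h1 h2] := Yab0 w; rewrite ger0_norm.
rewrite -ExZr// -ExD//; last exact: IntZr.
rewrite le_eqVlt; apply/orP; left; apply/eqP; congr Ex; apply/funext => w; ring.
Qed.

End independent_window.

(** * Crossings and ties at the boundary *)

(** The exponent is that of Bennett's bound at t = 2, which controls the second moment of e^S; the
    root 91/10 becomes the constant [M] in [point_exp_concentration]. *)
Lemma exp_sq_bound (R : realType) : expR (expR 2 - 1 - 2) <= (91 / 10) ^+ 2 :> R.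
Proof.
have e1 := @expR1_lt R; have e0 := expR_gt0 (1 : R).
have e2 : expR 2 <= 7393 / 1000 :> R.
  have -> : expR 2 = expR 1 ^+ 2 :> R by rewrite -expRM_natl mulr1.
  by move: (expR 1) e1 e0 => a; nra.
have e4 : expR 4 <= 5466 / 100 :> R.
  have -> : expR 4 = expR 2 ^+ 2 :> R by rewrite -expRM_natl -natrM.
  by move: (expR 2) e2 (expR_gt0 (2 : R)) => a; nra.
have h : expR (393 / 1000) <= 1482 / 1000 :> R.
  have := @expR_mul_Taylor5_le1 R (393 / 1000) ltac:(lra).
  by move: (expR _) (expR_gt0 (393 / 1000 : R)) => b b0 hb; lra.
apply: (@le_trans _ _ (expR (4 + 393 / 1000))); first by rewrite ler_expR; lra.
rewrite expRD; apply: (le_trans (ler_pM (expR_ge0 _) (expR_ge0 _) e4 h)); lra.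
Qed.

Section boundary.
Context d (Omega : measurableType d) (R : realType) (P : probability Omega R).
Context (n : nat) (X D : 'I_n -> {RV P >-> R}).
Hypothesis indep : forall i, independent2 P (X i) (fun w => (D i w, sample_but X i w)).
Local Notation off := (off X D).
Local Notation on := (on X).
Local Notation Ex := (Ex P).
Local Notation Int := (Int P).

Variables (xi : 'I_n -> Omega -> R).
Hypothesis oxi : forall j, on j (xi j).
Hypothesis Ixi : forall j, Int (fun w => xi j w ^+ 2).
Hypothesis xi0 : forall j, Ex (xi j) = 0.
Hypothesis sum_sig : \sum_(j < n) Ex (fun w => xi j w ^+ 2) = 1.
Local Notation sig := (second_moment P xi).
Local Notation tr := (trunc_above xi).
Local Notation W := (Sm predT xi).

Variable x : R.

Definition at_x j (w : Omega) : R := (xi j w == x)%:R.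

Lemma oat_x j : on j (at_x j).
Proof. by apply: on_eqr => //; exact: on_cst. Qed.

Lemma at_x01 j w : 0 <= at_x j w <= 1.
Proof. by rewrite /at_x; case: (_ == _); rewrite ?lexx ?ler01. Qed.

Lemma Iat_x j : Int (at_x j).
Proof.
apply: (@Int_bnd _ _ _ _ _ 1) => [|w]; first exact: on_Mfun (oat_x j).
by have /andP[h1 h2] := at_x01 j w; rewrite ger0_norm.
Qed.

Lemma Ex_at_x_le j : 0 < x -> Ex (at_x j) <= sig j / x ^+ 2.
Proof.
move=> x0; rewrite ler_pdivlMr ?exprn_gt0// /second_moment -ExZr; last exact: Iat_x.
apply: Ex_le => //; first by apply: IntZr; exact: Iat_x.
by move=> w; rewrite /at_x; case: eqP => [->|_]; rewrite ?mul1r ?mul0r ?sqr_ge0.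
Qed.

Lemma sum_Ex_at_x_le Q : 0 < x -> \sum_(j < n | Q j) Ex (at_x j) <= 1 / x ^+ 2.
Proof.
move=> x0; apply: (@le_trans _ _ (\sum_(j < n | Q j) sig j / x ^+ 2)).
  by apply: ler_sum => j _; exact: Ex_at_x_le.
by rewrite -mulr_suml ler_wpM2r ?invr_ge0 ?sqr_ge0//; exact: sum_sig_le1.
Qed.

Lemma Ex_at_x_ge0 j : 0 <= Ex (at_x j).
Proof. by apply: Ex_ge0 => w; have /andP[] := at_x01 j w. Qed.

Let mW Q : Mfun (Sm Q xi). Proof. exact: Mfun_Sm oxi. Qed.

Let Ex_uu_le dl j : 0 <= dl -> Ex (capped_square xi dl j) <= dl.
Proof.
move=> dl0; have Ixi1 : Int (xi j) by apply: Int_of_sq => //; exact: on_Mfun (oxi j).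
apply: (@le_trans _ _ (Ex (fun w => dl * `|xi j w|))).
  apply: Ex_le; [exact: (Iuu oxi Ixi)|by apply/IntZl/Int_norm|].
  by move=> w; have /andP[_] := uu_bnd xi j w dl0.
rewrite ExZl; last exact: Int_norm.
rewrite -[leRHS]mulr1 ler_wpM2l//; apply: Ex_abs_le => //; first exact: on_Mfun (oxi j).
rewrite expr1n; apply: le_trans (sum_sig_le1 sum_sig (pred1 j)).
by rewrite big_pred1_eq.
Qed.

(** Dropping one index costs at most dl E|xi i| <= dl. *)
Let theta_le dl i : 0 <= dl -> 1 / 2 <= \sum_(j < n) Ex (capped_square xi dl j) ->
  1 / 2 - dl <= \sum_(j < n | j != i) Ex (capped_square xi dl j).
Proof. by move=> dl0; rewrite (bigD1 i)//=; have := Ex_uu_le i dl0; lra. Qed.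

(** Concentration for the degenerate window a = b = y without exponential weight. Both terms on the
    right are at most dl times the probability of xi i = x, against a factor 1/2 - dl on the
    left. *)
Lemma point_concentration dl i y : 0 < dl -> 1 / 2 <= \sum_(j < n) Ex (capped_square xi dl j) ->
  Ex (fun w => at_x i w * (Sm (predC1 i) xi w == y)%:R) <= 6 * dl * Ex (at_x i).
Proof.
move=> dl0' EU; have dl0 := ltW dl0'.
have mA : measurable_fun setT (fun w => Sm (predC1 i) xi w == y).
  by apply: measurable_fun_eqr; [exact: mW|exact: measurable_cst].
have p0 := Ex_at_x_ge0 i.
have IA : Int (fun w => at_x i w * (Sm (predC1 i) xi w == y)%:R).
  by apply: (@IntMb _ _ _ _ _ _ 1); [exact: Iat_x|exact: Mfun_bool|move=> w; case: (_ == _); rewrite ?normr1 ?normr0].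
(* For dl > 1/6 the claim is trivial; otherwise 1/2 - dl >= 1/3, and 2 dl divided by 1/3 is 6 dl. *)
have [dlb|dls] := ltP (1 / 6) dl.
  apply: (@le_trans _ _ (Ex (at_x i))).
    apply: Ex_le => //; first exact: Iat_x.
    move=> w; have /andP[h1 h2] := at_x01 i w; rewrite -[leRHS]mulr1 ler_wpM2l//.
    by case: (_ == _).
  by rewrite -[leLHS]mul1r ler_wpM2r//; lra.
set Q := predC1 i.
pose Y := at_x i.
pose Z j w := Y w * (Fw 0 dl y y (Sm (Qm Q j) xi w) - dl).
(* The test function takes values in [0, 2 dl]; subtracting its midpoint halves the supremum. *)
have F01 s : `|Fw 0 dl y y s - dl| <= dl.
  have F0 := Fw_ge0 0 s dl0 (lexx y); have := Fw_le 0 s dl0 (lexx y).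
  by rewrite mul0r expR0 mul1r subrr add0r ler_norml => F1; apply/andP; split; lra.
have oZ j : Q j -> off j (Z j).
  move=> ji; have ij : i != j by rewrite eq_sym.
  have [h3 mh3 e3] := off_Qm D Q j oxi.
  apply: offM; first exact: on_off ij (oat_x i).
  apply: offB; last exact: off_cst.
  exists (fun z => Fw 0 dl y y (h3 z)); first by apply: measurable_Fw.
  by apply/funext => w; have := congr1 (fun f => f w) e3; move=> /= ->.
have Zb j w : Q j -> `|Z j w| <= 1 * dl.
  move=> _; rewrite normrM; apply: ler_pM => //.
  by have /andP[h1 h2] := at_x01 i w; rewrite ger0_norm.
have Y01 w : 0 <= Y w <= 1 by exact: at_x01.
have := @concentration _ _ _ _ _ X D indep xi xi oxi oxi Ixi xi0 (fun j w => or_intror erefl)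
  Q Y (fun=> y) (fun=> y) (fun w => Sm Q xi w == y) (capped_square xi dl) Z 0 dl dl 1 0 (1 * dl) 1 (1 / 2 - dl)
  (lexx 0) dl0 _ (on_Mfun (oat_x i)) Y01 (Mfun_cst _) (Mfun_cst _) (fun=> lexx y) _ mA _ (ouu oxi dl)
  (fun j w => uu_bnd xi j w dl0) (fun j w _ _ => lexx _) oZ Zb (theta_le i dl0 EU).
move=> h; have {}h := h _ _ _.
have {}h : (1 / 2 - dl) * Ex (fun w => Y w * (Sm Q xi w == y)%:R * expR (0 * Sm Q xi w)) <=
    Ex (fun w => Y w * (Fw 0 dl y y (Sm Q xi w) - dl) * Sm Q xi w) +
    \sum_(j < n | Q j) Ex (fun w => `|xi j w| * `|Y w * (Fw 0 dl y y (Sm (Qm Q j) xi w) - dl) - Z j w|) +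
    Ex (fun w => Y w * (Sm Q xi w == y)%:R * expR (0 * Sm Q xi w) *
      `|Sm Q (capped_square xi dl) w - \sum_(j < n | Q j) Ex (capped_square xi dl j)|).
  by apply: h => [Q' w|w|w /eqP ->]; rewrite ?mul0r ?expR0 ?subrr// lexx.
rewrite [X in _ + X + _]big1 ?addr0 in h; last first.
  move=> j ji; rewrite -[RHS](Ex_cst P); congr Ex; apply/funext => w.
  by rewrite /Z subrr normr0 mulr0.
have iQ : ~~ Q i by rewrite /= eqxx.
have prod (f : Omega -> R) (c : R) : off i f -> 0 <= c -> Int (fun w => f w ^+ 2) ->
    Ex (fun w => f w ^+ 2) <= c ^+ 2 ->
    Int (fun w => Y w * `|f w|) /\ Ex (fun w => Y w * `|f w|) <= Ex Y * c.
  move=> of_ c0 If fc; have mf := off_Mfun of_.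
  have If1 : Int (fun w => `|f w|) by apply/Int_norm/Int_of_sq.
  have [I1 ->] := on_indep indep (oat_x i) (off_comp (@normr_measurable R setT) of_) (Iat_x i) If1.
  by split=> //; apply: ler_wpM2l => //; exact: Ex_abs_le.
have [IW EW] := prod (Sm Q xi) 1 (off_Sm D iQ oxi) ler01 (Int_Sm_sq Q oxi Ixi)
  ltac:(by rewrite expr1n; exact: (Ex_sq_Sm_le indep oxi Ixi xi0 sum_sig Q)).
pose dev w := Sm Q (capped_square xi dl) w - \sum_(j < n | Q j) Ex (capped_square xi dl j).
have odev : off i dev by apply: offB; [exact: (off_Sm D iQ (ouu oxi dl))|exact: off_cst].
have [Idev Edev] := prod dev dl odev dl0 (Int_uu_dev oxi Ixi Q dl0) (Ex_uu_dev indep oxi Ixi sum_sig Q dl0).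
have mY := on_Mfun (oat_x i).
have T1 : Ex (fun w => Y w * (Fw 0 dl y y (Sm Q xi w) - dl) * Sm Q xi w) <= dl * Ex Y.
  apply: (@le_trans _ _ (Ex (fun w => dl * (Y w * `|Sm Q xi w|)))); last first.
    by rewrite ExZl// ler_wpM2l//; apply: (le_trans EW); rewrite mulr1.
  have mF : Mfun (fun w => Fw 0 dl y y (Sm Q xi w) - dl).
    by apply: MfunB; [apply: measurable_Fw => //; exact: mW|exact: Mfun_cst].
  have pw w : `|Y w * (Fw 0 dl y y (Sm Q xi w) - dl) * Sm Q xi w| <= dl * (Y w * `|Sm Q xi w|).
    have /andP[h1 h2] := Y01 w; rewrite !normrM (ger0_norm h1) [leRHS]mulrCA -mulrA.
    by rewrite ler_wpM2l// ler_wpM2r.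
  apply: Ex_le; [|exact: IntZl|by move=> w; exact: le_trans (ler_norm _) (pw w)].
  by apply: (Int_le _ pw); [apply: MfunM => //; exact: MfunM|exact: IntZl].
have T2 : Ex (fun w => Y w * (Sm Q xi w == y)%:R * expR (0 * Sm Q xi w) * `|dev w|) <= Ex Y * dl.
  have pw w : Y w * (Sm Q xi w == y)%:R * expR (0 * Sm Q xi w) * `|dev w| <= Y w * `|dev w|.
    have /andP[h1 h2] := Y01 w; rewrite mul0r expR0 mulr1 -mulrA ler_wpM2l//.
    by case: (_ == _); rewrite ?mul1r ?mul0r.
  apply: le_trans Edev; apply: Ex_le => //.
  apply: (Int_le _ _ Idev).
    apply: MfunM; last exact/Mfun_norm/(off_Mfun odev).
    apply: MfunM; first by apply: MfunM => //; exact: Mfun_bool.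
    by apply/Mfun_exp/MfunM; [exact: Mfun_cst|exact: mW].
  by move=> w; have /andP[h1 h2] := Y01 w; rewrite ger0_norm ?mulr_ge0 ?expR_ge0.
have {}h := le_trans h (lerD T1 T2).
have eE : (fun w => Y w * (Sm Q xi w == y)%:R * expR (0 * Sm Q xi w)) =
    (fun w => at_x i w * (Sm (predC1 i) xi w == y)%:R).
  by apply/funext => w; rewrite mul0r expR0 mulr1.
rewrite eE in h.
have A0 : 0 <= Ex (fun w => at_x i w * (Sm (predC1 i) xi w == y)%:R).
  by apply: Ex_ge0 => w; have /andP[h1 h2] := Y01 w; rewrite mulr_ge0.
have h3 : 1 / 3 * Ex (fun w => at_x i w * (Sm (predC1 i) xi w == y)%:R) <= 2 * dl * Ex Y.
  apply: (@le_trans _ _ (dl * Ex Y + Ex Y * dl)); last by lra.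
  by apply: le_trans h; apply: ler_wpM2r => //; lra.
rewrite /Y in h3; lra.
Qed.

(** The weighted form of the previous bound, available because the other summands are at most 1. It
    supplies the factor e^{-y} that is indispensable for large x. *)
Lemma point_exp_concentration dl i y : 0 < dl -> 1 / 2 <= \sum_(j < n) Ex (capped_square xi dl j) ->
  expR y * Ex (fun w => at_x i w *
     ((Sm (predC1 i) xi w == y) && [forall j, (j == i) || (xi j w <= 1)%R])%:R) <=
  61 * dl * Ex (at_x i).
Proof.
move=> dl0' EU; have dl0 := ltW dl0'.
pose A w := (Sm (predC1 i) xi w == y) && [forall j, (j == i) || (xi j w <= 1)%R].
change (expR y * Ex (fun w => at_x i w * (A w)%:R) <= 61 * dl * Ex (at_x i)).
have mA : measurable_fun setT A.
  apply: measurable_and.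
    by apply: measurable_fun_eqr; [exact: mW|exact: measurable_cst].
  apply: (@measurable_forall _ _ R) => j; case: (j == i) => /=; first exact: measurable_cst.
  by apply: measurable_fun_ler; [exact: on_Mfun (oxi j)|exact: measurable_cst].
have AV w : A w -> Sm (predC1 i) tr w = y.
  move=> /andP[/eqP <- /forallP h]; apply: eq_bigr => j /= ji; rewrite /trunc_above.
  by have := h j; rewrite (negbTE ji) /= => ->; rewrite mulr1.
have p0 := Ex_at_x_ge0 i.
have mAr : Mfun (fun w => (A w)%:R : R) by exact: Mfun_bool.
have A1 w : `|(A w)%:R| <= 1 :> R by case: (A w); rewrite ?normr1 ?normr0.
have IA : Int (fun w => at_x i w * (A w)%:R) by exact: IntMb (Iat_x i) mAr A1.
have A0 : 0 <= Ex (fun w => at_x i w * (A w)%:R).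
  by apply: Ex_ge0 => w; have /andP[h1 h2] := at_x01 i w; rewrite mulr_ge0.
have tr1 := tr_le1 xi.
have iQ : ~~ predC1 i i by rewrite /= eqxx.
(* For dl > 1/20 the exponential moment alone, at most e < 61/20, is enough. Otherwise theta = 9/20
   and 3 * (91/10) / (9/20) < 61. *)
have [dlb|dls] := ltP (1 / 20) dl.
  apply: (@le_trans _ _ (Ex (fun w => at_x i w * expR (Sm (predC1 i) tr w)))).
    rewrite -ExZl//; apply: Ex_le; first exact: IntZl.
      apply: (@IntMb _ _ _ _ _ _ (expR (1 * n%:R))); first exact: Iat_x.
        by apply/Mfun_exp/Mfun_Sm/otr.
      by move=> w; rewrite -[Sm _ _ _]mul1r; apply: expR_Sm_bnd.
    move=> w; have /andP[h1 h2] := at_x01 i w; rewrite mulrCA ler_wpM2l//.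
    rewrite -/(A w); have [Aw|_] := boolP (A w); last by rewrite mulr0 expR_ge0.
    by rewrite AV// mulr1.
  have [_ ->] := on_indep indep (oat_x i) (off_comp (@measurable_expR R) (off_Sm D iQ (otr oxi)))
    (Iat_x i) (Int_expR_tr oxi (predC1 i)).
  rewrite mulrC; apply: ler_wpM2r => //; apply: (le_trans (mgf_tr1 indep oxi Ixi xi0 sum_sig _)).
  apply: (@le_trans _ _ (expR 1)); last by have := @expR1_lt R; lra.
  by rewrite /mgf_const ler_expR; have := @expR1_lt R; lra.
have := @independent_concentration _ _ _ _ _ X D indep xi tr oxi (otr oxi) Ixi xi0 sum_sig (tr_or xi)
  dl (capped_square xi dl) dl0 (ouu oxi dl) (fun j w => uu_bnd xi j w dl0) i (at_x i) (fun=> y) (fun=> y) A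
  1 1 0 (expR (1 * n%:R)) (9 / 20) (91 / 10) ler01 _ (oat_x i) (at_x01 i) (on_cst _ _ _) (on_cst _ _ _)
  (fun=> lexx y) _ mA _ _ _ _ _.
move=> h.
have {}h : 9 / 20 * Ex (fun w => at_x i w * (A w)%:R * expR (1 * Sm (predC1 i) tr w)) <=
    Ex (fun w => at_x i w * (y - y + 3 * dl)) * (91 / 10).
  apply: h => //.
  - by move=> Q w; rewrite ler_expR ler_wpM2l// Sm_le.
  - by move=> _; rewrite subrr.
  - by move=> w Aw; rewrite AV// lexx.
  - move=> j w /andP[_ /forallP h] ji; have := h j; rewrite (negbTE ji) /= => xj.
    by rewrite /capped_square /trunc_above xj mulr1.
  - by have := theta_le i dl0 EU; lra.
  - have -> : (fun w => expR (1 * Sm (predC1 i) tr w) ^+ 2) = (fun w => expR (2 * Sm (predC1 i) tr w)).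
      by apply/funext => w; rewrite mul1r -expRM_natl.
    apply: (le_trans (mgf_tr indep oxi Ixi xi0 sum_sig _ _)) => //.
    exact: exp_sq_bound.
rewrite ExZr in h; last exact: Iat_x.
rewrite subrr add0r in h.
have h2 : expR y * Ex (fun w => at_x i w * (A w)%:R) <=
   Ex (fun w => at_x i w * (A w)%:R * expR (1 * Sm (predC1 i) tr w)).
  rewrite -ExZl//; apply: Ex_le; first exact: IntZl.
    apply: (@IntMb _ _ _ _ _ _ (expR (1 * n%:R))) => //; first exact: Mfun_expR_Sm (otr oxi).
    by move=> w; apply: expR_Sm_bnd.
  move=> w; rewrite mulrC; have [Aw|_] := boolP (A w); last by rewrite mulr0 !mul0r.
  by rewrite AV// mul1r.
have := mulr_ge0 dl0 p0; lra.
Qed.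

Let Sm_predT (h : 'I_n -> Omega -> R) i w : Sm predT h w = h i w + Sm (predC1 i) h w.
Proof. by rewrite /Sm (bigD1 i). Qed.

(** Here x - 1 = (z - 2) / 3 for z >= 0: this is the part without absolute values of the product
    event in [gammaz]. *)
Definition is_crossing i w : bool := (1 < xi i w)%R && (x - 1 < Sm (predC1 i) xi w)%R.

Let K Q := Sm Q at_x.
(** A quadratic polynomial in the sum and in the number of values [x] outside a chosen pair. It is
    built to have nonpositive mean for x >= 2, to be nonnegative for S < -1 and at least 1 at S =
    -1, and, for S > -1, to be negative only as far as the surplus of crossings can repay. *)
Let q Q w := (Sm Q xi w - 1) ^+ 2 / 2 - 1 - K Q w * Sm Q xi w + 11 / 6 * K Q w
  + (K Q w ^+ 2 - K Q w) / 2.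

Let K_bnd Q w : 0 <= K Q w <= n%:R.
Proof.
rewrite sumr_ge0 => [|j _]; last by have /andP[] := at_x01 j w.
by apply: Sm_le => j; have /andP[] := at_x01 j w.
Qed.

Let K_norm Q w : `|K Q w| <= n%:R.
Proof. by have /andP[h1 h2] := K_bnd Q w; rewrite ger0_norm. Qed.

Let mK Q : Mfun (K Q). Proof. exact: Mfun_Sm oat_x. Qed.

Let IS Q : Int (Sm Q xi).
Proof. by apply: Int_of_sq => //; exact: Int_Sm_sq oxi Ixi. Qed.

Let IK Q : Int (K Q).
Proof. exact: Int_bnd (K_norm Q). Qed.

Let IKS Q : Int (fun w => K Q w * Sm Q xi w).
Proof. exact: IntbM (K_norm Q). Qed.

Let IK2 Q : Int (fun w => K Q w ^+ 2).
Proof. by apply: (@Int_bnd _ _ _ _ _ (n%:R ^+ 2)) => [|w]; [exact: MfunX|exact: normX2_le]. Qed.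

Let Iq Q : Int (q Q).
Proof.
apply: IntD; last by apply/IntZr/IntB.
apply: IntD; last exact: IntZl.
apply: IntB => //; apply: IntB; last exact: Int_cst.
rewrite (_ : (fun w => _) = (fun w => (Sm Q xi w ^+ 2 - 2 * Sm Q xi w + 1) / 2)).
  apply/IntZr/IntD; last exact: Int_cst.
  by apply: IntB; [exact: Int_Sm_sq oxi Ixi|exact: IntZl].
by apply/funext => w; ring.
Qed.

Let Ex_K Q : Ex (K Q) = \sum_(j < n | Q j) Ex (at_x j).
Proof. by rewrite /K /Sm Ex_sum// => j _; exact: Iat_x. Qed.

(** A summand known to equal [x] contributes [x], and the rest of the sum is independent and
    centered. *)
Let Ex_KS Q : Ex (fun w => K Q w * Sm Q xi w) = x * Ex (K Q).
Proof.
have -> : (fun w => K Q w * Sm Q xi w) =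
    (fun w => \sum_(j < n | Q j) (x * at_x j w + at_x j w * Sm (Qm Q j) xi w)).
  apply/funext => w; rewrite /K {1}/Sm mulr_suml; apply: eq_bigr => j Qj.
  rewrite (Sm_D1 xi w Qj) mulrDr; congr (_ + _).
  by rewrite /at_x; case: eqP => [->|_]; rewrite ?mul1r ?mul0r ?mulr0 ?mulr1.
have I2 j : Int (fun w => at_x j w * Sm (Qm Q j) xi w).
  by apply: (@IntbM _ _ _ _ _ _ 1) => //; [exact: on_Mfun (oat_x j)|
    move=> w; have /andP[h1 h2] := at_x01 j w; rewrite ger0_norm].
rewrite Ex_sum => [|j _]; last by apply: IntD => //; exact/IntZl/Iat_x.
rewrite Ex_K mulr_sumr; apply: eq_bigr => j Qj.
rewrite ExD//; last exact/IntZl/Iat_x.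
rewrite ExZl; last exact: Iat_x.
have [_ ->] := on_indep indep (oat_x j) (off_Qm D Q j oxi) (Iat_x j) (IS (Qm Q j)).
rewrite [X in _ + _ * X](_ : _ = 0) ?mulr0 ?addr0//.
by rewrite Ex_sum => [|k _]; [rewrite big1|apply: Int_of_sq => //; exact: on_Mfun (oxi k)].
Qed.

Let Ex_K2 Q : Ex (fun w => K Q w ^+ 2) <= Ex (K Q) + Ex (K Q) ^+ 2.
Proof.
have -> : (fun w => K Q w ^+ 2) =
    (fun w => \sum_(j < n | Q j) (at_x j w + at_x j w * K (Qm Q j) w)).
  apply/funext => w; rewrite expr2 {1}/K {1}/Sm mulr_suml; apply: eq_bigr => j Qj.
  rewrite /K (Sm_D1 at_x w Qj) mulrDr; congr (_ + _).
  by rewrite /at_x; case: eqP => _; rewrite ?mul1r ?mul0r ?mulr0 ?mulr1.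
have I2 j : Int (fun w => at_x j w * K (Qm Q j) w).
  by apply: (IntMb (Iat_x j) (mK _)) => w; exact: K_norm.
rewrite Ex_sum => [|j _]; last by apply: IntD => //; exact/Iat_x.
rewrite expr2 {2}Ex_K mulr_suml Ex_K -big_split; apply: ler_sum => j Qj /=.
rewrite ExD//; last exact: Iat_x.
rewrite lerD2l.
have [_ ->] := on_indep indep (oat_x j) (off_Qm D Q j oat_x) (Iat_x j) (IK (Qm Q j)).
rewrite ler_wpM2l ?Ex_at_x_ge0//.
rewrite -Ex_K; apply: Ex_le; [exact: IK|exact: IK|move=> w; rewrite /K (Sm_D1 at_x w Qj) lerDr].
by have /andP[] := at_x01 j w.
Qed.

(** The square contributes at most 1, which -1 cancels. With k = E K the rest is at most k (11/6 - x
    + k/2), negative since x >= 2 and k <= 1 / x^2 <= 1/4. *)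
Let Ex_q Q : 2 <= x -> Ex (q Q) <= 0.
Proof.
move=> x2; have x0 : 0 < x by lra.
have ES : Ex (Sm Q xi) = 0.
  by rewrite Ex_sum => [|k _]; [rewrite big1|apply: Int_of_sq => //; exact: on_Mfun (oxi k)].
have I1 : Int (fun w => Sm Q xi w ^+ 2) by exact: Int_Sm_sq oxi Ixi.
have E1 := Ex_sq_Sm_le indep oxi Ixi xi0 sum_sig Q.
have -> : q Q = (fun w => (1 / 2 * Sm Q xi w ^+ 2 - Sm Q xi w) + (- (1 / 2) + (- 1 * (K Q w * Sm Q xi w) +
    (4 / 3 * K Q w + 1 / 2 * K Q w ^+ 2)))).
  by apply/funext => w; rewrite /q; field.
have J1 : Int (fun w => 4 / 3 * K Q w + 1 / 2 * K Q w ^+ 2) by apply: IntD; exact: IntZl.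
have J2 : Int (fun w => - 1 * (K Q w * Sm Q xi w) + (4 / 3 * K Q w + 1 / 2 * K Q w ^+ 2)).
  by apply: IntD => //; exact: IntZl.
have J3 : Int (fun w => 1 / 2 * Sm Q xi w ^+ 2 - Sm Q xi w) by apply: IntB => //; exact: IntZl.
rewrite ExD//; last by apply: IntD => //; exact: Int_cst.
rewrite ExB//; last exact: IntZl.
rewrite ExD//; last exact: Int_cst.
rewrite ExD//; last exact: IntZl.
rewrite ExD//; [|exact: IntZl|exact: IntZl].
rewrite !ExZl// Ex_cst ES Ex_KS.
have := Ex_K2 Q; have := sum_Ex_at_x_le Q x0; rewrite -Ex_K.
have k0 : 0 <= Ex (K Q) by apply: Ex_ge0 => w; have /andP[] := K_bnd Q w.
move: (Ex (K Q)) k0 => k k0 kx E2.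
have x1 : 1 / x ^+ 2 <= 1 / 4 by rewrite !div1r lef_pV2 ?posrE ?exprn_gt0//; nra.
by nra.
Qed.

Let pair_sum w : \sum_(i < n) \sum_(j < n | j != i) at_x i w * at_x j w =
  K predT w ^+ 2 - K predT w.
Proof.
rewrite expr2 {2}/K /Sm mulr_suml -sumrB; apply: eq_bigr => i _ /=.
have -> : \sum_(j < n) at_x j w = at_x i w + \sum_(j < n | j != i) at_x j w by rewrite (bigD1 i).
rewrite -mulr_sumr.
have [->|->] : at_x i w = 0 \/ at_x i w = 1 by rewrite /at_x; case: eqP => _; [right|left].
  by rewrite !mul0r subr0.
by rewrite !mul1r; lra.
Qed.

(* [K] variables equal to [x] make [K] crossings as soon as [W > 2 * x - 1]: this over-counting
   pays for the event [W = 2 * x - 1]. *)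
Lemma crossing_or_double_le : 2 <= x ->
  Ex (fun w => ([exists i, is_crossing i w] || ((1 < K predT w)%R && (W w == 2 * x - 1)))%:R) <=
  \sum_(i < n) Ex (fun w => (is_crossing i w)%:R).
Proof.
move=> x2; have mcr i : measurable_fun setT (is_crossing i).
  by apply: measurable_and; apply: measurable_fun_ltr; [exact: measurable_cst|exact: on_Mfun (oxi i)|exact: measurable_cst|exact: mW].
have Icr i : Int (fun w => (is_crossing i w)%:R) by exact: Int_bool.
pose G i j := fun w => at_x i w * (at_x j w * q (Qm (predC1 i) j) w).
have I1 i j : Int (fun w => at_x j w * q (Qm (predC1 i) j) w).
  by apply: (IntbM (Iq _) (M := 1)); [exact: on_Mfun (oat_x j)|
    move=> w; have /andP[h1 h2] := at_x01 j w; rewrite ger0_norm].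
have IG i j : Int (G i j).
  by apply: (IntbM (I1 i j) (M := 1)); [exact: on_Mfun (oat_x i)|
    move=> w; have /andP[h1 h2] := at_x01 i w; rewrite ger0_norm].
have off_q k Q : ~~ Q k -> off k (q Q).
  move=> Qk; have oS : off k (Sm Q xi) by exact: off_Sm.
  have oK : off k (K Q) by apply: off_Sm Qk oat_x.
  apply: offD; last by apply: offM; [apply: offB => //; exact: offM|exact: off_cst].
  apply: offD; last by apply: offM => //; exact: off_cst.
  apply: offB; last exact: offM.
  apply: offB; last exact: off_cst.
  apply: offM; last exact: off_cst.
  by apply: (@off_comp _ _ _ _ _ _ _ _ (fun y => y ^+ 2)); [exact: exprn_measurable|apply: offB => //; exact: off_cst].
(* The two indicators and the polynomial in the other variables are independent, so the sign is that
   of the mean of [q]. *)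
have EG i j : j != i -> Ex (G i j) <= 0.
  move=> ji; have oi : off i (fun w => at_x j w * q (Qm (predC1 i) j) w).
    apply: offM; first exact: on_off ji (oat_x j).
    by apply: off_q; rewrite /Qm /= eqxx.
  have [_ ->] := on_indep indep (oat_x i) oi (Iat_x i) (I1 i j).
  have oj : off j (q (Qm (predC1 i) j)) by apply: off_q; rewrite /Qm /= eqxx andbF.
  have [_ ->] := on_indep indep (oat_x j) oj (Iat_x j) (Iq _).
  by rewrite mulr_ge0_le0 ?Ex_at_x_ge0// mulr_ge0_le0 ?Ex_at_x_ge0// Ex_q.
have IGG : Int (fun w => 1 / 2 * \sum_(i < n) \sum_(j < n | j != i) G i j w).
  by apply: IntZl; apply: Int_sum => i _; apply: Int_sum.
apply: (@le_trans _ _ (Ex (fun w => \sum_(i < n) (is_crossing i w)%:R +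
    1 / 2 * \sum_(i < n) \sum_(j < n | j != i) G i j w))); last first.
  rewrite ExD//; last exact: Int_sum.
  rewrite Ex_sum// -[leRHS]addr0 lerD2l ExZl; last by apply: Int_sum => i _; apply: Int_sum.
  rewrite Ex_sum => [|i _]; last exact: Int_sum.
  rewrite mulr_ge0_le0//; apply: sumr_le0 => i _.
  by rewrite Ex_sum//; apply: sumr_le0 => j ji; exact: EG.
apply: Ex_le.
- apply: Int_bool; apply: measurable_or.
    rewrite (_ : (fun w => _) = (fun w => ~~ [forall i, ~~ is_crossing i w])).
      by apply: measurable_neg; apply: (@measurable_forall _ _ R) => i; exact: measurable_neg.
    by apply/funext => w; rewrite negb_forall; apply: eq_existsb => i; rewrite negbK.
  by apply: measurable_and; [apply: measurable_fun_ltr; [exact: measurable_cst|exact: mK]|apply: measurable_fun_eqr; [exact: mW|exact: measurable_cst]].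
- by apply: IntD => //; exact: Int_sum.
move=> w; set N := \sum_(i < n) _; set k := K predT w; set S := W w - 2 * x.
have -> : \sum_(i < n) \sum_(j < n | j != i) G i j w =
    (k ^+ 2 - k) * ((S - 1) ^+ 2 / 2 - 1 - (k - 2) * S + 11 / 6 * (k - 2) + ((k - 2) ^+ 2 - (k - 2)) / 2).
  rewrite -pair_sum mulr_suml; apply: eq_bigr => i _; rewrite mulr_suml; apply: eq_bigr => j ji.
  rewrite /G /at_x; case: (eqVneq (xi i w) x) => [xix|_]; last by rewrite !mul0r.
  case: (eqVneq (xi j w) x) => [xjx|_]; last by rewrite !mul0r !mulr0 mul0r.
  have ai : at_x i w = 1 by rewrite /at_x xix eqxx.
  have aj : at_x j w = 1 by rewrite /at_x xjx eqxx.
  have -> : S = Sm (Qm (predC1 i) j) xi w.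
    by rewrite /S (Sm_predT xi i w) (Sm_D1 (Q := predC1 i) xi w ji) xix xjx; lra.
  have -> : k - 2 = K (Qm (predC1 i) j) w.
    by rewrite /k /K (Sm_predT at_x i w) (Sm_D1 (Q := predC1 i) at_x w ji) ai aj; lra.
  by rewrite /q !mul1r.
have N0 : 0 <= N by apply: sumr_ge0.
have N1 : [exists i, is_crossing i w] -> 1 <= N.
  by move=> /existsP[i ci]; rewrite /N (bigD1 i)//= ci lerDl sumr_ge0.
have Nk : 2 * x - 1 < W w -> k <= N.
  move=> Wx; apply: ler_sum => i _; rewrite /at_x; case: eqP => // xix.
  rewrite (_ : is_crossing i w)//; apply/andP; split; first by rewrite xix; lra.
  by move: Wx; rewrite (Sm_predT xi i w) xix; lra.
have [m km] : exists m : nat, k = m%:R.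
  by exists (\sum_(j < n) (xi j w == x))%N; rewrite natr_sum.
have [m1|m2] := leqP m 1.
  have -> : k ^+ 2 - k = 0 by rewrite km; case: m m1 {km} => [|[|]]//; rewrite ?expr0n ?expr1n /=; lra.
  have -> : (1 < k) = false by rewrite km ltr1n ltnNge m1.
  by rewrite mul0r mulr0 addr0 orbF; case: [exists _, _] N1 => // /(_ isT).
have k2 : 2 <= k by rewrite km (ler_nat R 2 m).
(* True because [k] is an integer; a real k between 2 and 3 would break the count. *)
have k23 : 0 <= (k - 2) * (k - 3).
  have [m3|m3] := leqP m 2.
    have -> : k = 2 by rewrite km; congr (_%:R); apply/eqP; rewrite eqn_leq m3 m2.
    by lra.
  have : 3 <= k by rewrite km (ler_nat R 3 m).
  by move=> h; rewrite mulr_ge0; lra.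
have kk : 2 <= k ^+ 2 - k by nra.
set qq := _ - _ + _ + _.
have b1 (b : bool) : b%:R <= 1 :> R by case: b.
have [Sp|Sm1|Sm1] := ltgtP S (-1).
- have q0 : 0 <= qq by rewrite /qq; nra.
  have -> : (W w == 2 * x - 1) = false by apply/negbTE/eqP => h; move: Sp; rewrite /S h; lra.
  rewrite andbF orbF; apply: (@le_trans _ _ N); first by case: [exists _, _] N1 => // /(_ isT).
  by rewrite lerDl mulr_ge0// mulr_ge0//; lra.
(* Completing the square gives qq >= (k - 5) / 3, and k + k (k - 1) (k - 5) / 6 = 1 + (k - 1) (k -
   2) (k - 3) / 6. The coefficient 11/6 in [q] produces exactly this identity. *)
- have Nk' : k <= N by apply: Nk; move: Sm1; rewrite /S; lra.
  apply: (le_trans (b1 _)).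
  have qb : (k - 5) / 3 <= qq.
    have -> : qq = (S - 1 - (k - 2)) ^+ 2 / 2 + (k - 5) / 3 by rewrite /qq; field.
    by rewrite lerDr divr_ge0// sqr_ge0.
  have : (k ^+ 2 - k) * ((k - 5) / 3) <= (k ^+ 2 - k) * qq by rewrite ler_wpM2l//; lra.
  have : 0 <= (k - 1) * ((k - 2) * (k - 3)) by rewrite mulr_ge0//; lra.
  by lra.
- apply: (le_trans (b1 _)).
  have q1 : 1 <= qq by rewrite /qq Sm1; nra.
  have : (k ^+ 2 - k) * 1 <= (k ^+ 2 - k) * qq by rewrite ler_wpM2l//; lra.
  by lra.
Qed.

End boundary.

(** * Numerical constants *)

Section numerical_bounds.
Context (R : realType).

Lemma expR_third_ge : 1395 / 1000 <= expR (1 / 3) :> R.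
Proof. by have := @expR_ge_Taylor3 R (1 / 3) ltac:(lra); lra. Qed.

(** After multiplying out, the claim is 6 e^x <= (59/5) e^{1/3} x^2. It follows from e^{(x - 1)/2}
    <= x, the chord bound between x = 1 and x = 17/5, as e^{6/5} <= 17/5. *)
Lemma boundary_small (x : R) : 1 <= x <= 17 / 5 ->
  6 / x ^+ 2 <= 59 / 5 * expR (- ((3 * x - 1) / 3)).
Proof.
move=> /andP[x1 x2]; have x0 : 0 < x ^+ 2 by rewrite exprn_gt0//; lra.
rewrite (_ : - ((3 * x - 1) / 3) = 1 / 3 - x); last by field.
rewrite expRB ler_pdivrMr//.
rewrite [leRHS](_ : _ = 59 / 5 * expR (1 / 3) * x ^+ 2 / expR x); last by ring.
rewrite ler_pdivlMr ?expR_gt0//.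
have h : expR (x / 2 - 1 / 2) <= x.
  have hu : 0 <= (x / 2 - 1 / 2) / (6 / 5) <= 1 by apply/andP; split; lra.
  have := @expRM_sub1_le R (6 / 5) _ ltac:(lra) hu.
  rewrite [X in expR X](_ : _ = x / 2 - 1 / 2); last by field.
  have e : expR (6 / 5) <= 17 / 5 :> R.
    have := @expR_mul_Taylor5_le1 R (6 / 5) ltac:(lra).
    by move: (expR _) (expR_gt0 (6 / 5 : R)) => b b0 hb; lra.
  have : (x / 2 - 1 / 2) / (6 / 5) * (expR (6 / 5) - 1) <= (x / 2 - 1 / 2) / (6 / 5) * (12 / 5).
    by apply: ler_wpM2l; lra.
  lra.
have -> : expR x = expR 1 * expR (x / 2 - 1 / 2) ^+ 2.
  by rewrite -expRM_natl -expRD; congr expR; field.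
have h2 : expR (x / 2 - 1 / 2) ^+ 2 <= x ^+ 2 by apply: lerXn2r; rewrite ?nnegrE ?expR_ge0//; lra.
have e1 := @expR1_lt R; have e3 := expR_third_ge.
have h3 : expR 1 * expR (x / 2 - 1 / 2) ^+ 2 <= 2719 / 1000 * x ^+ 2.
  by apply: ler_pM; rewrite ?expR_ge0 ?sqr_ge0//; exact: ltW.
have : x ^+ 2 * (1395 / 1000) <= x ^+ 2 * expR (1 / 3) by rewrite ler_wpM2l// ltW.
lra.
Qed.

(** The factors e^{-x} cancel and 61 e <= (59/5) e^{1/3} x^2 remains, for which x >= 17/5 leaves
    ample room. *)
Lemma boundary_large (x : R) : 17 / 5 <= x ->
  61 / expR (x - 1) / x ^+ 2 <= 59 / 5 * expR (- ((3 * x - 1) / 3)).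
Proof.
move=> x1; have x0 : 0 < x ^+ 2 by rewrite exprn_gt0//; lra.
have x2 : (17 / 5) ^+ 2 <= x ^+ 2 by apply: lerXn2r; rewrite ?nnegrE//; lra.
rewrite (_ : - ((3 * x - 1) / 3) = (1 / 3 - 1) - (x - 1)); last by field.
have -> : expR (1 / 3 - 1 - (x - 1)) = expR (1 / 3) / expR 1 / expR (x - 1) by rewrite !(expRB (_ - _)) !(expRB (1 / 3)).
rewrite mulrA mulrAC ler_pM2r ?invr_gt0 ?expR_gt0// ler_pdivrMr//.
rewrite [leRHS](_ : _ = 59 / 5 * expR (1 / 3) * x ^+ 2 / expR 1); last by ring.
rewrite ler_pdivlMr ?expR_gt0//.
have e1 := @expR1_lt R; have e3 := expR_third_ge.
have c0 : 0 <= 1395 / 1000 :> R by lra.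
have := ler_pM (sqr_ge0 _) c0 x2 e3.
lra.
Qed.

Let e16 : expR (1 / 6) <= 1182 / 1000 :> R.
Proof.
have := @expR_mul_Taylor5_le1 R (1 / 6) ltac:(lra).
by move: (expR _) (expR_gt0 (1 / 6 : R)) => b b0 hb; lra.
Qed.

Lemma mm_le : sqrt_mgf_const R <= 1437 / 1000.
Proof.
have e1 := @expR1_lt R.
apply: (@le_trans _ _ (expR (36 / 100))); first by rewrite /sqrt_mgf_const ler_expR; lra.
have := @expR_mul_Taylor5_le1 R (36 / 100) ltac:(lra).
by move: (expR _) (expR_gt0 (36 / 100 : R)) => b b0 hb; lra.
Qed.

(** The factor 2 undoes the 1/2 in front of the window probability, and e^{1/6} is the loss in
    e^{-(2x - 1)/2} = e^{1/6} e^{-z/3}. The same two factors appear in the next two bounds. *)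
Lemma const_delta : 2 * expR (1 / 6) * (3 * sqrt_mgf_const R) <= 51 / 5.
Proof.
have h := ler_pM (expR_ge0 _) (ltW (mm_gt0 R)) e16 mm_le.
by lra.
Qed.

Lemma const_coupling : 2 * expR (1 / 6) * sqrt_mgf_const R <= 18 / 5.
Proof.
have h := ler_pM (expR_ge0 _) (ltW (mm_gt0 R)) e16 mm_le.
by lra.
Qed.

Lemma const_remainder :
  2 * expR (1 / 6) * Num.sqrt (mgf_const R * (expR 1 + (expR 1 - 1) ^+ 2)) <= 17 / 2.
Proof.
have e1 := @expR1_lt R; have e2 := @expR1_gt R.
have m0 := mm_gt0 R; have m1 := mm_le.
rewrite -mm_sq sqrtrM ?sqr_ge0// sqrtr_sqr (ger0_norm (ltW m0)).
have h : Num.sqrt (expR 1 + (expR 1 - 1) ^+ 2) <= 24 / 10 :> R.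
  rewrite -[leRHS]ger0_norm; last by lra.
  rewrite -sqrtr_sqr ler_wsqrtr//.
  by move: (expR 1) e1 e2 => a; nra.
have h1 := ler_pM (expR_ge0 _) (ltW m0) e16 m1.
have h2 := ler_pM (mulr_ge0 (expR_ge0 _) (ltW m0)) (sqrtr_ge0 _) h1 h.
by lra.
Qed.

End numerical_bounds.

(** * Ties, crossings and the window probability *)

Section part1.
Context d (Omega : measurableType d) (R : realType) (P : probability Omega R).
Context (n : nat) (X D : 'I_n -> {RV P >-> R}).
Hypothesis indep : forall i, independent2 P (X i) (fun w => (D i w, sample_but X i w)).
Local Notation off := (off X D).
Local Notation on := (on X).
Local Notation Ex := (Ex P).
Local Notation Int := (Int P).

Variables (xi : 'I_n -> Omega -> R).
Hypothesis oxi : forall j, on j (xi j).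
Hypothesis Ixi : forall j, Int (fun w => xi j w ^+ 2).
Hypothesis xi0 : forall j, Ex (xi j) = 0.
Hypothesis sum_sig : \sum_(j < n) Ex (fun w => xi j w ^+ 2) = 1.
Local Notation sig := (second_moment P xi).
Local Notation W := (Sm predT xi).

Variables (x dl : R).
Hypothesis dl0 : 0 < dl.
Hypothesis EU : 1 / 2 <= \sum_(j < n) Ex (capped_square xi dl j).
Local Notation crossing := (is_crossing xi x).

Let W_D1 i w : W w = xi i w + Sm (predC1 i) xi w.
Proof. by rewrite /Sm (bigD1 i). Qed.

Let mxi j : Mfun (xi j). Proof. exact: on_Mfun (oxi j). Qed.
Let mW Q : Mfun (Sm Q xi). Proof. exact: Mfun_Sm oxi. Qed.

Let mcr i : measurable_fun setT (crossing i).
Proof.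
by apply: measurable_and; apply: measurable_fun_ltr; [exact: measurable_cst|exact: mxi|exact: measurable_cst|exact: mW].
Qed.

Let measurable_exists (b : 'I_n -> Omega -> bool) :
  (forall i, measurable_fun setT (b i)) -> measurable_fun setT (fun w => [exists i, b i w]).
Proof.
move=> mb; rewrite (_ : (fun w => _) = (fun w => ~~ [forall i, ~~ b i w])).
  by apply: measurable_neg; apply: (@measurable_forall _ _ R) => i; exact: measurable_neg.
by apply/funext => w; rewrite negb_forall; apply: eq_existsb => i; rewrite negbK.
Qed.

(** What is left of the window when some summand exceeds 1 but there is neither a summand above [x]
    nor a crossing. *)
Definition tie w : bool := [&& (1 < x)%R, W w == 2 * x - 1, [exists i, xi i w == x]
  & [forall j, (xi j w <= 1)%R || (xi j w == x)]].

Let mtie : measurable_fun setT tie.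
Proof.
apply: measurable_and; first exact: measurable_cst.
apply: measurable_and; first by apply: measurable_fun_eqr; [exact: mW|exact: measurable_cst].
apply: measurable_and.
  by apply: measurable_exists => i; apply: measurable_fun_eqr; [exact: mxi|exact: measurable_cst].
apply: (@measurable_forall _ _ R) => i; apply: measurable_or.
  by apply: measurable_fun_ler; [exact: mxi|exact: measurable_cst].
by apply: measurable_fun_eqr; [exact: mxi|exact: measurable_cst].
Qed.

Let mct : measurable_fun setT (fun w => [exists i, crossing i w] || tie w).
Proof. by apply: measurable_or => //; exact: measurable_exists. Qed.

Let b01 (b : bool) : (0 <= b%:R :> R) && (b%:R <= 1 :> R).
Proof. by case: b; rewrite ?lexx ?ler01. Qed.

Let ex_le_sum (b : 'I_n -> bool) : [exists i, b i]%:R <= \sum_(i < n) (b i)%:R :> R.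
Proof.
case: existsP => [[i bi]|_]; last by apply: sumr_ge0 => i _; have /andP[] := b01 (b i).
by rewrite (bigD1 i)//= bi lerDl; apply: sumr_ge0 => j _; have /andP[] := b01 (b j).
Qed.

(** There is no tie for x <= 1. Up to x = 17/5 the unweighted point bound is summed over the index
    attaining [x]. Beyond, exponential decay is needed, which requires the other summands to be at
    most 1; ties with several summands equal to [x] are therefore absorbed by the crossings. *)
Lemma crossing_or_tie_le :
  Ex (fun w => ([exists i, crossing i w] || tie w)%:R) <=
  \sum_(i < n) Ex (fun w => (crossing i w)%:R) + 59 / 5 * expR (- ((3 * x - 1) / 3)) * dl.
Proof.
have Icr i : Int (fun w => (crossing i w)%:R) by exact: Int_bool.
have Ict : Int (fun w => ([exists i, crossing i w] || tie w)%:R) by exact: Int_bool.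
have ecr : Ex (fun w => \sum_(i < n) (crossing i w)%:R) = \sum_(i < n) Ex (fun w => (crossing i w)%:R).
  by rewrite Ex_sum.
have [x1|x1] := leP x 1.
  apply: (@le_trans _ _ (Ex (fun w => \sum_(i < n) (crossing i w)%:R))).
    apply: Ex_le => //; first exact: Int_sum.
    by move=> w; rewrite /tie ltNge x1 /= orbF; exact: ex_le_sum.
  by rewrite ecr lerDl mulr_ge0 ?(ltW dl0)// mulr_ge0// expR_ge0.
have x0 : 0 < x by lra.
have le_or (a b : bool) : (a || b)%:R <= a%:R + b%:R :> R by case: a; case: b => /=; lra.
have [x2|x2] := leP x (17 / 5).
  pose T i w := at_x xi x i w * (Sm (predC1 i) xi w == x - 1)%:R.
  have IT i : Int (T i).
    apply: (IntMb (M := 1)); [exact: Iat_x| |by move=> w; rewrite ger0_norm; have /andP[] := b01 (Sm (predC1 i) xi w == x - 1)].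
    by apply: Mfun_bool; apply: measurable_fun_eqr; [exact: mW|exact: measurable_cst].
  apply: (@le_trans _ _ (Ex (fun w => \sum_(i < n) (crossing i w)%:R + \sum_(i < n) T i w))).
    apply: Ex_le => //; first by apply: IntD; exact: Int_sum.
    move=> w; apply: (le_trans (le_or _ _)); apply: lerD; first exact: ex_le_sum.
    have T0 i : 0 <= T i w by rewrite mulr_ge0.
    case: (boolP (tie w)) => [|_]; last exact: sumr_ge0.
    move=> /and4P[_ /eqP Wx /existsP[i /eqP xix] _].
    rewrite (bigD1 i)//= [T i w](_ : _ = 1); first by rewrite lerDl; apply: sumr_ge0.
    rewrite /T /at_x xix eqxx mul1r; have := W_D1 i w; rewrite Wx xix => h.
    by rewrite (_ : _ == _ = true)//; apply/eqP; lra.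
  rewrite ExD; [|exact: Int_sum|exact: Int_sum].
  rewrite ecr lerD2l Ex_sum//.
  apply: (@le_trans _ _ (\sum_(i < n) 6 * dl * Ex (at_x xi x i))).
    by apply: ler_sum => i _; exact: (point_concentration indep oxi Ixi xi0 sum_sig).
  rewrite -mulr_sumr; have h := sum_Ex_at_x_le oxi Ixi sum_sig predT x0.
  apply: (@le_trans _ _ (6 * dl * (1 / x ^+ 2))); first by rewrite ler_wpM2l// mulr_ge0// ltW.
  rewrite (_ : 6 * dl * (1 / x ^+ 2) = 6 / x ^+ 2 * dl); last by field; rewrite gt_eqF.
  by rewrite ler_wpM2r ?(ltW dl0)// boundary_small//; apply/andP; split; lra.
pose B i w := (Sm (predC1 i) xi w == x - 1) && [forall j, (j == i) || (xi j w <= 1)%R].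
pose T i w := at_x xi x i w * (B i w)%:R.
have mB i : measurable_fun setT (B i).
  apply: measurable_and.
    by apply: measurable_fun_eqr; [exact: mW|exact: measurable_cst].
  apply: (@measurable_forall _ _ R) => j; case: (j == i) => /=; first exact: measurable_cst.
  by apply: measurable_fun_ler; [exact: mxi|exact: measurable_cst].
have IT i : Int (T i).
  apply: (IntMb (M := 1)); [exact: Iat_x|exact: Mfun_bool|].
  by move=> w; rewrite ger0_norm; have /andP[] := b01 (B i w).
pose C w := [exists i, crossing i w] || ((1 < Sm predT (at_x xi x) w)%R && (W w == 2 * x - 1)).
have mC : measurable_fun setT C.
  apply: measurable_or; first exact: measurable_exists.
  apply: measurable_and; last by apply: measurable_fun_eqr; [exact: mW|exact: measurable_cst].
  by apply: measurable_fun_ltr; [exact: measurable_cst|apply: Mfun_Sm => j; exact: oat_x].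
apply: (@le_trans _ _ (Ex (fun w => (C w)%:R + \sum_(i < n) T i w))).
  apply: Ex_le => //; first by apply: IntD; [exact: Int_bool|exact: Int_sum].
  move=> w; have T0 i : 0 <= T i w.
    by rewrite mulr_ge0.
  have sT0 : 0 <= \sum_(i < n) T i w by exact: sumr_ge0.
  rewrite /C; case: (boolP [exists i, crossing i w]) => [_|_] /=; first by rewrite lerDl.
  case: (boolP (tie w)) => [|_]; last by rewrite addr_ge0//; have /andP[] := b01 ((1 < Sm predT (at_x xi x) w)%R && (W w == 2 * x - 1)).
  move=> /and4P[_ /eqP Wx /existsP[i /eqP xix] /forallP all]; rewrite Wx eqxx andbT.
  have ai : at_x xi x i w = 1 by rewrite /at_x xix eqxx.
  (* With two summands equal to [x] the event is already in [C]; with a single one, the definition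
     of a tie makes all others at most 1, which is [B i]. *)
  have [K1|K1] := ltP 1 (Sm predT (at_x xi x) w); first by rewrite lerDl.
  rewrite add0r (bigD1 i)//= [T i w](_ : _ = 1); first by rewrite lerDl; apply: sumr_ge0.
  rewrite /T ai mul1r (_ : B i w)//; apply/andP; split.
    by have := W_D1 i w; rewrite Wx xix => h; apply/eqP; lra.
  apply/forallP => j; case: (eqVneq j i) => //= ji; have /orP[//|/eqP xjx] := all j.
  move: K1; rewrite /Sm (bigD1 i)//= (bigD1 j)//= ai {1}/at_x xjx eqxx /=.
  have : 0 <= \sum_(k < n | (k != i) && (k != j)) at_x xi x k w.
    by apply: sumr_ge0 => k _; have /andP[] := at_x01 xi x k w.
  lra.
rewrite ExD; [|exact: Int_bool|exact: Int_sum].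
apply: lerD; first by apply: (crossing_or_double_le indep oxi Ixi xi0 sum_sig); lra.
rewrite Ex_sum//.
apply: (@le_trans _ _ (\sum_(i < n) (61 / expR (x - 1) * dl) * Ex (at_x xi x i))).
  apply: ler_sum => i _.
  have := point_exp_concentration indep oxi Ixi xi0 sum_sig x i (x - 1) dl0 EU.
  rewrite -ler_pdivlMl ?expR_gt0// => /le_trans; apply.
  by rewrite le_eqVlt; apply/orP; left; apply/eqP; rewrite -!mulrA; ring.
rewrite -mulr_sumr; have h := sum_Ex_at_x_le oxi Ixi sum_sig predT x0.
have c0 : 0 <= 61 / expR (x - 1) * dl by rewrite mulr_ge0 ?(ltW dl0)// divr_ge0// expR_ge0.
apply: (le_trans (ler_wpM2l c0 h)).
rewrite (_ : 61 / expR (x - 1) * dl * (1 / x ^+ 2) = 61 / expR (x - 1) / x ^+ 2 * dl); last by rewrite div1r; ring.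
by rewrite ler_wpM2r ?(ltW dl0)// boundary_large// ltW.
Qed.

(** The event splits into [A], where no summand exceeds 1 and the exponential weight is usable, and
    its complement, covered by large summands, crossings and ties. *)
Lemma window_probability_le (eta : Omega -> R) (etaj : 'I_n -> Omega -> R) (s z : R) (E : Omega -> bool) :
  x = (z + 1) / 3 ->
  0 <= s <= 1 -> Mfun eta -> (forall w, 0 <= eta w <= x) ->
  (forall j, off j (etaj j)) -> (forall j w, 0 <= etaj j w <= x) ->
  measurable_fun setT E ->
  (forall w, E w -> z - s * eta w <= W w <= z - s * eta w + eta w) ->
  (forall w, E w -> 2 * x - 1 <= W w) ->
  Ex (fun w => (E w)%:R) <=
  \sum_(i < n) Ex (fun w => (x < xi i w)%R%:R) +
  \sum_(i < n) Ex (fun w => (crossing i w)%:R) +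
  expR (- (z / 3)) * (22 * dl + 17 / 2 * Num.sqrt (Ex (fun w => eta w ^+ 2)) +
    18 / 5 * \sum_(j < n) Num.sqrt (sig j) * Num.sqrt (Ex (fun w => (eta w - etaj j w) ^+ 2))).
Proof.
move=> xz s01 meta eta0 oetaj etaj0 mE EW Ex1.
pose A w := E w && [forall j, (xi j w <= 1)%R].
have mA : measurable_fun setT A.
  apply: measurable_and => //; apply: (@measurable_forall _ _ R) => j.
  by apply: measurable_fun_ler; [exact: mxi|exact: measurable_cst].
have mbig i : measurable_fun setT (fun w => (x < xi i w)%R).
  by apply: measurable_fun_ltr; [exact: measurable_cst|exact: mxi].
have Ibig i : Int (fun w => (x < xi i w)%R%:R) by exact: Int_bool.
apply: (@le_trans _ _ (Ex (fun w => \sum_(i < n) (x < xi i w)%R%:R +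
    ([exists i, crossing i w] || tie w)%:R + (A w)%:R))).
  apply: Ex_le; first exact: Int_bool.
    by apply: IntD; [apply: IntD; [exact: Int_sum|exact: Int_bool]|exact: Int_bool].
  move=> w; have /andP[t0 t1] := b01 ([exists i, crossing i w] || tie w).
  have s0 : 0 <= \sum_(i < n) (x < xi i w)%R%:R :> R by apply: sumr_ge0.
  have /andP[A0 _] := b01 (A w).
  case: (boolP (E w)) => Ew; last by rewrite !addr_ge0.
  have Wx := Ex1 w Ew.
  have [all1|] := boolP [forall j, (xi j w <= 1)%R].
    by rewrite /A Ew all1 lerDr addr_ge0.
  rewrite negb_forall => /existsP[i]; rewrite -ltNge => xi1.
  have [/existsP[j xjx]|] := boolP [exists j, (x < xi j w)%R].
    rewrite (bigD1 j)//= xjx -!addrA lerDl !addr_ge0//.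
    by apply: sumr_ge0.
  rewrite negb_exists => /forallP lex.
  rewrite (_ : _ || _ = true); first by rewrite -addrA addrCA lerDl addr_ge0.
  case: (boolP [exists i, crossing i w]) => //=.
  rewrite negb_exists => /forallP nocr.
  (* Without a crossing, W - xi j <= x - 1; with xi j <= x and W >= 2 x - 1, both inequalities must
     be equalities. *)
  have key j : 1 < xi j w -> xi j w = x /\ W w = 2 * x - 1.
    move=> xj1; have := nocr j; rewrite /is_crossing xj1 /= -leNgt => h.
    have := lex j; rewrite -leNgt => h2; have := W_D1 j w => h3.
    by split; lra.
  have [xix WW] := key i xi1.
  apply/and4P; split.
  - by rewrite -xix.
  - exact/eqP.
  - by apply/existsP; exists i; exact/eqP.
  - by apply/forallP => j; case: (leP (xi j w) 1) => //= xj1; have [-> _] := key j xj1.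
rewrite ExD; [|by apply: IntD; [exact: Int_sum|exact: Int_bool]|exact: Int_bool].
rewrite ExD; [|exact: Int_sum|exact: Int_bool].
rewrite Ex_sum//.
have h1 := crossing_or_tie_le.
have h2 := @near_window_bound _ _ _ _ _ X D indep xi oxi Ixi xi0 sum_sig eta etaj x s z (2 * x - 1) dl A
  s01 (ltW dl0) meta eta0 oetaj etaj0 EU mA
  (fun w Aw j => (forallP (proj2 (andP Aw))) j)
  (fun w Aw => EW w (proj1 (andP Aw))) (fun w Aw => Ex1 w (proj1 (andP Aw))).
set e3 := expR (- (z / 3)); set k1 := Num.sqrt (Ex (fun w => eta w ^+ 2)) in h2 *.
set k2 := \sum_(j < n) _ in h2 *.
have e30 : 0 < e3 by exact: expR_gt0.
have k10 : 0 <= k1 by exact: sqrtr_ge0.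
have k20 : 0 <= k2 by apply: sumr_ge0 => j _; rewrite mulr_ge0 ?sqrtr_ge0.
rewrite [- ((3 * x - 1) / 3)](_ : _ = - (z / 3)) in h1; last by rewrite xz; field.
rewrite -/e3 in h1.
have ee : expR (1 / 6) * e3 * expR ((2 * x - 1) / 2) = 1.
  by rewrite /e3 -!expRD -[RHS]expR0; congr expR; rewrite xz; field.
have h3 : Ex (fun w => (A w)%:R) <= e3 * (51 / 5 * dl + 17 / 2 * k1 + 18 / 5 * k2).
  have t0 := expR_gt0 ((2 * x - 1) / 2).
  have c1 := ler_wpM2r (ltW dl0) (@const_delta R).
  have c2 := ler_wpM2r k10 (@const_remainder R).
  have c3 := ler_wpM2r k20 (@const_coupling R).
  have c123 : 2 * expR (1 / 6) * (3 * sqrt_mgf_const R * dl + Num.sqrt (mgf_const R * (expR 1 + (expR 1 - 1) ^+ 2)) * k1 + sqrt_mgf_const R * k2)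
      <= 51 / 5 * dl + 17 / 2 * k1 + 18 / 5 * k2 by lra.
  apply: (@le_trans _ _ (e3 * (2 * expR (1 / 6) * (3 * sqrt_mgf_const R * dl + Num.sqrt (mgf_const R * (expR 1 + (expR 1 - 1) ^+ 2)) * k1 + sqrt_mgf_const R * k2)))); last first.
    by rewrite ler_pM2l.
  have c0 : 0 <= 2 * (expR (1 / 6) * e3) by rewrite mulr_ge0// mulr_ge0 ?expR_ge0.
  have := ler_wpM2l c0 h2.
  rewrite (_ : 2 * (expR (1 / 6) * e3) * (1 / 2 * expR ((2 * x - 1) / 2) * Ex (fun w => (A w)%:R)) =
    expR (1 / 6) * e3 * expR ((2 * x - 1) / 2) * Ex (fun w => (A w)%:R)); last by field.
  by rewrite ee mul1r => /le_trans; apply; rewrite le_eqVlt; apply/orP; left; apply/eqP; ring.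
(* The split 22 = 59/5 + 51/5 between ties and window. *)
have h4 : e3 * (22 * dl + 17 / 2 * k1 + 18 / 5 * k2) =
   59 / 5 * e3 * dl + e3 * (51 / 5 * dl + 17 / 2 * k1 + 18 / 5 * k2) by field.
rewrite h4; lra.
Qed.

End part1.

(** * The nonuniform bound for W + Delta *)

Section L2norm.
Context d (Omega : measurableType d) (R : realType) (P : probability Omega R).

(** Compares a real second moment of the clipped variable with an extended-real norm that may be
    infinite, in which case there is nothing to prove. *)
Lemma sqrt_Ex_le_Lnorm (f g : Omega -> R) : Mfun f -> Mfun g -> Int P (fun w => g w ^+ 2) ->
  (forall w, `|g w| <= `|f w|) ->
  ((Num.sqrt (Ex P (fun w => g w ^+ 2)))%:E <= 'N[P]_2%:E[EFin \o f])%E.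
Proof.
move=> mf mg Ig gf; set c := Num.sqrt _.
have two0 : (2 : R) != 0 by rewrite pnatr_eq0.
have h : ((c ^+ 2)%:E <= 'N[P]_2%:E[EFin \o f] `^ 2)%E.
  rewrite poweR_Lnorm// /c sqr_sqrtr; last by apply: Ex_ge0 => w; exact: sqr_ge0.
  rewrite -Ex_fin//; apply: ge0_le_integral => //.
  - by move=> w _; rewrite lee_fin sqr_ge0.
  - by apply/measurable_EFinP; exact: MfunX.
  - apply/measurable_EFinP; rewrite (_ : (fun _ => _) = (fun w => `|f w| ^+ 2)).
      by apply: MfunX; exact: Mfun_norm.
    by apply/funext => w; rewrite powR_mulrn.
  move=> w _; rewrite /= powR_mulrn// lee_fin -(real_normK (num_real (g w))).
  by rewrite lerXn2r ?nnegrE.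
move: h (Lnorm_ge0 P 2%:E (EFin \o f)); move: (Lnorm _ _ _) => [r| |//].
  rewrite poweR_EFin !lee_fin => h r0; move: h.
  by rewrite powR_mulrn// ler_sqr ?nnegrE// sqrtr_ge0.
by move=> _ _; rewrite leey.
Qed.

End L2norm.

Section sided.
Context d (Omega : measurableType d) (R : realType) (P : probability Omega R).
Context (n : nat) (X D : 'I_n -> {RV P >-> R}).
Hypothesis indep : forall i, independent2 P (X i) (fun w => (D i w, sample_but X i w)).
Local Notation off := (off X D).
Local Notation on := (on X).
Local Notation Ex := (Ex P).
Local Notation Int := (Int P).

Section one_sign.
Variables (xi : 'I_n -> Omega -> R).
Hypothesis oxi : forall j, on j (xi j).
Hypothesis Ixi : forall j, Int (fun w => xi j w ^+ 2).
Hypothesis xi0 : forall j, Ex (xi j) = 0.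
Hypothesis sum_sig : \sum_(j < n) Ex (fun w => xi j w ^+ 2) = 1.
Local Notation sig := (second_moment P xi).
Local Notation W := (Sm predT xi).

Let W_D1 i w : W w = xi i w + Sm (predC1 i) xi w.
Proof. by rewrite /Sm (bigD1 i). Qed.

Let mxi j : Mfun (xi j). Proof. exact: on_Mfun (oxi j). Qed.
Let mW Q : Mfun (Sm Q xi). Proof. exact: Mfun_Sm oxi. Qed.

(** On [E] clipping does not change |Delta|, so the window is the intended one, while [eta] and
    [etaj] are bounded. Crossings become products of probabilities because xi i is independent of
    the other summands. *)
Lemma one_sided_bound (Delta : Omega -> R) (dl z s : R) (E : Omega -> bool) :
  let x := (z + 1) / 3 in
  let eta w := Num.min `|Delta w| x in
  let etaj j w := Num.min `|D j w| x in
  0 <= z -> 0 < dl -> 1 / 2 <= \sum_(j < n) Ex (capped_square xi dl j) ->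
  0 <= s <= 1 -> Mfun Delta -> measurable_fun setT E ->
  (forall w, E w -> `|Delta w| <= x) ->
  (forall w, E w -> z - s * `|Delta w| <= W w <= z - s * `|Delta w| + `|Delta w|) ->
  Ex (fun w => (E w)%:R) <=
  \sum_(i < n) Ex (fun w => (x < `|xi i w|)%R%:R) +
  \sum_(i < n) Ex (fun w => ((z - 2) / 3 < `|W w - xi i w|)%R%:R) * Ex (fun w => (1 < `|xi i w|)%R%:R) +
  expR (- (z / 3)) * (22 * dl + 17 / 2 * Num.sqrt (Ex (fun w => eta w ^+ 2)) +
    18 / 5 * \sum_(j < n) Num.sqrt (sig j) * Num.sqrt (Ex (fun w => (eta w - etaj j w) ^+ 2))).
Proof.
move=> x eta etaj z0 dl0 EU s01 mD mE Ex_x EW.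
have x0 : 0 <= x by rewrite /x; lra.
have /andP[s0 s1] := s01.
have meta : Mfun eta by apply: Mfun_min; [exact: Mfun_norm|exact: Mfun_cst].
have eta0 w : 0 <= eta w <= x by rewrite /eta le_min normr_ge0 x0 ge_min lexx orbT.
have etaE w : E w -> eta w = `|Delta w| by move=> Ew; rewrite /eta min_l// Ex_x.
have oetaj j : off j (etaj j).
  apply: (@off_comp _ _ _ _ _ X D j (fun y => Num.min `|y| x)); last exact: off_D.
  by apply: measurable_minr; [exact: normr_measurable|exact: measurable_cst].
have etaj0 j w : 0 <= etaj j w <= x by rewrite /etaj le_min normr_ge0 x0 ge_min lexx orbT.
have EW' w : E w -> z - s * eta w <= W w <= z - s * eta w + eta w.
  by move=> Ew; rewrite etaE//; exact: EW.
(* In the window W >= z - |Delta| >= z - x, and z - x = 2 x - 1. *)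
have El w : E w -> 2 * x - 1 <= W w.
  move=> Ew; have /andP[h _] := EW w Ew; have := Ex_x w Ew; have := normr_ge0 (Delta w).
  move: h; move: `|Delta w| => y h y0 yx.
  have : s * y <= y by rewrite ler_piMl.
  rewrite /x in yx *; lra.
apply: (le_trans (window_probability_le indep oxi Ixi xi0 sum_sig dl0 EU erefl s01 meta eta0 oetaj etaj0 mE EW' El)).
rewrite lerD2r; apply: lerD.
  apply: ler_sum => i _; apply: Ex_le.
  - by apply: Int_bool; apply: measurable_fun_ltr; [exact: measurable_cst|exact: mxi].
  - by apply: Int_bool; apply: measurable_fun_ltr; [exact: measurable_cst|exact: Mfun_norm].
  - move=> w; rewrite ler_nat; case: (ltP x (xi i w)) => // h.
    by rewrite (lt_le_trans h (ler_norm _)).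
apply: ler_sum => i _.
have iQ : ~~ predC1 i i by rewrite /= eqxx.
have o1 : on i (fun w => (1 < `|xi i w|)%R%:R).
  by apply: on_ltr; [exact: on_cst|exact: on_norm].
have o2 : off i (fun w => (x - 1 < `|Sm (predC1 i) xi w|)%R%:R).
  apply: (@off_comp _ _ _ _ _ X D i (fun y => (x - 1 < `|y|)%R%:R)); last exact: off_Sm.
  by apply: Mfun_ltr; [exact: measurable_cst|exact: normr_measurable].
have I1 : Int (fun w => (1 < `|xi i w|)%R%:R).
  by apply: Int_bool; apply: measurable_fun_ltr; [exact: measurable_cst|exact: Mfun_norm].
have I2 : Int (fun w => (x - 1 < `|Sm (predC1 i) xi w|)%R%:R).
  by apply: Int_bool; apply: measurable_fun_ltr; [exact: measurable_cst|exact: Mfun_norm].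
have [I3 E3] := on_indep indep o1 o2 I1 I2.
have -> : (fun w => ((z - 2) / 3 < `|W w - xi i w|)%R%:R : R) =
    (fun w => (x - 1 < `|Sm (predC1 i) xi w|)%R%:R).
  apply/funext => w; rewrite (W_D1 i w) [xi i w + _]addrC addrK.
  by rewrite (_ : (z - 2) / 3 = x - 1)// /x; field.
apply: (@le_trans _ _ (Ex (fun w => (1 < `|xi i w|)%R%:R * (x - 1 < `|Sm (predC1 i) xi w|)%R%:R))); last by rewrite E3 [leRHS]mulrC.
apply: Ex_le => //.
  apply: Int_bool; apply: measurable_and; apply: measurable_fun_ltr; [exact: measurable_cst|exact: mxi|exact: measurable_cst|exact: mW].
move=> w; rewrite /is_crossing -/x -natrM ler_nat mulnb.
case: (ltP 1 (xi i w)) => //= h1; case: (ltP (x - 1) (Sm (predC1 i) xi w)) => //= h2.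
by rewrite (lt_le_trans h1 (ler_norm _)) (lt_le_trans h2 (ler_norm _)).
Qed.

End one_sign.

Variables (xi : 'I_n -> Omega -> R).
Hypothesis oxi : forall j, on j (xi j).
Hypothesis Ixi : forall j, Int (fun w => xi j w ^+ 2).
Hypothesis xi0 : forall j, Ex (xi j) = 0.
Hypothesis sum_sig : \sum_(j < n) Ex (fun w => xi j w ^+ 2) = 1.
Local Notation sig := (second_moment P xi).
Local Notation W := (Sm predT xi).

Let mxi j : Mfun (xi j). Proof. exact: on_Mfun (oxi j). Qed.
Let mW Q : Mfun (Sm Q xi). Proof. exact: Mfun_Sm oxi. Qed.

Definition part1_bound (Delta : Omega -> R) (dl z : R) : R :=
  \sum_(i < n) Ex (fun w => ((`|z| + 1) / 3 < `|xi i w|)%R%:R) +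
  \sum_(i < n) Ex (fun w => ((`|z| - 2) / 3 < `|W w - xi i w|)%R%:R) * Ex (fun w => (1 < `|xi i w|)%R%:R) +
  expR (- (`|z| / 3)) * (22 * dl +
    17 / 2 * Num.sqrt (Ex (fun w => (Num.min `|Delta w| ((`|z| + 1) / 3)) ^+ 2)) +
    18 / 5 * \sum_(j < n) Num.sqrt (sig j) *
      Num.sqrt (Ex (fun w => (Num.min `|Delta w| ((`|z| + 1) / 3) - Num.min `|D j w| ((`|z| + 1) / 3)) ^+ 2))).

Lemma Sm_opp Q w : Sm Q (fun j w => - xi j w) w = - Sm Q xi w.
Proof. by rewrite /Sm -sumrN. Qed.

Lemma two_sided_bound (Delta : Omega -> R) (dl z : R) (E : Omega -> bool) :
  0 < dl -> 1 / 2 <= \sum_(j < n) Ex (capped_square xi dl j) -> Mfun Delta -> measurable_fun setT E ->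
  (forall w, E w -> `|Delta w| <= (`|z| + 1) / 3) ->
  (forall w, E w -> z - `|Delta w| <= W w <= z) \/ (forall w, E w -> z <= W w <= z + `|Delta w|) ->
  Ex (fun w => (E w)%:R) <= part1_bound Delta dl z.
Proof.
move=> dl0 EU mD mE ED EW.
have [z0|/ltW z0] := leP 0 z.
  rewrite /part1_bound ger0_norm// in ED *.
  case: EW => EW.
    apply: (@one_sided_bound xi oxi Ixi xi0 sum_sig Delta dl z 1 E) => //; first by rewrite ler01 lexx.
    by move=> w /EW; rewrite mul1r subrK.
  apply: (@one_sided_bound xi oxi Ixi xi0 sum_sig Delta dl z 0 E) => //; first by rewrite ler01 lexx.
  by move=> w /EW; rewrite mul0r subr0.
pose xi' j w := - xi j w.
have oxi' j : on j (xi' j).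
  rewrite (_ : xi' j = (fun w => 0 - xi j w)); first by apply: onB => //; exact: on_cst.
  by apply/funext => w; rewrite sub0r.
have sq' j : (fun w => xi' j w ^+ 2) = (fun w => xi j w ^+ 2) by apply/funext => w; rewrite sqrrN.
have Ixi' j : Int (fun w => xi' j w ^+ 2) by rewrite sq'.
have xi0' j : Ex (xi' j) = 0.
  by rewrite ExN ?xi0 ?oppr0//; apply: Int_of_sq.
have sum_sig' : \sum_(j < n) Ex (fun w => xi' j w ^+ 2) = 1.
  by rewrite -sum_sig; apply: eq_bigr => j _; rewrite sq'.
have uu' j : capped_square xi' dl j = capped_square xi dl j by apply/funext => w; rewrite /capped_square /xi' normrN.
have EU' : 1 / 2 <= \sum_(j < n) Ex (capped_square xi' dl j) by under eq_bigr do rewrite uu'.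
have sig' j : second_moment P xi' j = sig j by rewrite /second_moment sq'.
have n1 (c : R) i : (fun w => (c < `|xi' i w|)%R%:R : R) = (fun w => (c < `|xi i w|)%R%:R).
  by apply/funext => w; rewrite normrN.
have n2 (c : R) i : (fun w => (c < `|Sm predT xi' w - xi' i w|)%R%:R : R) = (fun w => (c < `|W w - xi i w|)%R%:R).
  by apply/funext => w; rewrite Sm_opp -opprD normrN.
have := fun s => @one_sided_bound xi' oxi' Ixi' xi0' sum_sig' Delta dl (- z) s E.
rewrite /part1_bound ler0_norm// in ED *.
under [X in _ -> _ <= X + _ + _]eq_bigr do rewrite -n1.
under [X in _ -> _ <= _ + X + _]eq_bigr do rewrite -n2 -n1.
under [X in _ -> _ <= _ + _ * (_ + _ * X)]eq_bigr do rewrite -sig'.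
have z0' : 0 <= - z by rewrite oppr_ge0.
move=> h; case: EW => EW.
  apply: (h 0) => //; first by rewrite ler01 lexx.
  by move=> w /EW; rewrite Sm_opp mul0r subr0; move: `|Delta w| (W w) => a b /andP[h1 h2]; apply/andP; split; lra.
apply: (h 1) => //; first by rewrite ler01 lexx.
by move=> w /EW; rewrite Sm_opp mul1r subrK; move: `|Delta w| (W w) => a b /andP[h1 h2]; apply/andP; split; lra.
Qed.

Lemma part1_real (Delta : Omega -> R) (dl z : R) :
  0 < dl -> 1 / 2 <= \sum_(j < n) Ex (capped_square xi dl j) -> Mfun Delta ->
  `|Ex (fun w => (W w + Delta w <= z)%R%:R) - Ex (fun w => (W w <= z)%R%:R)| <=
  Ex (fun w => ((`|z| + 1) / 3 < `|Delta w|)%R%:R) + part1_bound Delta dl z.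
Proof.
move=> dl0 EU mD; set x := (`|z| + 1) / 3.
have mT : Mfun (fun w => W w + Delta w) by exact: MfunD.
have mc := @measurable_cst _ _ Omega R setT.
have ib (b : Omega -> bool) : measurable_fun setT b -> Int (fun w => (b w)%:R) by exact: Int_bool.
have m1 : measurable_fun setT (fun w => (W w + Delta w <= z)%R) by apply: measurable_fun_ler; [exact: mT|exact: mc].
have m2 : measurable_fun setT (fun w => (W w <= z)%R) by apply: measurable_fun_ler; [exact: mW|exact: mc].
have m3 : measurable_fun setT (fun w => (x < `|Delta w|)%R) by apply: measurable_fun_ltr => //; exact: Mfun_norm.
have m4 : measurable_fun setT (fun w => (`|Delta w| <= x)%R) by apply: measurable_fun_ler => //; exact: Mfun_norm.
pose E1 w := [&& (W w <= z)%R, ~~ (W w + Delta w <= z)%R & (`|Delta w| <= x)%R].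
pose E2 w := [&& (W w + Delta w <= z)%R, ~~ (W w <= z)%R & (`|Delta w| <= x)%R].
have mE1 : measurable_fun setT E1.
  by apply: measurable_and => //; apply: measurable_and => //; exact: measurable_neg.
have mE2 : measurable_fun setT E2.
  by apply: measurable_and => //; apply: measurable_and => //; exact: measurable_neg.
have b1 : Ex (fun w => (E1 w)%:R) <= part1_bound Delta dl z.
  apply: two_sided_bound => //; first by move=> w /and3P[].
  left => w /and3P[h1]; rewrite -ltNge => h2 _; rewrite h1 andbT.
  by have := ler_norm (Delta w); lra.
have b2 : Ex (fun w => (E2 w)%:R) <= part1_bound Delta dl z.
  apply: two_sided_bound => //; first by move=> w /and3P[].
  right => w /and3P[h1]; rewrite -ltNge => h2 _; rewrite ltW//=.
  by have := ler_norm (- Delta w); rewrite normrN; lra.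
have k (a b : Omega -> bool) (E : Omega -> bool) : measurable_fun setT a -> measurable_fun setT b ->
    measurable_fun setT E -> (forall w, a w ==> [|| b w, E w | (x < `|Delta w|)%R]) ->
    Ex (fun w => (a w)%:R) <= Ex (fun w => (b w)%:R) + (Ex (fun w => (x < `|Delta w|)%R%:R) + Ex (fun w => (E w)%:R)).
  move=> ma mb mE imp; rewrite -ExD; [|exact: ib|exact: ib].
  rewrite -ExD; [|exact: ib|by apply: IntD; exact: ib].
  apply: Ex_le; [exact: ib|by apply: IntD; [exact: ib|apply: IntD; exact: ib]|move=> w].
  rewrite -!natrD ler_nat; move: (imp w).
  by case: (a w); case: (b w); case: (E w); case: (_ < _).
have k1 : Ex (fun w => (W w <= z)%R%:R) <= Ex (fun w => (W w + Delta w <= z)%R%:R) +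
    (Ex (fun w => (x < `|Delta w|)%R%:R) + Ex (fun w => (E1 w)%:R)).
  apply: k => // w; apply/implyP => h1; rewrite /E1 h1 /=.
  by case: (W w + Delta w <= z) => //=; case: leP.
have k2 : Ex (fun w => (W w + Delta w <= z)%R%:R) <= Ex (fun w => (W w <= z)%R%:R) +
    (Ex (fun w => (x < `|Delta w|)%R%:R) + Ex (fun w => (E2 w)%:R)).
  apply: k => // w; apply/implyP => h1; rewrite /E2 h1 /=.
  by case: (W w <= z) => //=; case: leP.
rewrite ler_norml; move: k1 k2 b1 b2; set t1 := Ex _; set t2 := Ex _; set t3 := Ex _; set t4 := Ex _; set t5 := Ex _.
by move=> *; apply/andP; split; lra.
Qed.

End sided.

(** * Application to T *)

Section expectation_ereal.
Context d (Omega : measurableType d) (R : realType) (P : probability Omega R).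

Lemma expectation_Ex f : Int P f -> 'E_P[f]%E = (Ex P f)%:E.
Proof. by move=> If; rewrite unlock Ex_fin. Qed.

Lemma Int_ge0_expectation f : Mfun f -> (forall w, 0 <= f w) ->
  ('E_P[f] < +oo)%E -> Int P f.
Proof.
rewrite unlock => mf f0 h; apply/integrableP; split; first exact/measurable_EFinP.
by under eq_integral => w _ do rewrite /= ger0_norm//.
Qed.

End expectation_ereal.

Lemma norm_min_sub_le (R : realType) (a b x : R) :
  `|Num.min `|a| x - Num.min `|b| x| <= `|a - b|.
Proof.
have := normr_ge0 (a - b); have := ler_dist_dist a b; rewrite ler_norml => /andP[h1 h2] h0.
rewrite /Num.min; case: ltP => k1; case: ltP => k2; rewrite ler_norml; apply/andP; split; lra.
Qed.

Section real_setting.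
Context d (Omega : measurableType d) (R : realType) (P : probability Omega R).
Context (n : nat) (X : 'I_n -> {RV P >-> R}) (T : {mfun n.-tuple R >-> R}) (g : 'I_n -> {mfun R >-> R}).
Context (D : 'I_n -> {RV P >-> R}).
Hypothesis indep : forall i, independent2 P (X i) (fun w => (D i w, sample_but X i w)).
Hypothesis Eg : forall i, ('E_P[gX X g i] = 0)%E.
Hypothesis Eg2 : (\sum_(i < n) 'E_P[fun w => (gX X g i w ^+ 2)%R] = 1)%E.
Local Notation xi := (gX X g).
Local Notation Delta := (remainder X T g).
Local Notation Ex := (Ex P).
Local Notation Int := (Int P).

Lemma on_gX j : on X j (xi j).
Proof. by exists (g j). Qed.

Lemma Mfun_gX j : Mfun (xi j).
Proof. exact: on_Mfun (on_gX j). Qed.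

Lemma Int_gX_sq j : Int (fun w => xi j w ^+ 2).
Proof.
apply: Int_ge0_expectation; [by apply: MfunX; exact: Mfun_gX|by move=> w; exact: sqr_ge0|].
apply: (@le_lt_trans _ _ 1%E); last exact: ltry.
rewrite -Eg2 (bigD1 j)//= leeDl// sume_ge0// => i _.
by apply: expectation_ge0 => w; exact: sqr_ge0.
Qed.

Lemma Ex_gX j : Ex (xi j) = 0.
Proof.
apply: EFin_inj; rewrite -expectation_Ex//; apply: Int_of_sq; [exact: Mfun_gX|exact: Int_gX_sq].
Qed.

Lemma sum_Ex_gX_sq : \sum_(j < n) Ex (fun w => xi j w ^+ 2) = 1.
Proof.
apply: EFin_inj; rewrite -sumEFin -[RHS]Eg2; apply: eq_bigr => j _.
by rewrite expectation_Ex//; exact: Int_gX_sq.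
Qed.

Lemma linear_partE : linear_part X g = Sm predT xi.
Proof. by []. Qed.

Lemma Mfun_linear_part : Mfun (linear_part X g).
Proof. by rewrite linear_partE; apply: (Mfun_Sm _ on_gX). Qed.

Lemma Mfun_stat : Mfun (stat X T).
Proof.
apply: measurableT_comp => //; apply/measurable_fun_tnthP => j.
by rewrite (_ : _ \o _ = X j)//; apply/funext => w /=; rewrite tnth_mktuple.
Qed.

Lemma Mfun_remainder : Mfun Delta.
Proof. by apply: MfunB; [exact: Mfun_stat|exact: Mfun_linear_part]. Qed.

Lemma statE w : stat X T w = linear_part X g w + Delta w.
Proof. by rewrite /remainder addrC subrK. Qed.

Lemma L2remainder_ge (f : Omega -> R) : Mfun f -> Int (fun w => f w ^+ 2) ->
  (forall w, `|f w| <= `|Delta w|) ->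
  ((Num.sqrt (Ex (fun w => f w ^+ 2)))%:E <= L2remainder X T g)%E.
Proof. by move=> mf If h; apply: sqrt_Ex_le_Lnorm => //; exact: Mfun_remainder. Qed.

Lemma L2coupling_ge (f : 'I_n -> Omega -> R) : (forall j, Mfun (f j)) ->
  (forall j, Int (fun w => f j w ^+ 2)) -> (forall j w, `|f j w| <= `|Delta w - D j w|) ->
  ((\sum_(j < n) Num.sqrt (Ex (fun w => xi j w ^+ 2)) * Num.sqrt (Ex (fun w => f j w ^+ 2)))%:E <=
   L2coupling X T g D)%E.
Proof.
move=> mf If h; rewrite -sumEFin; apply: lee_sum => j _; rewrite EFinM.
apply: lee_pmul; rewrite ?lee_fin ?sqrtr_ge0//.
  by apply: sqrt_Ex_le_Lnorm => //; [exact: Mfun_gX|exact: Mfun_gX|exact: Int_gX_sq].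
by apply: sqrt_Ex_le_Lnorm => //; apply: MfunB; [exact: Mfun_remainder|exact: measurable_funPT].
Qed.

Section probabilities.
Variable z : R.

Lemma P_stat_le : P [set w | (stat X T w <= z)%R] = (Ex (fun w => (Sm predT xi w + Delta w <= z)%R%:R))%:E.
Proof.
rewrite -(@Ex_bool _ _ _ P (fun w => (Sm predT xi w + Delta w <= z)%R)).
  by congr (P _); apply/funext => w /=; rewrite statE.
by apply: measurable_fun_ler; [apply: MfunD; [exact: Mfun_linear_part|exact: Mfun_remainder]|exact: measurable_cst].
Qed.

Lemma P_linear_le : P [set w | (linear_part X g w <= z)%R] = (Ex (fun w => (Sm predT xi w <= z)%R%:R))%:E.
Proof.
by rewrite -Ex_bool//; apply: measurable_fun_ler; [exact: Mfun_linear_part|exact: measurable_cst].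
Qed.

Lemma P_norm_gt (f : Omega -> R) c : Mfun f -> P [set w | (`|f w| > c)%R] = (Ex (fun w => (c < `|f w|)%R%:R))%:E.
Proof.
by move=> mf; rewrite -Ex_bool//; apply: measurable_fun_ltr; [exact: measurable_cst|exact: Mfun_norm].
Qed.

Definition gammaz_tail : R :=
  \sum_(i < n) Ex (fun w => ((`|z| + 1) / 3 < `|xi i w|)%R%:R) +
  \sum_(i < n) Ex (fun w => ((`|z| - 2) / 3 < `|Sm predT xi w - xi i w|)%R%:R) * Ex (fun w => (1 < `|xi i w|)%R%:R).

Lemma gammazE : gammaz X T g z = (P [set w | (`|Delta w| > (`|z| + 1) / 3)%R] + gammaz_tail%:E)%E.
Proof.
rewrite /gammaz /gammaz_tail EFinD addeA; congr (_ + _ + _)%E.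
  by rewrite -sumEFin; apply: eq_bigr => i _; rewrite P_norm_gt//; exact: Mfun_gX.
rewrite -sumEFin; apply: eq_bigr => i _; rewrite EFinM !P_norm_gt//; first exact: Mfun_gX.
by apply: MfunB; [exact: Mfun_linear_part|exact: Mfun_gX].
Qed.

Lemma stat_linear_bound (dl : R) : 0 < dl -> 1 / 2 <= \sum_(j < n) Ex (capped_square xi dl j) ->
  (`| P [set w | (stat X T w <= z)%R] - P [set w | (linear_part X g w <= z)%R] |
     <= gammaz X T g z + (expR (- (`|z| / 3)))%:E * tau X T g D dl)%E.
Proof.
move=> dl0 EU; have := part1_real indep on_gX Int_gX_sq Ex_gX sum_Ex_gX_sq z dl0 EU Mfun_remainder.
rewrite P_stat_le P_linear_le gammazE P_norm_gt; last exact: Mfun_remainder.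
rewrite -EFinB abse_EFin -lee_fin => h; apply: le_trans h _.
rewrite /part1_bound -/gammaz_tail addrA EFinD [X in (X + _ <= _)%E]EFinD; apply: leeD => //.
set x := (_ + 1) / 3; have x0 : 0 <= x by rewrite /x; have := normr_ge0 z; lra.
rewrite EFinM; apply: lee_wpmul2l; first by rewrite lee_fin expR_ge0.
have mmin (f : Omega -> R) : Mfun f -> Mfun (fun w => Num.min `|f w| x).
  by move=> mf; apply: Mfun_min; [exact: Mfun_norm|exact: Mfun_cst].
have min0 (f : Omega -> R) w : 0 <= Num.min `|f w| x <= x by rewrite le_min normr_ge0 x0 ge_min lexx orbT.
have mmD : Mfun (fun w => Num.min `|Delta w| x) by apply: mmin; exact: Mfun_remainder.
have mmB j : Mfun (fun w => Num.min `|Delta w| x - Num.min `|D j w| x) by apply: MfunB => //; apply: mmin; exact: measurable_funPT.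
rewrite /tau EFinD EFinD; apply: leeD; first apply: leeD => //.
  rewrite EFinM; apply: lee_wpmul2l; first by rewrite lee_fin; lra.
  apply: L2remainder_ge => //.
    apply: (@Int_bnd _ _ _ _ _ (x ^+ 2)); first exact: MfunX.
    move=> w; apply: normX2_le; have /andP[h1 h2] := min0 Delta w.
    by rewrite ger0_norm.
  move=> w; have /andP[h1 h2] := min0 Delta w.
  by rewrite ger0_norm// ge_min lexx.
rewrite EFinM; apply: lee_wpmul2l; first by rewrite lee_fin; lra.
apply: L2coupling_ge => //.
  move=> j; apply: (@Int_bnd _ _ _ _ _ (x ^+ 2)); first exact: MfunX.
  move=> w; apply: normX2_le; have /andP[h1 h2] := min0 Delta w; have /andP[h3 h4] := min0 (D j) w.
  by rewrite ler_norml; apply/andP; split; lra.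
by move=> j w; exact: norm_min_sub_le.
Qed.

End probabilities.

Lemma truncated_condition (dl : R) : 0 < dl ->
  ((1 / 2)%:E <= \sum_(i < n) 'E_P[fun w => (`|xi i w| * Num.min dl `|xi i w|)%R])%E ->
  1 / 2 <= \sum_(j < n) Ex (capped_square xi dl j).
Proof.
move=> dl0; rewrite -lee_fin -sumEFin; congr (_ <= _)%E; apply: eq_bigr => j _.
rewrite expectation_Ex//; exact: (Iuu on_gX Int_gX_sq j (ltW dl0)).
Qed.

End real_setting.

(** * The normal distribution *)

Section normal.
Context (R : realType).
Implicit Types (x z w : R).

Definition gpdf x : R := normal_pdf 0 1 x.
Definition gcdf z : R := fine (Phi z).
Let c : R := normal_peak 1.

Lemma gpeak_gt0 : 0 < c. Proof. exact: normal_peak_gt0. Qed.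

Lemma gpdfE x : gpdf x = c * expR (- (x ^+ 2 / 2)).
Proof. by rewrite /gpdf normal_pdfE ?oner_neq0// /normal_fun subr0 expr1n mulNr. Qed.

Lemma gpdf_gt0 x : 0 < gpdf x.
Proof. by rewrite gpdfE mulr_gt0 ?gpeak_gt0 ?expR_gt0. Qed.

Lemma gpdfN x : gpdf (- x) = gpdf x.
Proof. by rewrite !gpdfE sqrrN. Qed.

Lemma Phi_fin z : Phi z = (gcdf z)%:E.
Proof. by rewrite /gcdf fineK// fin_num_measure. Qed.

Lemma gcdf_ge0 z : 0 <= gcdf z.
Proof. by rewrite -lee_fin -Phi_fin. Qed.

Lemma gcdf_le1 z : gcdf z <= 1.
Proof. by rewrite -lee_fin -Phi_fin; exact: (@probability_le1 _ _ _ (normal_prob 0 1)). Qed.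

Lemma der_gpdf x : is_derive x 1 gpdf (- x * gpdf x).
Proof.
rewrite (_ : gpdf = fun x => c * expR (- (x ^+ 2 * 2^-1))); last by apply/funext => y; exact: gpdfE.
by der; field.
Qed.

Lemma der_gcdf x : is_derive x 1 gcdf (gpdf x).
Proof.
have [] := @continuous_FTC1 R gpdf (BInfty R true) x (x + 1).
- by rewrite ltrDl.
- by apply: integrableS (integrable_normal_pdf 0 1).
- exact: ltNyr.
- by apply: continuous_normal_pdf; rewrite oner_neq0.
move=> dF eF; apply: (DeriveDef dF); rewrite -derive1E; exact: eF.
Qed.

(** The identity seen as a random variable under the normal law: its distribution function is
    [gcdf], so the limits at infinity of distribution functions apply. *)
Let gid : measurableTypeR R -> R := idfun.

#[local] HB.instance Definition _ :=
  @isMeasurableFun.Build _ _ _ _ gid (@measurable_id _ _ setT).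

Let idn : {RV (normal_prob 0 1 : probability (measurableTypeR R) R) >-> R} := gid.

Lemma gcdf_Ny0 : gcdf @ -oo --> (0 : R).
Proof. exact/fine_cvg/(cvg_cdfNy0 idn). Qed.

Lemma gcdf_y1 : gcdf @ +oo --> (1 : R).
Proof. exact/fine_cvg/(cvg_cdfy1 idn). Qed.

Lemma gcdf_small e : 0 < e -> exists M, forall x, x <= M -> gcdf x < e.
Proof.
move=> e0; have /cvgrPdist_lt/(_ e e0)[M [_ h]] := gcdf_Ny0.
exists (M - 1) => x xM; have := h x; rewrite sub0r normrN ger0_norm ?gcdf_ge0//; apply; lra.
Qed.

Lemma gcdf_big e : 0 < e -> exists M, forall x, M <= x -> 1 - e < gcdf x.
Proof.
move=> e0; have /cvgrPdist_lt/(_ e e0)[M [_ h]] := gcdf_y1.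
exists (M + 1) => x xM; have := h x; rewrite ltr_norml => /(_ _)/andP[]; lra.
Qed.

(** The sum gcdf y + gcdf (- y) has zero derivative by symmetry of the density, and tends to 1 at
    infinity. *)
Lemma gcdfN x : gcdf (- x) = 1 - gcdf x.
Proof.
pose G y := gcdf y + gcdf (- y).
have dG (y : R) : is_derive y 1 G 0.
  have dn : is_derive y 1 (fun y => gcdf (- y)) (- gpdf y).
    have d1 := der_gcdf (- y); have d2 : is_derive y 1 (fun y : R => - y) (-1) by apply: derN; exact: derI.
    by apply: (der_cast (is_derive1_comp d1 d2)); rewrite gpdfN; ring.
  by apply: (der_cast (derD (der_gcdf y) dn)); rewrite subrr.
have Gc y w : G y = G w.
  wlog yw : y w / y <= w by move=> h; case: (leP y w) => [/h//|/ltW/h].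
  by have [u _ /eqP] := mvt dG yw; rewrite mul0r subr_eq0 => /eqP.
suff -> : 1 = G x by rewrite /G addrAC subrr add0r.
apply/eqP; rewrite eq_le; apply/andP; split; apply/ler_addgt0Pr => e e0.
  have [M hM] := gcdf_big e0; rewrite (Gc x M) /G.
  by have := hM M (lexx _); have := gcdf_ge0 (- M); lra.
have [M hM] := gcdf_small e0; rewrite (Gc x M) /G.
by have := hM M (lexx _); have := gcdf_le1 (- M); lra.
Qed.

(** Left of -1 the difference gpdf - gcdf is nondecreasing and tends to 0 at minus infinity. On the
    rest of the half-line gcdf <= 1 and gpdf >= gpdf 1. *)
Lemma gcdf_tail : exists2 C : R, 0 < C & forall w, w <= 0 -> gcdf w <= C * gpdf w.
Proof.
exists (1 + (gpdf 1)^-1); first by rewrite ltr_wpDr ?invr_ge0 ?ltW ?gpdf_gt0.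
have p1 := gpdf_gt0 1.
have far w : w <= -1 -> gcdf w <= gpdf w.
  move=> w1; apply/ler_addgt0Pr => e e0; have [M hM] := gcdf_small e0.
  have dh (y : R) : is_derive y 1 (fun y => gpdf y - gcdf y) (- y * gpdf y - gpdf y).
    by apply: derB; [exact: der_gpdf|exact: der_gcdf].
  have mw : Num.min M w <= w by rewrite ge_min lexx orbT.
  have := @der_ge0_le _ _ _ (Num.min M w) w dh _ mw.
  have /hM : Num.min M w <= M by rewrite ge_min lexx.
  have := gpdf_gt0 (Num.min M w) => h1 h2 h3.
  have : gpdf (Num.min M w) - gcdf (Num.min M w) <= gpdf w - gcdf w; last lra.
  apply: h3 => y /andP[_ yw]; have := gpdf_gt0 y => p0.
  by rewrite (_ : _ - _ = (- y - 1) * gpdf y); [rewrite mulr_ge0//; lra|ring].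
move=> w w0; have [w1|w1] := leP w (-1).
  apply: (le_trans (far w w1)); rewrite ler_peMl//; first exact: ltW (gpdf_gt0 w).
  by rewrite lerDl invr_ge0; exact: ltW.
apply: (le_trans (gcdf_le1 w)); rewrite mulrDl mul1r -[leLHS]add0r lerD//; first exact: ltW (gpdf_gt0 w).
rewrite mulrC ler_pdivlMr// mul1r !gpdfE ler_wpM2l//; first exact: ltW gpeak_gt0.
by rewrite ler_expR lerN2 ler_wpM2r//; nra.
Qed.

Lemma gcdf_tailR : exists2 C : R, 0 < C & forall w, 0 <= w -> 1 - gcdf w <= C * gpdf w.
Proof.
have [C C0 h] := gcdf_tail; exists C => // w w0.
by rewrite -gcdfN -[gpdf w]gpdfN h// oppr_le0.
Qed.

End normal.

(** * Stein's equation *)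

Section weight.
Context (R : realType).
Implicit Types (x z v w c h t : R).

(** The envelope of the Stein solution and its derivative. It varies by at most a factor e over unit
    steps, and its mean at the truncated sum is of order e^{-z/4}. *)
Definition stein_weight z v : R := expR (- (z / 4)) * (expR (v / 2) + expR (- (v / 2))).

Lemma om_ge0 z v : 0 <= stein_weight z v.
Proof. by rewrite mulr_ge0 ?addr_ge0 ?expR_ge0. Qed.

Lemma om_shift z v c : `|c - v| <= 1 -> stein_weight z c <= expR 1 * stein_weight z v.
Proof.
rewrite ler_norml => /andP[h1 h2]; rewrite /stein_weight mulrCA ler_wpM2l ?expR_ge0// mulrDr -!expRD.
by rewrite lerD// ler_expR; lra.
Qed.

Lemma om_crossing z v : 0 <= z -> `|v - z| <= 1 ->
  stein_weight z v <= (1 + expR 1) * (expR (- (z / 4)) * expR (v / 2)).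
Proof.
rewrite ler_norml => z0 /andP[h1 h2]; rewrite /stein_weight mulrCA ler_wpM2l ?expR_ge0// mulrDl mul1r -!expRD.
by rewrite lerD2l ler_expR; lra.
Qed.

Lemma sqr_le_expR t : 0 <= t -> 1 + t ^+ 2 <= 32 * expR (t / 4).
Proof.
move=> t0; have := @expR_ge_Taylor3 R (t / 4) (ltac:(by rewrite divr_ge0)).
have : 0 <= (t / 4) ^+ 3 by rewrite exprn_ge0// divr_ge0.
by move: (expR _) => e; nra.
Qed.

(** The three regions w <= 0, 0 <= w <= z and w >= z match the three behaviours of the Stein
    solution. In each, the polynomial 1 + w^2 is absorbed by e^{|w|/4} and the Gaussian factor
    supplies e^{-z/4} up to the constant e. *)
Lemma om_left z w : 0 <= z -> w <= 0 -> (1 + w ^+ 2) * expR (- (z ^+ 2 / 2)) <= 32 * expR 1 * stein_weight z w.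
Proof.
move=> z0 w0; have := @sqr_le_expR (- w) (ltac:(by rewrite oppr_ge0)); rewrite sqrrN => h.
apply: (@le_trans _ _ (32 * expR (- w / 4) * expR (- (z ^+ 2 / 2)))).
  by rewrite ler_wpM2r ?expR_ge0.
rewrite (_ : 32 * expR 1 * stein_weight z w = 32 * (expR 1 * expR (- (z / 4)) * (expR (w / 2) + expR (- (w / 2))))); last by rewrite /stein_weight; ring.
rewrite -mulrA ler_wpM2l//.
apply: (@le_trans _ _ (expR 1 * expR (- (z / 4)) * expR (- (w / 2)))); last first.
  by rewrite ler_wpM2l ?mulr_ge0 ?expR_ge0// lerDr expR_ge0.
by rewrite -!expRD ler_expR; nra.
Qed.

Lemma om_middle z w : 0 <= w <= z ->
  (1 + w ^+ 2) * expR ((w ^+ 2 - z ^+ 2) / 2) <= 32 * expR 1 * stein_weight z w.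
Proof.
move=> /andP[w0 wz]; have h := sqr_le_expR w0.
apply: (@le_trans _ _ (32 * expR (w / 4) * expR ((w ^+ 2 - z ^+ 2) / 2))).
  by rewrite ler_wpM2r ?expR_ge0.
rewrite -!mulrA ler_wpM2l// /stein_weight mulrA.
apply: (@le_trans _ _ (expR 1 * expR (- (z / 4)) * expR (w / 2))); last first.
  by rewrite ler_wpM2l ?mulr_ge0 ?expR_ge0// lerDl expR_ge0.
rewrite -!expRD ler_expR; have := sqr_ge0 (z - w - 1 / 4); have : 0 <= (z - w) * w by rewrite mulr_ge0// subr_ge0.
by nra.
Qed.

Lemma om_right z w : 0 <= z -> z <= w -> 1 + w ^+ 2 <= 32 * expR 1 * stein_weight z w.
Proof.
move=> z0 zw; apply: (le_trans (sqr_le_expR (le_trans z0 zw))).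
rewrite -mulrA ler_wpM2l// /stein_weight mulrA.
apply: (@le_trans _ _ (expR 1 * expR (- (z / 4)) * expR (w / 2))); last first.
  by rewrite ler_wpM2l ?mulr_ge0 ?expR_ge0// lerDl expR_ge0.
by rewrite -!expRD ler_expR; lra.
Qed.

Lemma mvt_between (f f' : R -> R) v h : (forall x, is_derive x 1 f (f' x)) ->
  exists c, [/\ Num.min v (v + h) <= c <= Num.max v (v + h), `|c - v| <= `|h| & f (v + h) - f v = f' c * h].
Proof.
move=> df; have [h0|/ltW h0] := leP 0 h.
  have [|c /andP[c1 c2] e] := @mvt R f f' v (v + h) df; first lra.
  exists c; rewrite min_l ?max_r ?c1 ?c2//; [|lra|lra].
  by rewrite !ger0_norm//; [rewrite e; split=> //; [lra|ring]|lra].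
have [|c /andP[c1 c2] e] := @mvt R f f' (v + h) v df; first lra.
exists c; rewrite min_r ?max_l ?c1 ?c2//; [|lra|lra].
rewrite !ler0_norm//; [|lra]; split=> //; first lra.
by rewrite -[LHS]opprB e; ring.
Qed.

(* [f' = g + e] with [e] constant, as in Stein's equation on each side of [z]. *)
Lemma side_Taylor (S : pred R) z M e (f g g' : R -> R) v h :
  (forall x y c, S x -> S y -> Num.min x y <= c <= Num.max x y -> S c) ->
  (forall x, is_derive x 1 f (g x + e)) -> (forall x, is_derive x 1 g (g' x)) ->
  (forall x, S x -> `|g' x| <= M * stein_weight z x) -> 0 <= M -> S v -> S (v + h) -> `|h| <= 1 ->
  `|g (v + h) - g v| <= expR 1 * M * stein_weight z v * `|h| /\
  `|f (v + h) - f v - h * (g v + e)| <= expR 1 * M * stein_weight z v * h ^+ 2.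
Proof.
move=> Sc df dg gM M0 Sv Svh h1.
have key c : S c -> `|c - v| <= 1 -> `|g' c| <= expR 1 * M * stein_weight z v.
  move=> Sc' cv; apply: (le_trans (gM c Sc')).
  by rewrite [expR 1 * M]mulrC -mulrA ler_wpM2l//; exact: om_shift.
have [c [c1 c2 ->]] := mvt_between v h dg; split.
  rewrite normrM ler_wpM2r//; apply: key (le_trans c2 h1); exact: Sc c1.
have [k [k1 k2 ->]] := mvt_between v h df.
have Sk : S k by exact: Sc k1.
have [c' [d1 d2 e1]] := mvt_between v (k - v) dg.
rewrite addrC subrK in d1 e1.
have Sc' : S c' by exact: Sc d1.
rewrite (_ : _ - _ = h * (g k - g v)); last ring.
rewrite e1 !normrM mulrCA -[h ^+ 2]real_normK ?num_real// expr2.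
apply: ler_pM; rewrite ?mulr_ge0// ?ler_wpM2l//.
by apply: key => //; exact: le_trans d2 (le_trans k2 h1).
Qed.

End weight.

Lemma der_measurable (R : realType) (f f' : R -> R) :
  (forall x : R, is_derive x 1 f (f' x)) -> measurable_fun setT f.
Proof.
move=> df; apply: continuous_measurable_fun => x.
by have [d _] := df x; apply: differentiable_continuous; exact/derivable1_diffP.
Qed.

Section Stein_solution.
Context (R : realType).
Implicit Types (x z v w c h t : R).

Definition ipdf w : R := (normal_peak 1)^-1 * expR (w ^+ 2 / 2).

Lemma ipdf_ge0 w : 0 <= ipdf w.
Proof. by rewrite mulr_ge0 ?expR_ge0// invr_ge0 ltW ?normal_peak_gt0 ?oner_neq0. Qed.

Lemma gpdf_ipdf w : gpdf w * ipdf w = 1.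
Proof.
rewrite gpdfE /ipdf mulrACA -expRD addNr expR0 mulr1 mulfV//.
by rewrite gt_eqF// gpeak_gt0.
Qed.

Lemma gpdf_ipdf2 z w : gpdf z * ipdf w = expR ((w ^+ 2 - z ^+ 2) / 2).
Proof.
rewrite gpdfE /ipdf mulrACA -expRD mulfV ?mul1r; last by rewrite gt_eqF// gpeak_gt0.
by congr expR; field.
Qed.

Lemma der_ipdf w : is_derive w 1 ipdf (w * ipdf w).
Proof.
rewrite (_ : ipdf = fun w => (normal_peak 1)^-1 * expR (w ^+ 2 / 2))//.
by der; rewrite /ipdf; field; rewrite gt_eqF// gpeak_gt0.
Qed.

(** The two branches of the classical solution of f' - w f = 1(w <= z) - gcdf z. Each is kept as a
    function smooth on the whole line, so that the mean value theorem needs no one-sided derivatives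
    at [z]. *)
Definition steinL z w := (1 - gcdf z) * (gcdf w * ipdf w).
Definition steinR z w := gcdf z * ((1 - gcdf w) * ipdf w).

Lemma sgcdf_ge0 w : 0 <= 1 - gcdf w.
Proof. by rewrite subr_ge0 gcdf_le1. Qed.

Lemma steinL_ge0 z w : 0 <= steinL z w.
Proof. by apply: mulr_ge0; [exact: sgcdf_ge0|apply: mulr_ge0; [exact: gcdf_ge0|exact: ipdf_ge0]]. Qed.

Lemma steinR_ge0 z w : 0 <= steinR z w.
Proof. by apply: mulr_ge0; [exact: gcdf_ge0|apply: mulr_ge0; [exact: sgcdf_ge0|exact: ipdf_ge0]]. Qed.

Lemma der_steinL z w : is_derive w 1 (steinL z) (w * steinL z w + (1 - gcdf z)).
Proof.
have d1 := derM (der_gcdf w) (der_ipdf w).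
apply: (der_cast (derM (derC (1 - gcdf z) w) d1)).
by rewrite mulr0 addr0 -[ipdf w * gpdf w]mulrC gpdf_ipdf /steinL; ring.
Qed.

Lemma der_steinR z w : is_derive w 1 (steinR z) (w * steinR z w + - gcdf z).
Proof.
have d1 := derM (derB (derC 1 w) (der_gcdf w)) (der_ipdf w).
apply: (der_cast (derM (derC (gcdf z) w) d1)).
have := gpdf_ipdf w; rewrite mulr0 addr0 sub0r mulrN -[ipdf w * gpdf w]mulrC => ->.
by rewrite /steinR; ring.
Qed.

Lemma der_id_mul f (e : R) w : is_derive w 1 f (w * f w + e) ->
  is_derive w 1 (fun x => x * f x) ((1 + w ^+ 2) * f w + w * e).
Proof. by move=> df; apply: (der_cast (derM (derI w) df)); ring. Qed.

Lemma steinLR z : steinL z z = steinR z z.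
Proof. by rewrite /steinL /steinR; ring. Qed.

(** The derivative of w f(w) is (1 + w^2) f + w e, where e is the constant of the equation; hence
    the factor 1 + w^2 and the companion bounds on the constants. The tail bounds on gcdf turn each
    quantity into one of the three weighted estimates. *)
Lemma stein_bounds : exists2 M : R, 0 <= M & forall z, 0 <= z ->
  (forall w, w <= z -> (1 + w ^+ 2) * steinL z w <= M * stein_weight z w /\ (1 + w ^+ 2) * (1 - gcdf z) <= M * stein_weight z w) /\
  (forall w, z <= w -> (1 + w ^+ 2) * steinR z w <= M * stein_weight z w /\ 1 + w ^+ 2 <= M * stein_weight z w).
Proof.
have [C1 C10 h1] := gcdf_tail R; have [C2 C20 h2] := gcdf_tailR R.
pose c : R := normal_peak 1; have c0 : 0 < c by exact: gpeak_gt0.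
pose C := C1 + C2; have C0 : 0 <= C by rewrite addr_ge0// ltW.
have t1 w : w <= 0 -> gcdf w <= C * gpdf w.
  by move=> w0; apply: (le_trans (h1 w w0)); rewrite ler_wpM2r ?(ltW (gpdf_gt0 _))// lerDl ltW.
have t2 w : 0 <= w -> 1 - gcdf w <= C * gpdf w.
  by move=> w0; apply: (le_trans (h2 w w0)); rewrite ler_wpM2r ?(ltW (gpdf_gt0 _))// lerDr ltW.
pose A : R := 32 * expR 1; have A0 : 0 <= A by rewrite mulr_ge0// expR_ge0.
pose M := (C ^+ 2 * c + C + C * c + 1) * A.
have p0 : 0 <= C ^+ 2 * c by rewrite mulr_ge0 ?sqr_ge0// ltW.
have p1 : 0 <= C * c by rewrite mulr_ge0// ltW.
exists M => [|z z0]; first by rewrite mulr_ge0//; lra.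
have big a w : 0 <= a -> a <= C ^+ 2 * c + C + C * c + 1 -> a * (A * stein_weight z w) <= M * stein_weight z w.
  by move=> a0 ha; rewrite mulrA ler_wpM2r ?om_ge0// /M ler_wpM2r.
have sq0 w : 0 <= 1 + w ^+ 2 by rewrite addr_ge0// sqr_ge0.
have pz := gpdfE z; have Fz := t2 z z0.
split=> w wz; split.
- have [w0|/ltW w0] := leP w 0.
    apply: (@le_trans _ _ (C ^+ 2 * c * ((1 + w ^+ 2) * expR (- (z ^+ 2 / 2))))); last first.
      apply: (le_trans (ler_wpM2l p0 (om_left z0 w0))); apply: big => //; lra.
    rewrite [leRHS]mulrCA ler_wpM2l//.
    rewrite (_ : C ^+ 2 * c * _ = (C * gpdf z) * (C * (gpdf w * ipdf w))); last by rewrite gpdf_ipdf pz -/c; ring.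
    apply: ler_pM => //; [exact: sgcdf_ge0|by apply: mulr_ge0; [exact: gcdf_ge0|exact: ipdf_ge0]|].
    by rewrite mulrA ler_wpM2r ?ipdf_ge0// t1.
  apply: (@le_trans _ _ (C * ((1 + w ^+ 2) * expR ((w ^+ 2 - z ^+ 2) / 2)))); last first.
    apply: (le_trans (ler_wpM2l C0 (om_middle _))); first by rewrite w0.
    apply: big => //; lra.
  rewrite [leRHS]mulrCA ler_wpM2l// -gpdf_ipdf2 mulrA.
  apply: ler_pM => //; [exact: sgcdf_ge0|by apply: mulr_ge0; [exact: gcdf_ge0|exact: ipdf_ge0]|].
  by rewrite ler_piMl ?ipdf_ge0// gcdf_le1.
- apply: (@le_trans _ _ (C * c * ((1 + w ^+ 2) * expR (- (z ^+ 2 / 2))))).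
    by rewrite [leRHS]mulrCA ler_wpM2l// -mulrA -pz.
  have [w0|/ltW w0] := leP w 0.
    apply: (le_trans (ler_wpM2l p1 (om_left z0 w0))); apply: big => //; lra.
  apply: (@le_trans _ _ (C * c * ((1 + w ^+ 2) * expR ((w ^+ 2 - z ^+ 2) / 2)))).
    by rewrite ler_wpM2l// ler_wpM2l// ler_expR; have := sqr_ge0 w; lra.
  apply: (le_trans (ler_wpM2l p1 (om_middle _))); first by rewrite w0.
  apply: big => //; lra.
- apply: (@le_trans _ _ (C * (1 + w ^+ 2))); last first.
    apply: (le_trans (ler_wpM2l C0 (om_right z0 wz))); apply: big => //; lra.
  rewrite mulrC ler_wpM2r// -[leRHS]mul1r; apply: ler_pM; rewrite ?gcdf_ge0 ?gcdf_le1//.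
    by rewrite mulr_ge0 ?ipdf_ge0// subr_ge0 gcdf_le1.
  rewrite [leRHS](_ : C = C * gpdf w * ipdf w); last by rewrite -mulrA gpdf_ipdf mulr1.
  rewrite ler_wpM2r ?ipdf_ge0//.
  by apply: t2; exact: le_trans wz.
have h := big 1 w ler01 (ltac:(lra)); rewrite mul1r in h.
exact: le_trans (om_right z0 wz) h.
Qed.

(** [D] plays the role of f'. Away from [z] it is smooth; a step that may cross [z] is charged to
    the indicator |v - z| <= |h|. The value [b z] is left free, so open and closed half-lines are
    both covered, as the reflection of negative [z] requires. *)
Lemma Stein_solution : exists2 K : R, 0 <= K & forall z (b : R -> bool), 0 <= z ->
  measurable_fun setT b -> (forall w, w < z -> b w) -> (forall w, z < w -> ~~ b w) ->
  exists f : R -> R, let D w := w * f w + (b w)%:R - gcdf z in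
  [/\ measurable_fun setT f, forall w, `|f w| <= K * stein_weight z w, forall w, `|D w| <= K * stein_weight z w,
    forall v h, `|h| <= 1 -> `|D (v + h) - D v| <=
      K * (stein_weight z v * `|h| + (`|v - z| <= `|h|)%R%:R * (expR (- (z / 4)) * expR (v / 2))) &
    forall v h, `|h| <= 1 -> `|f (v + h) - f v - h * D v| <=
      K * (stein_weight z v * h ^+ 2 + `|h| * (`|v - z| <= `|h|)%R%:R * (expR (- (z / 4)) * expR (v / 2)))].
Proof.
have [M M0 bM] := stein_bounds.
pose e1 : R := expR 1; have e10 : 1 <= e1 by rewrite -expR0 ler_expR.
pose K := 4 * M * (1 + e1) ^+ 2.
have KM : 2 * M * (1 + e1) * (1 + e1) <= K by rewrite /K; nra.
have K0 : 0 <= K by apply: mulr_ge0; [exact: mulr_ge0|exact: sqr_ge0].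
have eM : e1 * (2 * M) <= K by rewrite /K; nra.
have MK : M <= K by rewrite /K; nra.
have MK2 : 2 * M <= K by rewrite /K; nra.
exists K => // z b z0 mb bl br; have [bL bR] := bM z z0.
pose f w := if w <= z then steinL z w else steinR z w.
have fL w : w <= z -> f w = steinL z w by rewrite /f => ->.
have fR w : z <= w -> f w = steinR z w.
  rewrite /f; case: ltgtP => // -> _; exact: steinLR.
have big w (a : R) : 0 <= a -> (1 + w ^+ 2) * a <= M * stein_weight z w -> a <= M * stein_weight z w /\ `|w| * a <= M * stein_weight z w.
  move=> a0 h; have : 0 <= (`|w| - 1 / 2) ^+ 2 by exact: sqr_ge0.
  have : `|w| ^+ 2 = w ^+ 2 by rewrite real_normK ?num_real.
  move: h; move: (stein_weight z w) `|w| (w ^+ 2) (sqr_ge0 w) => o t s s0 h1 ts h2; split; nra.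
pose gL w := w * steinL z w; pose gR w := w * steinR z w.
pose gL' w := (1 + w ^+ 2) * steinL z w + w * (1 - gcdf z).
pose gR' w := (1 + w ^+ 2) * steinR z w + w * - gcdf z.
have dgL w : is_derive w 1 gL (gL' w) by apply: der_id_mul; exact: der_steinL.
have dgR w : is_derive w 1 gR (gR' w) by apply: der_id_mul; exact: der_steinR.
have nD w (a1 a2 : R) : `|a1| <= M * stein_weight z w -> `|a2| <= M * stein_weight z w -> `|a1 + a2| <= 2 * M * stein_weight z w.
  move=> h1 h2; apply: (le_trans (ler_normD _ _)).
  by rewrite (_ : 2 * M * stein_weight z w = M * stein_weight z w + M * stein_weight z w); [exact: lerD|ring].
have gLb w : w <= z -> `|gL' w| <= 2 * M * stein_weight z w.
  move=> wz; have [h1 h2] := bL w wz; apply: nD.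
    by rewrite ger0_norm//; apply: mulr_ge0; [rewrite addr_ge0// sqr_ge0|exact: steinL_ge0].
  rewrite normrM [`|1 - _|]ger0_norm ?sgcdf_ge0//.
  by have [] := big w _ (sgcdf_ge0 z) h2.
have gRb w : z <= w -> `|gR' w| <= 2 * M * stein_weight z w.
  move=> wz; have [h1 h2] := bR w wz; apply: nD.
    by rewrite ger0_norm//; apply: mulr_ge0; [rewrite addr_ge0// sqr_ge0|exact: steinR_ge0].
  rewrite normrM normrN [`|gcdf _|]ger0_norm ?gcdf_ge0//.
  have [//||_] := big w 1; first by rewrite mulr1.
  by rewrite mulr1; apply: le_trans; rewrite ler_piMr// gcdf_le1.
pose D w := w * f w + (b w)%:R - gcdf z.
have DL w : w < z -> D w = gL w + (1 - gcdf z).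
  by move=> wz; rewrite /D (bl w wz) fL ?ltW// addrA.
have DR w : z < w -> D w = gR w + - gcdf z.
  by move=> wz; rewrite /D (negbTE (br w wz)) fR ?ltW// addr0.
have fb w : `|f w| <= M * stein_weight z w.
  have [wz|/ltW wz] := leP w z.
    rewrite fL// ger0_norm ?steinL_ge0//; have [h1 _] := bL w wz.
    by have [] := big w _ (steinL_ge0 z w) h1.
  rewrite fR// ger0_norm ?steinR_ge0//; have [h1 _] := bR w wz.
  by have [] := big w _ (steinR_ge0 z w) h1.
have LLb w : w <= z -> `|gL w + (1 - gcdf z)| <= 2 * M * stein_weight z w.
  move=> wz; have [h1 h2] := bL w wz.
  apply: nD.
    rewrite normrM [`|steinL _ _|]ger0_norm ?steinL_ge0//.
    by have [] := big w _ (steinL_ge0 z w) h1.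
  by rewrite ger0_norm ?sgcdf_ge0//; have [] := big w _ (sgcdf_ge0 z) h2.
have RRb w (e : R) : z <= w -> `|e| <= 1 -> `|gR w + e| <= 2 * M * stein_weight z w.
  move=> wz he; have [h1 h2] := bR w wz.
  apply: nD.
    rewrite normrM [`|steinR _ _|]ger0_norm ?steinR_ge0//.
    by have [] := big w _ (steinR_ge0 z w) h1.
  by apply: (le_trans he); apply: le_trans h2; rewrite lerDl sqr_ge0.
have cz : `|- gcdf z| <= 1 by rewrite normrN ger0_norm ?gcdf_ge0// gcdf_le1.
have Db w : `|D w| <= 2 * M * stein_weight z w.
  have [wz|wz] := ltP w z; first by rewrite DL//; exact: LLb (ltW wz).
  rewrite /D fR// -addrA; apply: RRb => //.
  have := gcdf_ge0 z; have := gcdf_le1 z; rewrite ler_norml; case: (b w) => /= *; apply/andP; split; lra.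
(* The solution is continuous at [z], so its Lipschitz bound is obtained by splitting the interval
   there. *)
have lip u w B : u <= w -> (forall c, u <= c <= w -> stein_weight z c <= B) -> `|f w - f u| <= 2 * M * B * (w - u).
  have lipL u' w' : u' <= w' -> w' <= z -> (forall c, u' <= c <= w' -> stein_weight z c <= B) ->
      `|f w' - f u'| <= 2 * M * B * (w' - u').
    move=> uw wz hB; rewrite !fL//; last exact: le_trans wz.
    have [c /andP[c1 c2] ->] := mvt (der_steinL z) uw.
    rewrite normrM [`|w' - _|]ger0_norm ?subr_ge0// ler_wpM2r ?subr_ge0//.
    apply: (le_trans (LLb c (le_trans c2 wz))).
    by rewrite ler_wpM2l// ?hB ?c1 ?c2// mulr_ge0.
  have lipR u' w' : u' <= w' -> z <= u' -> (forall c, u' <= c <= w' -> stein_weight z c <= B) ->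
      `|f w' - f u'| <= 2 * M * B * (w' - u').
    move=> uw wz hB; rewrite !fR//; last exact: le_trans uw.
    have [c /andP[c1 c2] ->] := mvt (der_steinR z) uw.
    rewrite normrM [`|w' - _|]ger0_norm ?subr_ge0// ler_wpM2r ?subr_ge0//.
    apply: (le_trans (RRb c _ (le_trans wz c1) cz)).
    by rewrite ler_wpM2l// ?hB ?c1 ?c2// mulr_ge0.
  move=> uw hB; have [wz|/ltW zw] := leP w z; first exact: lipL.
  have [uz|/ltW zu] := leP u z; last exact: lipR.
  have h1 : `|f w - f z| <= 2 * M * B * (w - z).
    by apply: lipR => // c /andP[c1 c2]; apply: hB; rewrite c2 (le_trans uz).
  have h2 : `|f z - f u| <= 2 * M * B * (z - u).
    by apply: lipL => // c /andP[c1 c2]; apply: hB; rewrite c1 (le_trans c2).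
  rewrite (_ : f w - f u = (f w - f z) + (f z - f u)); last by ring.
  apply: (le_trans (ler_normD _ _)); apply: (le_trans (lerD h1 h2)).
  by rewrite le_eqVlt; apply/orP; left; apply/eqP; ring.
have side v h : `|h| <= 1 -> [\/ v < z /\ v + h < z, z < v /\ z < v + h | `|v - z| <= `|h|].
  move=> h1; have := ler_norm h; have := ler_norm (- h); rewrite normrN => n1 n2.
  case: (ltgtP v z) => vz; last by constructor 3; rewrite vz subrr normr0.
    case: (ltP (v + h) z) => vhz; first by constructor 1.
    by constructor 3; rewrite ler0_norm; lra.
  case: (ltP z (v + h)) => vhz; first by constructor 2.
  by constructor 3; rewrite ger0_norm; lra.
have SL (x y c : R) : x <= z -> y <= z -> Num.min x y <= c <= Num.max x y -> c <= z.
  by move=> xz yz /andP[_ /le_trans]; apply; rewrite ge_max xz.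
have SR (x y c : R) : z <= x -> z <= y -> Num.min x y <= c <= Num.max x y -> z <= c.
  by move=> xz yz /andP[+ _]; apply: le_trans; rewrite le_min xz.
have M20 : 0 <= 2 * M by exact: mulr_ge0.
have TL v h : v < z -> v + h < z -> `|h| <= 1 -> `|gL (v + h) - gL v| <= e1 * (2 * M) * stein_weight z v * `|h| /\
    `|steinL z (v + h) - steinL z v - h * (gL v + (1 - gcdf z))| <= e1 * (2 * M) * stein_weight z v * h ^+ 2.
  move=> vz vhz h1.
  by apply: (@side_Taylor R (fun x => x <= z) z (2 * M) (1 - gcdf z) (steinL z) gL gL') => //;
    [exact: der_steinL|exact: ltW|exact: ltW].
have TR v h : z < v -> z < v + h -> `|h| <= 1 -> `|gR (v + h) - gR v| <= e1 * (2 * M) * stein_weight z v * `|h| /\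
    `|steinR z (v + h) - steinR z v - h * (gR v + - gcdf z)| <= e1 * (2 * M) * stein_weight z v * h ^+ 2.
  move=> vz vhz h1.
  by apply: (@side_Taylor R (fun x => z <= x) z (2 * M) (- gcdf z) (steinR z) gR gR') => //;
    [exact: der_steinR|exact: ltW|exact: ltW].
pose wt v := expR (- (z / 4)) * expR (v / 2) : R.
have wt0 v : 0 <= wt v by rewrite mulr_ge0 ?expR_ge0.
have fin v (X r : R) (c : bool) : 0 <= r -> X <= e1 * (2 * M) * stein_weight z v * r -> X <= K * (stein_weight z v * r + c%:R * wt v).
  move=> r0 hX; apply: (le_trans hX); rewrite -mulrA.
  apply: (@le_trans _ _ (K * (stein_weight z v * r))).
    by rewrite ler_wpM2r// mulr_ge0// om_ge0.
  by rewrite ler_wpM2l// lerDl mulr_ge0.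
(* Within distance 1 of z >= 0 the part e^{v/2} dominates the weight; this is the form that the
   concentration bound controls. *)
have cr v h : `|h| <= 1 -> `|v - z| <= `|h| -> 2 * M * (1 + e1) * stein_weight z v <= K * wt v.
  move=> h1 vz; apply: (@le_trans _ _ (2 * M * (1 + e1) * ((1 + e1) * wt v))).
    rewrite ler_wpM2l//; first by rewrite mulr_ge0// addr_ge0// expR_ge0.
    by apply: om_crossing => //; exact: le_trans vz h1.
  by rewrite mulrA ler_wpM2r.
have osh v h c : `|h| <= 1 -> `|c - v| <= `|h| -> stein_weight z c <= e1 * stein_weight z v.
  by move=> h1 /le_trans/(_ h1); exact: om_shift.
exists f; split.
- rewrite /f; apply: measurable_fun_ifT.
  + by apply: measurable_fun_ler => //; exact: measurable_cst.
  + exact: der_measurable (der_steinL z).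
  + exact: der_measurable (der_steinR z).
- by move=> w; apply: (le_trans (fb w)); rewrite ler_wpM2r ?om_ge0.
- by move=> w; apply: (le_trans (Db w)); rewrite ler_wpM2r ?om_ge0.
- move=> v h h1; rewrite -/(D (v + h)) -/(D v) -/(wt v).
  case: (side v h h1) => [[vz vhz]|[vz vhz]|vz].
  + have [t1 _] := TL v h vz vhz h1; apply: fin => //.
    by rewrite !DL//; move: t1; congr (`|_| <= _); ring.
  + have [t1 _] := TR v h vz vhz h1; apply: fin => //.
    by rewrite !DR//; move: t1; congr (`|_| <= _); ring.
  rewrite vz mul1r (le_trans (ler_normB _ _))//.
  apply: (@le_trans _ _ (2 * M * (1 + e1) * stein_weight z v)).
    apply: (le_trans (lerD (Db _) (Db _))).
    have : stein_weight z (v + h) <= e1 * stein_weight z v by apply: (osh v h) => //; rewrite addrAC subrr add0r.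
    by move=> /(ler_wpM2l M20); lra.
  apply: (le_trans (cr v h h1 vz)); rewrite ler_wpM2l// lerDr mulr_ge0 ?om_ge0//.
move=> v h h1; rewrite -/(D v) -/(wt v).
case: (side v h h1) => [[vz vhz]|[vz vhz]|vz].
- have [_ t1] := TL v h vz vhz h1.
  apply: (@le_trans _ _ (e1 * (2 * M) * stein_weight z v * h ^+ 2)).
    by move: t1; rewrite DL// !fL// ltW.
  apply: (@le_trans _ _ (K * (stein_weight z v * h ^+ 2))).
    by rewrite -mulrA ler_wpM2r// mulr_ge0 ?om_ge0// sqr_ge0.
  by rewrite ler_wpM2l// lerDl; apply: mulr_ge0 => //; exact: mulr_ge0.
- have [_ t1] := TR v h vz vhz h1.
  apply: (@le_trans _ _ (e1 * (2 * M) * stein_weight z v * h ^+ 2)).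
    by move: t1; rewrite DR// !fR// ltW.
  apply: (@le_trans _ _ (K * (stein_weight z v * h ^+ 2))).
    by rewrite -mulrA ler_wpM2r// mulr_ge0 ?om_ge0// sqr_ge0.
  by rewrite ler_wpM2l// lerDl; apply: mulr_ge0 => //; exact: mulr_ge0.
rewrite vz mulr1 (le_trans (ler_normB _ _))//.
apply: (@le_trans _ _ (K * (`|h| * wt v))); last first.
  by rewrite ler_wpM2l// lerDr mulr_ge0 ?om_ge0 ?sqr_ge0.
rewrite mulrCA; apply: le_trans (ler_wpM2l (normr_ge0 h) (cr v h h1 vz)).
have l1 : `|f (v + h) - f v| <= 2 * M * (e1 * stein_weight z v) * `|h|.
  have [h0|/ltW h0] := leP 0 h.
    rewrite (_ : `|h| = v + h - v); last by rewrite ger0_norm//; ring.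
    apply: lip; first lra.
    by move=> c /andP[c1 c2]; apply: (osh v h) => //; rewrite !ger0_norm//; lra.
  rewrite distrC [`|h|]ler0_norm// (_ : - h = v - (v + h)); last ring.
  apply: lip; first lra.
  by move=> c /andP[c1 c2]; apply: (osh v h) => //; rewrite !ler0_norm//; lra.
rewrite normrM; have := ler_wpM2l (normr_ge0 h) (Db v); move: l1.
by move: `|f _ - _| `|D v| `|h| (stein_weight z v) => *; lra.
Qed.

End Stein_solution.

(** * Two-sided truncation *)

Section truncated_sum.
Context d (Omega : measurableType d) (R : realType) (P : probability Omega R).
Context (n : nat) (X D : 'I_n -> {RV P >-> R}).
Hypothesis indep : forall i, independent2 P (X i) (fun w => (D i w, sample_but X i w)).
Local Notation on := (on X).
Local Notation Ex := (Ex P).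
Local Notation Int := (Int P).

Variables (xi : 'I_n -> Omega -> R).
Hypothesis oxi : forall j, on j (xi j).
Hypothesis Ixi : forall j, Int (fun w => xi j w ^+ 2).
Hypothesis xi0 : forall j, Ex (xi j) = 0.
Hypothesis sum_sig : \sum_(j < n) Ex (fun w => xi j w ^+ 2) = 1.
Local Notation sig := (second_moment P xi).

Definition trunc j w := xi j w * (`|xi j w| <= 1)%R%:R.
(** A third absolute moment capped so that it is finite under second moments alone; for m = 1 it
    also dominates the effects of truncation at 1. *)
Definition capped_cube (m : R) j w := xi j w ^+ 2 * Num.min m `|xi j w|.
Definition lyapunov (m : R) := \sum_(j < n) Ex (capped_cube m j).

Let mxi j : Mfun (xi j). Proof. exact: on_Mfun (oxi j). Qed.

Lemma ott j : on j (trunc j).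
Proof. by apply: onM => //; apply: on_ler; [exact: on_norm|exact: on_cst]. Qed.

Lemma tt_or j w : trunc j w = 0 \/ trunc j w = xi j w.
Proof. by rewrite /trunc; case: (_ <= _); rewrite ?mulr1 ?mulr0; [right|left]. Qed.

Lemma tt_le1 j w : `|trunc j w| <= 1.
Proof. by rewrite /trunc; case: (leP `|xi j w| 1) => h; rewrite ?mulr1 ?mulr0 ?normr0. Qed.

Lemma tt_le j w : `|trunc j w| <= `|xi j w|.
Proof. by case: (tt_or j w) => ->//; rewrite normr0. Qed.

Lemma ok3 m j : on j (capped_cube m j).
Proof. by apply: onM; [exact: onX|apply: on_min; [exact: on_cst|exact: on_norm]]. Qed.

Lemma k3_ge0 m j w : 0 <= m -> 0 <= capped_cube m j w.
Proof. by move=> m0; rewrite mulr_ge0 ?sqr_ge0// le_min m0 normr_ge0. Qed.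

Lemma k3_le m j w : 0 <= m -> capped_cube m j w <= m * xi j w ^+ 2.
Proof. by move=> m0; rewrite /capped_cube mulrC ler_wpM2r ?sqr_ge0// ge_min lexx. Qed.

Lemma Ik3 m j : 0 <= m -> Int (capped_cube m j).
Proof.
move=> m0; apply: (@Int_le _ _ _ _ _ (fun w => m * xi j w ^+ 2)).
- exact: on_Mfun (ok3 m j).
- by move=> w; rewrite ger0_norm ?k3_ge0//; exact: k3_le.
- exact: IntZl.
Qed.

Lemma lya_ge0 m : 0 <= m -> 0 <= lyapunov m.
Proof. by move=> m0; apply: sumr_ge0 => j _; apply: Ex_ge0 => w; exact: k3_ge0. Qed.

Lemma lya1_le1 : lyapunov 1 <= 1.
Proof.
rewrite -[leRHS]sum_sig; apply: ler_sum => j _; apply: Ex_le; [by apply: Ik3|exact: Ixi|move=> w].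
by rewrite -[leRHS]mul1r; exact: k3_le.
Qed.

Lemma mtt j : Mfun (trunc j). Proof. exact: on_Mfun (ott j). Qed.
Lemma Itt j : Int (trunc j). Proof. exact: Int_bnd (mtt j) (tt_le1 j). Qed.

Let tt_cases j w : (`|xi j w| <= 1 /\ trunc j w = xi j w /\ capped_cube 1 j w = `|xi j w| * xi j w ^+ 2) \/
  (1 < `|xi j w| /\ trunc j w = 0 /\ capped_cube 1 j w = xi j w ^+ 2).
Proof.
rewrite /trunc /capped_cube; case: (leP `|xi j w| 1) => h; [left|right]; rewrite ?mulr1 ?mulr0.
  by split=> //; split=> //; rewrite mulrC.
by [].
Qed.

Let xi_sq j w : xi j w ^+ 2 = `|xi j w| ^+ 2.
Proof. by rewrite real_normK ?num_real. Qed.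

(** By centering, the mean of the truncation is minus the mean of the discarded part, where |xi| <=
    xi^2. *)
Lemma Ex_tt_le j : `|Ex (trunc j)| <= Ex (capped_cube 1 j).
Proof.
have Ix : Int (xi j) by exact: Int_of_sq.
have -> : Ex (trunc j) = - Ex (fun w => xi j w - trunc j w).
  by rewrite ExB//; [rewrite xi0 sub0r opprK|exact: Itt].
rewrite normrN; apply: (le_trans (Ex_norm (IntB Ix (Itt j)))).
apply: Ex_le; [apply: Int_norm; apply: IntB => //; exact: Itt|by apply: Ik3|move=> w].
case: (tt_cases j w) => [[h [-> ->]]|[h [-> ->]]]; first by rewrite subrr normr0 mulr_ge0 ?sqr_ge0.
rewrite subr0 xi_sq; nra.
Qed.

Lemma Itt2 j : Int (fun w => trunc j w ^+ 2).
Proof.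
apply: (@Int_bnd _ _ _ _ _ (1 ^+ 2)); first exact/MfunX/mtt.
by move=> w; apply: normX2_le; exact: tt_le1.
Qed.

Lemma Ex_tt2_ge j : sig j - Ex (capped_cube 1 j) <= Ex (fun w => trunc j w ^+ 2).
Proof.
rewrite -ExB//; last by apply: Ik3.
apply: Ex_le; [apply: IntB => //; by apply: Ik3|exact: Itt2|move=> w].
case: (tt_cases j w) => [[h [-> ->]]|[h [-> ->]]].
  by rewrite lerBlDr lerDl mulr_ge0 ?sqr_ge0.
by rewrite subrr sqr_ge0.
Qed.

Lemma Ex_tt2_le j : Ex (fun w => trunc j w ^+ 2) <= sig j.
Proof.
apply: Ex_le => //; [exact: Itt2|move=> w].
by rewrite xi_sq -[trunc j w ^+ 2]real_normK ?num_real// lerXn2r ?nnegrE//; exact: tt_le.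
Qed.

Lemma Itt3 j : Int (fun w => `|trunc j w| * trunc j w ^+ 2).
Proof.
apply: (@Int_bnd _ _ _ _ _ 1).
  by apply: MfunM; [exact/Mfun_norm/mtt|exact/MfunX/mtt].
move=> w; rewrite normrM normr_id normrX; have := tt_le1 j w; have := normr_ge0 (trunc j w).
by move: `|trunc j w| => t t0 t1; nra.
Qed.

Lemma Ex_tt3_le j : Ex (fun w => `|trunc j w| * trunc j w ^+ 2) <= Ex (capped_cube 1 j).
Proof.
apply: Ex_le; [exact: Itt3|by apply: Ik3|move=> w].
case: (tt_cases j w) => [[h [-> ->]]|[h [-> ->]]] //.
by rewrite normr0 mul0r sqr_ge0.
Qed.

(* Chebyshev's association inequality: [(t^2 - a^2) (t - a) >= 0] with [a = E t]. *)
Lemma Ex_tt_cheb j : Ex (fun w => trunc j w ^+ 2) * Ex (fun w => `|trunc j w|) <= Ex (fun w => `|trunc j w| * trunc j w ^+ 2).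
Proof.
set a := Ex (fun w => `|trunc j w|).
have a0 : 0 <= a by apply: Ex_ge0.
have In : Int (fun w => `|trunc j w|) by apply: Int_norm; exact: Itt.
have : 0 <= Ex (fun w => `|trunc j w| * trunc j w ^+ 2 - a * trunc j w ^+ 2 - (a ^+ 2 * `|trunc j w| - a ^+ 3)).
  apply: Ex_ge0 => w; rewrite -[trunc j w ^+ 2]real_normK ?num_real//.
  have := normr_ge0 (trunc j w); move: `|trunc j w| => t t0.
  rewrite (_ : _ - _ = (t - a) ^+ 2 * (t + a)); last ring.
  by rewrite mulr_ge0 ?sqr_ge0// addr_ge0.
rewrite ExB; [|apply: IntB; [exact: Itt3|exact/IntZl/Itt2]|by apply: IntB; [exact: IntZl|exact: Int_cst]].
rewrite ExB; [|exact: Itt3|exact/IntZl/Itt2].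
rewrite ExB; [|exact: IntZl|exact: Int_cst].
rewrite (ExZl a (Itt2 j)) (ExZl (a ^+ 2) In) Ex_cst -/a; lra.
Qed.

(** Two-sided truncation may shift the mean, but by at most the variance, so the exponent of
    Bennett's bound becomes at most e^t - 1 < 2. The sign [s] covers both tails. *)
Lemma mgf_tt Q (s t : R) : `|s| = 1 -> 0 <= t <= 1 -> Ex (fun w => expR (t * Sm Q (fun j w => s * trunc j w) w)) <= expR 2.
Proof.
move=> s1 /andP[t0 t1]; have c0 : 0 <= expR t - 1 - t by have := expR_ge1Dx t; lra.
have et : expR t <= expR 1 by rewrite ler_expR.
have e3 := expR1_lt R.
apply: (@le_trans _ _ (expR (\sum_(j < n | Q j) (expR t - 1) * sig j))).
  apply: (Ex_expR_Sm_le indep Q t0).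
  - by move=> j; apply: onM; [exact: on_cst|exact: ott].
  - by move=> j w; apply: (le_trans (ler_norm _)); rewrite normrM s1 mul1r tt_le1.
  - move=> j; rewrite (_ : (fun w => _) = (fun w => trunc j w ^+ 2)); first exact: Itt2.
    by apply/funext => w; rewrite exprMn -[s ^+ 2]real_normK ?num_real// s1 expr1n mul1r.
  move=> j; rewrite (_ : (fun w => _ ^+ 2) = (fun w => trunc j w ^+ 2)); last first.
    by apply/funext => w; rewrite exprMn -[s ^+ 2]real_normK ?num_real// s1 expr1n mul1r.
  have h2 : Ex (fun w => s * trunc j w) <= sig j.
    rewrite ExZl; last exact: Itt.
    apply: (le_trans (ler_norm _)); rewrite normrM s1 mul1r (le_trans (Ex_tt_le j))//.
    apply: Ex_le => //; [by apply: Ik3|move=> w]; rewrite -[leRHS]mul1r; exact: k3_le.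
  have := ler_wpM2l t0 h2; have := ler_wpM2l c0 (Ex_tt2_le j); lra.
rewrite ler_expR -mulr_sumr.
have h := sum_sig_le1 sum_sig Q.
have e0 : 0 <= expR t - 1 by lra.
by have := ler_wpM2l e0 h; lra.
Qed.

Local Notation V Q := (Sm Q trunc).

Lemma V_le Q w : `|V Q w| <= n%:R.
Proof.
apply: (le_trans (ler_norm_sum _ _ _)); apply: (@le_trans _ _ (\sum_(j < n | Q j) 1)).
  by apply: ler_sum => j _; exact: tt_le1.
by rewrite sumr_const ler_nat (leq_trans (max_card _))// card_ord.
Qed.

Lemma mV Q : Mfun (V Q). Proof. exact: Mfun_Sm ott. Qed.

Lemma om_bnd z Q w : stein_weight z (V Q w) <= expR (- (z / 4)) * (expR (n%:R / 2) + expR (n%:R / 2)).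
Proof.
have := V_le Q w; rewrite ler_norml => /andP[h1 h2].
by rewrite /stein_weight ler_wpM2l ?expR_ge0// lerD// ler_expR; lra.
Qed.

Lemma mom (z : R) f : Mfun f -> Mfun (fun w : Omega => stein_weight z (f w)).
Proof.
move=> mf; apply: MfunM; first exact: Mfun_cst.
apply: MfunD; apply: Mfun_exp; last apply: MfunN; by apply: MfunM => //; exact: Mfun_cst.
Qed.

Lemma Iom z Q : Int (fun w => stein_weight z (V Q w)).
Proof.
apply: (@Int_bnd _ _ _ _ _ (expR (- (z / 4)) * (expR (n%:R / 2) + expR (n%:R / 2)))).
  exact/mom/mV.
by move=> w; rewrite ger0_norm ?om_ge0//; exact: om_bnd.
Qed.

Lemma Ex_om_le z Q : Ex (fun w => stein_weight z (V Q w)) <= 2 * expR 2 * expR (- (z / 4)).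
Proof.
have I s (t : R) : `|s| = 1 -> 0 <= t -> Int (fun w => expR (t * Sm Q (fun j w => s * trunc j w) w)).
  move=> s1 t0; apply: (@Int_expR_Sm _ _ _ _ _ X) => //.
    by move=> j; apply: onM; [exact: on_cst|exact: ott].
  by move=> j w; apply: (le_trans (ler_norm _)); rewrite normrM s1 mul1r tt_le1.
have n1 : `|-1 : R| = 1 by rewrite normrN normr1.
have h2 : 0 <= 2^-1 :> R by lra.
have E1 := mgf_tt Q (normr1 R) (ltac:(by apply/andP; split; lra) : 0 <= 2^-1 <= 1).
have E2 := mgf_tt Q n1 (ltac:(by apply/andP; split; lra) : 0 <= 2^-1 <= 1).
rewrite (_ : (fun w => stein_weight z (V Q w)) = (fun w => expR (- (z / 4)) *
   (expR (2^-1 * Sm Q (fun j w => 1 * trunc j w) w) + expR (2^-1 * Sm Q (fun j w => -1 * trunc j w) w)))).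
  have J1 := I 1 2^-1 (normr1 R) h2; have J2 := I (-1) 2^-1 n1 h2.
  rewrite ExZl; last exact: IntD.
  rewrite ExD//.
  have := expR_ge0 (- (z / 4)); move: E1 E2; set x1 := Ex _; set x2 := Ex _.
  by move=> h3 h4 h5; have := ler_wpM2l h5 (lerD h3 h4); lra.
apply/funext => w; rewrite /stein_weight /Sm -!mulr_sumr mul1r mulN1r mulrN.
by rewrite [X in expR X + _]mulrC [X in _ + expR (- X)]mulrC.
Qed.

Let gam := lyapunov 1.
Hypothesis gam0 : 0 < gam.
Hypothesis gam1 : gam <= 1 / 10.
(** With this choice gam / dl = 1/4, and the sum of the means of [u] without one index is at least 1
    - gam - 1/4 - 4 gam >= 1/4 when gam <= 1/10. *)
Let dl := 4 * gam.
Let u j w := `|trunc j w| * Num.min dl `|trunc j w|.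

Let u_ge j w : xi j w ^+ 2 - capped_cube 1 j w - capped_cube 1 j w / dl <= u j w.
Proof.
have dl0 : 0 < dl by rewrite mulr_gt0.
rewrite /u; case: (tt_cases j w) => [[h [-> ->]]|[h [-> ->]]].
  have t0 := normr_ge0 (xi j w); rewrite xi_sq; move: `|xi j w| t0 h => t t0 t1.
  have h1 : 0 <= t * t ^+ 2 by rewrite mulr_ge0// sqr_ge0.
  apply: (@le_trans _ _ (t ^+ 2 - t * t ^+ 2 / dl)); first by lra.
  case: (leP dl t) => dt; last by rewrite -expr2 lerBlDr lerDl divr_ge0// ltW.
  apply: (@le_trans _ _ 0); last by rewrite mulr_ge0// ltW.
  by rewrite subr_le0 ler_pdivlMr// mulrC ler_wpM2r// sqr_ge0.
by rewrite normr0 mul0r subrr sub0r oppr_le0 divr_ge0 ?sqr_ge0// ltW.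
Qed.

Let u_bnd j w : 0 <= u j w <= dl * `|xi j w|.
Proof.
have dl0 : 0 <= dl by rewrite mulr_ge0// ltW.
rewrite /u mulr_ge0 ?le_min ?normr_ge0 ?dl0//= mulrC.
by apply: ler_pM; rewrite ?le_min ?normr_ge0 ?dl0// ?ge_min ?lexx//; exact: tt_le.
Qed.

Let ou j : on j (u j).
Proof. by apply: onM; [exact/on_norm/ott|apply: on_min; [exact: on_cst|exact/on_norm/ott]]. Qed.

Let u_le j w : `|u j w| <= dl.
Proof.
have dl0 : 0 <= dl by rewrite mulr_ge0// ltW.
rewrite /u normrM normr_id ger0_norm ?le_min ?normr_ge0 ?dl0// -[leRHS]mul1r.
by apply: ler_pM; rewrite ?le_min ?normr_ge0 ?dl0 ?ge_min ?lexx//; exact: tt_le1.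
Qed.

Let Iu j : Int (u j).
Proof. exact: Int_bnd (on_Mfun (ou j)) (u_le j). Qed.

Let sum_u i : 1 / 4 <= \sum_(j < n | j != i) Ex (u j).
Proof.
have dl0 : 0 < dl by rewrite mulr_gt0.
have Ik j : Int (capped_cube 1 j) by apply: Ik3.
have all : 1 - gam - gam / dl <= \sum_(j < n) Ex (u j).
  rewrite -[X in X - _ - _]sum_sig /gam /lyapunov mulr_suml -!sumrB; apply: ler_sum => j _.
  rewrite -ExB// -ExZr// -ExB//; [|exact: IntB|exact: IntZr].
  apply: Ex_le; [apply: IntB; [exact: IntB|exact: IntZr]|exact: Iu|exact: u_ge].
move: all; rewrite (bigD1 i)//=.
have : Ex (u i) <= dl.
  rewrite -[leRHS](Ex_cst P); apply: Ex_le => //; [exact: Int_cst|move=> w].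
  exact: le_trans (ler_norm _) (u_le i w).
have : gam / dl = 1 / 4 by rewrite /dl; field; rewrite gt_eqF.
have := gam1; rewrite {2}/dl; move: (\sum_(_ < n | _) _) (Ex (u i)) (gam / dl) => a b c; lra.
Qed.

(** The discontinuity is felt only when the other summands fall within |trunc i| of [z], a window
    depending on [X i] alone. The constants are 1 / theta = 4 and 3 dl = 12 gam. *)
Lemma window_tt i (Y : Omega -> R) (z : R) : on i Y -> (forall w, 0 <= Y w <= 1) ->
  Ex (fun w => Y w * (`|V (predC1 i) w - z| <= `|trunc i w|)%R%:R * expR (V (predC1 i) w / 2)) <=
  4 * expR 1 * Ex (fun w => Y w * (2 * `|trunc i w| + 12 * gam)).
Proof.
move=> oY Y1; have dl0 : 0 <= dl by rewrite mulr_ge0// ltW.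
have h := @independent_concentration _ _ _ _ _ X D indep xi trunc oxi ott Ixi xi0 sum_sig tt_or dl u dl0 ou u_bnd
  i Y (fun w => z - `|trunc i w|) (fun w => z + `|trunc i w|) (fun w => `|V (predC1 i) w - z| <= `|trunc i w|)%R
  2^-1 1 2 (expR (2^-1 * n%:R)) (1 / 4) (expR 1).
have {h}h : 1 / 4 * Ex (fun w => Y w * (`|V (predC1 i) w - z| <= `|trunc i w|)%R%:R * expR (2^-1 * V (predC1 i) w)) <=
    Ex (fun w => Y w * (z + `|trunc i w| - (z - `|trunc i w|) + 3 * dl)) * expR 1.
  apply: h.
  - by [].
  - by move=> Q w; rewrite ler_expR ler_wpM2l//; exact: le_trans (ler_norm _) (V_le Q w).
  - exact: oY.
  - exact: Y1.
  - by apply: onB; [exact: on_cst|exact/on_norm/ott].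
  - by apply: onD; [exact: on_cst|exact/on_norm/ott].
  - by move=> w; have := normr_ge0 (trunc i w); lra.
  - by move=> w; have := tt_le1 i w; lra.
  - by apply: measurable_fun_ler; [apply/Mfun_norm/MfunB; [exact: mV|exact: Mfun_cst]|exact/Mfun_norm/mtt].
  - by move=> w; rewrite ler_norml => /andP[h1 h2]; apply/andP; split; lra.
  - move=> j w _ _; rewrite /u ler_wpM2r//; last exact: tt_le.
    by rewrite le_min dl0 normr_ge0.
  - exact: sum_u.
  - exact: expR_ge0.
  rewrite -expRM_natl mulr1.
  rewrite (_ : (fun w => _) = (fun w => expR (1 * Sm (predC1 i) (fun j w => 1 * trunc j w) w))); last first.
    apply/funext => w; rewrite -expRM_natl; congr expR; rewrite mul1r /Sm -mulr_sumr mul1r; by field.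
  by apply: mgf_tt; rewrite ?normr1// ler01 lexx.
have e1 : (fun w => Y w * (`|V (predC1 i) w - z| <= `|trunc i w|)%R%:R * expR (2^-1 * V (predC1 i) w)) =
    (fun w => Y w * (`|V (predC1 i) w - z| <= `|trunc i w|)%R%:R * expR (V (predC1 i) w / 2)).
  by apply/funext => w; rewrite [2^-1 * _]mulrC.
have e2 : (fun w => Y w * (z + `|trunc i w| - (z - `|trunc i w|) + 3 * dl)) = (fun w => Y w * (2 * `|trunc i w| + 12 * gam)).
  by apply/funext => w; rewrite /dl; congr (_ * _); ring.
rewrite e1 e2 in h; move: h; set x := Ex _; set y := Ex _; lra.
Qed.

End truncated_sum.

(** * Stein bound for the truncated sum *)

Section Berry_Esseen.
Context d (Omega : measurableType d) (R : realType) (P : probability Omega R).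
Context (n : nat) (X D : 'I_n -> {RV P >-> R}).
Hypothesis indep : forall i, independent2 P (X i) (fun w => (D i w, sample_but X i w)).
Local Notation off := (off X D).
Local Notation on := (on X).
Local Notation Ex := (Ex P).
Local Notation Int := (Int P).

Variables (xi : 'I_n -> Omega -> R).
Hypothesis oxi : forall j, on j (xi j).
Hypothesis Ixi : forall j, Int (fun w => xi j w ^+ 2).
Hypothesis xi0 : forall j, Ex (xi j) = 0.
Hypothesis sum_sig : \sum_(j < n) Ex (fun w => xi j w ^+ 2) = 1.
Local Notation tt := (trunc xi).
Local Notation V Q := (Sm Q tt).
Local Notation gam := (lyapunov P xi 1).
Hypothesis gam0 : 0 < gam.
Hypothesis gam1 : gam <= 1 / 10.

Let V_D1 i w : V predT w = V (predC1 i) w + tt i w.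
Proof. by rewrite /Sm (bigD1 i)//= addrC. Qed.

Section Stein_bounds.
Variables (K z : R) (b : R -> bool) (f : R -> R).
Hypothesis K0 : 0 <= K.
Hypothesis z0 : 0 <= z.
Hypothesis mb : measurable_fun setT b.
Hypothesis mf : measurable_fun setT f.
Let Df w := w * f w + (b w)%:R - gcdf z.
Hypothesis fK : forall w, `|f w| <= K * stein_weight z w.
Hypothesis DK : forall w, `|Df w| <= K * stein_weight z w.
Hypothesis DD : forall v h, `|h| <= 1 -> `|Df (v + h) - Df v| <=
  K * (stein_weight z v * `|h| + (`|v - z| <= `|h|)%R%:R * (expR (- (z / 4)) * expR (v / 2))).
Hypothesis ff : forall v h, `|h| <= 1 -> `|f (v + h) - f v - h * Df v| <=
  K * (stein_weight z v * h ^+ 2 + `|h| * (`|v - z| <= `|h|)%R%:R * (expR (- (z / 4)) * expR (v / 2))).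

Let mD : measurable_fun setT Df.
Proof.
apply: measurable_funB; last exact: measurable_cst.
apply: measurable_funD; last exact: (Mfun_bool mb).
by apply: measurable_funM => //; exact: measurable_id.
Qed.

Let B : R := K * (expR (- (z / 4)) * (expR (n%:R / 2) + expR (n%:R / 2))).

Let fB Q w : `|f (V Q w)| <= B.
Proof. by apply: (le_trans (fK _)); rewrite ler_wpM2l//; exact: om_bnd. Qed.
Let DB Q w : `|Df (V Q w)| <= B.
Proof. by apply: (le_trans (DK _)); rewrite ler_wpM2l//; exact: om_bnd. Qed.

Let mV Q : Mfun (V Q). Proof. exact: mV oxi Q. Qed.
Let mfV Q : Mfun (fun w => f (V Q w)). Proof. exact: Mfun_comp. Qed.
Let mDV Q : Mfun (fun w => Df (V Q w)). Proof. exact: Mfun_comp. Qed.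
Let IfV Q : Int (fun w => f (V Q w)). Proof. exact: Int_bnd (mfV Q) (fB Q). Qed.
Let IDV Q : Int (fun w => Df (V Q w)). Proof. exact: Int_bnd (mDV Q) (DB Q). Qed.
Let mtt j : Mfun (tt j). Proof. exact: mtt oxi j. Qed.
Let Itt j : Int (tt j). Proof. exact: Itt oxi j. Qed.
Let tt1 j w : `|tt j w| <= 1. Proof. exact: tt_le1. Qed.

Let e4 := expR (- (z / 4)).
Let wt i w := (`|V (predC1 i) w - z| <= `|tt i w|)%R%:R * expR (V (predC1 i) w / 2).

Let cross i : measurable_fun setT (fun w => `|V (predC1 i) w - z| <= `|tt i w|)%R.
Proof. by apply: measurable_fun_ler; [apply/Mfun_norm/MfunB; [exact: mV|exact: Mfun_cst]|exact: Mfun_norm]. Qed.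

Let mwt i : Mfun (wt i).
Proof.
apply: MfunM; first exact/Mfun_bool/cross.
by apply/Mfun_exp/MfunM; [exact: mV|exact: Mfun_cst].
Qed.

Let wt_bnd i w : `|wt i w| <= expR (n%:R / 2).
Proof.
rewrite /wt normrM normr_nat ger0_norm ?expR_ge0//.
apply: (@le_trans _ _ (1 * expR (V (predC1 i) w / 2))).
  by rewrite ler_wpM2r ?expR_ge0// lern1; case: (_ <= _).
rewrite mul1r ler_expR; have := V_le xi (predC1 i) w; rewrite ler_norml => /andP[]; lra.
Qed.

Let window i (Y : Omega -> R) : on i Y -> (forall w, 0 <= Y w <= 1) ->
  Int (fun w => Y w * wt i w) /\
  Ex (fun w => Y w * wt i w) <= 4 * expR 1 * Ex (fun w => Y w * (2 * `|tt i w| + 12 * gam)).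
Proof.
move=> oY Y1; split.
  apply: (@Int_bnd _ _ _ _ _ (1 * expR (n%:R / 2))); first by apply: MfunM; [exact: on_Mfun oY|exact: mwt].
  move=> w; rewrite normrM; apply: ler_pM => //; have /andP[y0 y1] := Y1 w; by rewrite ger0_norm.
have := window_tt indep oxi Ixi xi0 sum_sig gam0 gam1 z oY Y1.
by congr (Ex _ <= _); apply/funext => w; rewrite /wt mulrA.
Qed.

Let s i := Ex (fun w => tt i w ^+ 2).
Let k i := Ex (capped_cube xi 1 i).

Let s_ge0 i : 0 <= s i. Proof. by apply: Ex_ge0 => w; exact: sqr_ge0. Qed.
Let s_tt i : s i * Ex (fun w => `|tt i w|) <= k i.
Proof. exact: le_trans (Ex_tt_cheb oxi i) (Ex_tt3_le oxi Ixi i). Qed.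

Let Int_norm_tt i : Int (fun w => `|tt i w|). Proof. exact: Int_norm. Qed.

Let off_f i (h : R -> R) : measurable_fun setT h -> off i (fun w => h (V (predC1 i) w)).
Proof. by move=> mh; apply: off_comp => //; apply: off_Sm; [rewrite /= eqxx|exact: ott]. Qed.

Let mom : measurable_fun setT (stein_weight z).
Proof.
apply: measurable_funM; first exact: measurable_cst.
by apply: measurable_funD; apply: measurableT_comp; [exact: measurable_expR|apply: measurable_funM|
  exact: measurable_expR|apply: measurableT_comp => //; apply: measurable_funM].
Qed.

Let Iom Q : Int (fun w => stein_weight z (V Q w)). Proof. exact: Iom oxi z Q. Qed.
Let Eom Q : Ex (fun w => stein_weight z (V Q w)) <= 2 * expR 2 * e4. Proof. exact: (Ex_om_le indep oxi Ixi xi0 sum_sig). Qed.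

Let on_om i (Y : Omega -> R) : on i Y -> (forall w, 0 <= Y w <= 1) ->
  Int (fun w => Y w * stein_weight z (V (predC1 i) w)) /\
  Ex (fun w => Y w * stein_weight z (V (predC1 i) w)) <= Ex Y * (2 * expR 2 * e4).
Proof.
move=> oY Y1; have IY : Int Y.
  by apply: (@Int_bnd _ _ _ _ _ 1); [exact: on_Mfun oY|move=> w; have /andP[y0 y1] := Y1 w; rewrite ger0_norm].
have [I1 ->] := on_indep indep oY (off_f i mom) IY (Iom (predC1 i)); split=> //.
by apply: ler_wpM2l; [apply: Ex_ge0 => w; have /andP[] := Y1 w|exact: Eom].
Qed.

Let tt_sq1 i w : 0 <= tt i w ^+ 2 <= 1.
Proof. by apply/andP; split; [exact: sqr_ge0|rewrite -[tt i w ^+ 2]real_normK ?num_real// expr_le1]. Qed.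

(** The increment of [D] is only of first order in |trunc i|; the prefactor [s i] restores third
    order through [s_tt], the association inequality. *)
Let D_diff i : s i * `|Ex (fun w => Df (V predT w)) - Ex (fun w => Df (V (predC1 i) w))| <=
  K * e4 * ((2 * expR 2 + 8 * expR 1) * k i + 48 * expR 1 * gam * s i).
Proof.
rewrite -ExB//.
have o1 : on i (fun=> 1) by exact: on_cst.
have on1 : on i (fun w => `|tt i w|) by apply: on_norm; exact: ott.
have n01 w : 0 <= `|tt i w| <= 1 by rewrite normr_ge0 tt1.
have [I1 E1] := on_om on1 n01.
have [I2 E2] := window o1 (fun w => ltac:(by rewrite ler01 lexx)).
have Is : Int (fun w => Df (V predT w) - Df (V (predC1 i) w)) by exact: IntB.
apply: (@le_trans _ _ (s i * Ex (fun w => K * (`|tt i w| * stein_weight z (V (predC1 i) w) + e4 * (1 * wt i w))))).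
  rewrite ler_wpM2l//; apply: (le_trans (Ex_norm Is)); apply: Ex_le.
  - exact: Int_norm.
  - by apply: IntZl; apply: IntD => //; exact: IntZl.
  move=> w; rewrite (V_D1 i); apply: (le_trans (DD _ (tt1 i w))).
  by rewrite /wt le_eqVlt; apply/orP; left; apply/eqP; rewrite -/e4; ring.
rewrite ExZl; last by apply: IntD => //; exact: IntZl.
rewrite ExD//; last exact: IntZl.
rewrite (ExZl e4 I2).
have E3 : Ex (fun w => 1 * (2 * `|tt i w| + 12 * gam)) = 2 * Ex (fun w => `|tt i w|) + 12 * gam.
  rewrite (_ : (fun w => _) = (fun w => 2 * `|tt i w| + 12 * gam)); last by apply/funext => w; rewrite mul1r.
  by rewrite ExD; [rewrite (ExZl 2 (Int_norm_tt i)) Ex_cst|exact: IntZl|exact: Int_cst].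
rewrite E3 in E2.
rewrite mulrCA -mulrA ler_wpM2l//.
have e40 : 0 <= e4 by exact: expR_ge0.
have st := s_tt i; have s0 := s_ge0 i; have e10 := expR_ge0 (1 : R); have e20 := expR_ge0 (2 : R).
have h1 := ler_wpM2l s0 E1; have h2 := ler_wpM2l (mulr_ge0 s0 e40) E2.
have h3 := ler_wpM2l (mulr_ge0 e20 e40) st; have h4 := ler_wpM2l (mulr_ge0 e10 e40) st.
move: h1 h2 h3 h4; set x1 := Ex _; set x2 := Ex _; set x3 := Ex _; lra.
Qed.

(** The first-order Taylor remainder in the leave-one-out expansion of trunc i times f at the full
    sum. *)
Let rem i w := tt i w * (f (V predT w) - f (V (predC1 i) w) - tt i w * Df (V (predC1 i) w)).

Let Irem i : Int (rem i).
Proof.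
apply: (@Int_bnd _ _ _ _ _ (1 * (B + B + 1 * B))).
  apply: MfunM => //; apply: MfunB; first exact: MfunB.
  exact: MfunM.
move=> w; rewrite normrM; apply: ler_pM => //.
apply: (le_trans (ler_normB _ _)); apply: lerD.
  by apply: (le_trans (ler_normB _ _)); apply: lerD.
by rewrite normrM; apply: ler_pM.
Qed.

Let rem_le i : `|Ex (rem i)| <= K * e4 * ((2 * expR 2 + 8 * expR 1) * k i + 48 * expR 1 * gam * s i).
Proof.
have on2 : on i (fun w => tt i w ^+ 2) by apply: onX; exact: ott.
have on3 : on i (fun w => `|tt i w| * tt i w ^+ 2) by apply: onM => //; apply: on_norm; exact: ott.
have n3 w : 0 <= `|tt i w| * tt i w ^+ 2 <= 1.
  by have /andP[h1 h2] := tt_sq1 i w; rewrite mulr_ge0//= mulr_ile1.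
have [I1 E1] := on_om on3 n3.
have [I2 E2] := window on2 (tt_sq1 i).
apply: (@le_trans _ _ (Ex (fun w => K * (`|tt i w| * tt i w ^+ 2 * stein_weight z (V (predC1 i) w) + e4 * (tt i w ^+ 2 * wt i w))))).
  apply: (le_trans (Ex_norm (Irem i))); apply: Ex_le.
  - exact: Int_norm.
  - by apply: IntZl; apply: IntD => //; exact: IntZl.
  move=> w; rewrite /rem normrM (V_D1 i); apply: (le_trans (ler_wpM2l (normr_ge0 _) (ff _ (tt1 i w)))).
  rewrite -/e4 /wt -[tt i w ^+ 2]real_normK ?num_real// le_eqVlt; apply/orP; left; apply/eqP; ring.
rewrite ExZl; last by apply: IntD => //; exact: IntZl.
rewrite ExD//; last exact: IntZl.
rewrite (ExZl e4 I2) -mulrA ler_wpM2l//.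
have E3 : Ex (fun w => tt i w ^+ 2 * (2 * `|tt i w| + 12 * gam)) = 2 * Ex (fun w => `|tt i w| * tt i w ^+ 2) + 12 * gam * s i.
  rewrite (_ : (fun w => _) = (fun w => 2 * (`|tt i w| * tt i w ^+ 2) + 12 * gam * tt i w ^+ 2)); last by apply/funext => w; ring.
  rewrite ExD; [rewrite ExZl ?ExZl//|apply: IntZl|apply: IntZl]; first [exact: Itt2|exact: Itt3].
rewrite E3 in E2.
have e40 : 0 <= e4 by exact: expR_ge0.
have st := Ex_tt3_le oxi Ixi i; have s0 := s_ge0 i; have e10 := expR_ge0 (1 : R); have e20 := expR_ge0 (2 : R).
have h2 := ler_wpM2l e40 E2.
have h3 := ler_wpM2l (mulr_ge0 e20 e40) st; have h4 := ler_wpM2l (mulr_ge0 e10 e40) st.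
rewrite -/(k i) in st h3 h4.
move: E1 h2 h3 h4; set x1 := Ex _; set x2 := Ex _; set x3 := Ex _; lra.
Qed.

Lemma Stein_bound : `|Ex (fun w => (b (V predT w))%:R) - gcdf z| <=
  K * e4 * ((8 * expR 2 + 112 * expR 1) * gam).
Proof.
have e40 : 0 <= e4 by exact: expR_ge0.
have IbV : Int (fun w => (b (V predT w))%:R).
  by apply: Int_bool; exact: (measurableT_comp mb (mV predT)).
have Itf i : Int (fun w => tt i w * f (V predT w)).
  by apply: (IntbM (IfV predT) (mtt i) (tt1 i)).
have It2D i : Int (fun w => tt i w ^+ 2 * Df (V (predC1 i) w)) /\
    Ex (fun w => tt i w ^+ 2 * Df (V (predC1 i) w)) = s i * Ex (fun w => Df (V (predC1 i) w)).
  by apply: (on_indep indep); [apply: onX; exact: ott|exact: off_f mD|exact: Itt2|exact: IDV].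
have Itf' i : Int (fun w => tt i w * f (V (predC1 i) w)) /\
    Ex (fun w => tt i w * f (V (predC1 i) w)) = Ex (tt i) * Ex (fun w => f (V (predC1 i) w)).
  by apply: (on_indep indep); [exact: ott|exact: off_f mf|exact: Itt|exact: IfV].
have Etf i : Ex (fun w => tt i w * f (V predT w)) =
    Ex (rem i) + s i * Ex (fun w => Df (V (predC1 i) w)) + Ex (tt i) * Ex (fun w => f (V (predC1 i) w)).
  have [I1 <-] := It2D i; have [I2 <-] := Itf' i.
  have I3 := IntD (Irem i) I1; rewrite -(ExD (Irem i) I1) -(ExD I3 I2).
  by congr Ex; apply/funext => w; rewrite /rem; ring.
have EVf : Ex (fun w => V predT w * f (V predT w)) = \sum_(i < n) Ex (fun w => tt i w * f (V predT w)).
  rewrite -Ex_sum//; congr Ex; apply/funext => w.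
  by rewrite /Sm mulr_suml.
have IVf : Int (fun w => V predT w * f (V predT w)).
  rewrite (_ : (fun w => _) = (fun w => \sum_(i < n) tt i w * f (V predT w))); first exact: Int_sum.
  by apply/funext => w; rewrite /Sm mulr_suml.
have -> : Ex (fun w => (b (V predT w))%:R) - gcdf z =
    Ex (fun w => Df (V predT w)) - \sum_(i < n) Ex (fun w => tt i w * f (V predT w)).
  rewrite -EVf -ExB// -[X in _ - X](Ex_cst P) -ExB//; last exact: Int_cst.
  by congr Ex; apply/funext => w; rewrite /Df; ring.
set DV := Ex (fun w => Df (V predT w)).
(* Four errors, each proportional to [gam]: the missing variance, the change of [D] when one summand
   is removed, the Taylor remainder, and the nonzero mean of the truncated summand. *)
have -> : DV - \sum_(i < n) Ex (fun w => tt i w * f (V predT w)) =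
    (1 - \sum_(i < n) s i) * DV + \sum_(i < n) (s i * (DV - Ex (fun w => Df (V (predC1 i) w)))
      - Ex (rem i) - Ex (tt i) * Ex (fun w => f (V (predC1 i) w))).
  rewrite mulrBl mul1r -addrA mulr_suml -sumrN; congr (_ + _).
  rewrite -[X in _ = X + _]sumrN -big_split/=; apply: eq_bigr => i _; rewrite Etf; ring.
have fle Q : `|Ex (fun w => f (V Q w))| <= K * (2 * expR 2 * e4).
  apply: (le_trans (Ex_norm (IfV Q))); apply: (@le_trans _ _ (Ex (fun w => K * stein_weight z (V Q w)))).
    by apply: Ex_le; [exact: Int_norm|exact: IntZl|move=> w; exact: fK].
  by rewrite ExZl// ler_wpM2l.
have Dle : `|DV| <= K * (2 * expR 2 * e4).
  apply: (le_trans (Ex_norm (IDV _))); apply: (@le_trans _ _ (Ex (fun w => K * stein_weight z (V predT w)))).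
    by apply: Ex_le; [exact: Int_norm|exact: IntZl|move=> w; exact: DK].
  by rewrite ExZl// ler_wpM2l.
have ss1 : \sum_(i < n) s i <= 1.
  by rewrite -[leRHS]sum_sig; apply: ler_sum => i _; exact: Ex_tt2_le.
have ss2 : 1 - \sum_(i < n) s i <= gam.
  rewrite -[X in X - _]sum_sig -sumrB; apply: ler_sum => i _.
  by rewrite lerBlDr -lerBlDl; exact: Ex_tt2_ge oxi Ixi i.
have E20 : 0 <= K * (2 * expR 2 * e4) by rewrite !mulr_ge0// expR_ge0.
have t1 : `|(1 - \sum_(i < n) s i) * DV| <= gam * (K * (2 * expR 2 * e4)).
  by rewrite normrM; apply: ler_pM => //; rewrite ger0_norm// subr_ge0.
have t2 i : `|s i * (DV - Ex (fun w => Df (V (predC1 i) w))) - Ex (rem i) - Ex (tt i) * Ex (fun w => f (V (predC1 i) w))| <=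
    K * e4 * ((6 * expR 2 + 16 * expR 1) * k i + 96 * expR 1 * gam * s i).
  have a1 : `|s i * (DV - Ex (fun w => Df (V (predC1 i) w)))| <=
      K * e4 * ((2 * expR 2 + 8 * expR 1) * k i + 48 * expR 1 * gam * s i).
    by rewrite normrM [`|s i|]ger0_norm//; exact: D_diff.
  have a2 := rem_le i.
  have a3 : `|Ex (tt i) * Ex (fun w => f (V (predC1 i) w))| <= k i * (K * (2 * expR 2 * e4)).
    by rewrite normrM; apply: ler_pM => //; exact: (Ex_tt_le oxi Ixi xi0).
  apply: (le_trans (ler_normB _ _)); apply: (le_trans (lerD (ler_normB _ _) (lexx _))).
  move: a1 a2 a3; set x1 := `|_|; set x2 := `|_|; set x3 := `|_|; lra.
apply: (le_trans (ler_normD _ _)); apply: (le_trans (lerD t1 (ler_norm_sum _ _ _))).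
have t3 := ler_sum (index_enum _) (P := predT) (fun i _ => t2 i).
apply: (le_trans (lerD (lexx _) t3)).
rewrite -mulr_sumr big_split/= -!mulr_sumr -/gam.
have h := ler_wpM2l (mulr_ge0 (mulr_ge0 K0 e40) (mulr_ge0 (expR_ge0 1) (ltW gam0))) ss1.
move: h; rewrite /lyapunov; set x1 := \sum_(_ < n) s _; set x2 := \sum_(_ < n) _; lra.
Qed.

End Stein_bounds.

(** The constant of the Stein solution is chosen once and depends only on [R], which makes the final
    constant absolute. *)
Definition BE_const : R := s2val (cid2 (Stein_solution R)) * (8 * expR 2 + 112 * expR 1).

Lemma BE_const_ge0 : 0 <= BE_const.
Proof.
have K0 := s2valP (cid2 (Stein_solution R)).
by rewrite /BE_const; apply: mulr_ge0 => //; apply: addr_ge0; apply: mulr_ge0; rewrite ?expR_ge0.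
Qed.

Lemma truncated_Berry_Esseen z (b : R -> bool) : 0 <= z -> measurable_fun setT b ->
  (forall w, w < z -> b w) -> (forall w, z < w -> ~~ b w) ->
  `|Ex (fun w => (b (V predT w))%:R) - gcdf z| <= BE_const * expR (- (z / 4)) * gam.
Proof.
move=> z0 mb bl br; rewrite /BE_const.
case: (cid2 (Stein_solution R)) => K K0 h /=.
have [f [mf h1 h2 h3 h4]] := h z b z0 mb bl br.
apply: (le_trans (Stein_bound K0 mb mf h1 h2 h3 h4)).
by rewrite le_eqVlt; apply/orP; left; apply/eqP; ring.
Qed.

End Berry_Esseen.

(** * Nonuniform Berry-Esseen bound *)

Section tails.
Context d (Omega : measurableType d) (R : realType) (P : probability Omega R).
Context (n : nat) (X D : 'I_n -> {RV P >-> R}).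
Hypothesis indep : forall i, independent2 P (X i) (fun w => (D i w, sample_but X i w)).
Local Notation off := (off X D).
Local Notation on := (on X).
Local Notation Ex := (Ex P).
Local Notation Int := (Int P).

Variables (xi : 'I_n -> Omega -> R).
Hypothesis oxi : forall j, on j (xi j).
Hypothesis Ixi : forall j, Int (fun w => xi j w ^+ 2).
Hypothesis xi0 : forall j, Ex (xi j) = 0.
Hypothesis sum_sig : \sum_(j < n) Ex (fun w => xi j w ^+ 2) = 1.
Local Notation sig := (second_moment P xi).
Local Notation tt := (trunc xi).
Local Notation k3 := (capped_cube xi).
Local Notation lya := (lyapunov P xi).
Local Notation W Q := (Sm Q xi).

Let mxi j : Mfun (xi j). Proof. exact: on_Mfun (oxi j). Qed.
Let Ixi1 j : Int (xi j). Proof. exact: Int_of_sq. Qed.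
Let mW Q : Mfun (W Q). Proof. exact: Mfun_Sm oxi. Qed.
Let IW2 Q : Int (fun w => W Q w ^+ 2). Proof. exact: Int_Sm_sq oxi Ixi. Qed.

Lemma lya_mono m : 1 <= m -> lya 1 <= lya m.
Proof.
move=> m1; apply: ler_sum => j _; apply: Ex_le; [by apply: Ik3|apply: Ik3 => //; exact: le_trans m1|move=> w].
by rewrite ler_wpM2l ?sqr_ge0// le_min ge_min m1/= ge_min lexx orbT.
Qed.

(** If it vanished, xi^2 <= e^2 + capped_cube / e would bound the total variance by n e^2; at e = 1
    / (n + 1) this is below 1. *)
Lemma lya1_gt0 : 0 < lya 1.
Proof.
rewrite lt_neqAle lya_ge0// andbT eq_sym; apply/negP => /eqP l0.
pose e : R := (n.+1%:R)^-1.
have e0 : 0 < e by rewrite invr_gt0 ltr0n.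
have e1 : e <= 1 by rewrite invf_le1 ?ltr0n// ler1n.
have : 1 <= \sum_(j < n) (e ^+ 2 + Ex (k3 1 j) / e).
  rewrite -[leLHS]sum_sig; apply: ler_sum => j _.
  have Ik : Int (k3 1 j) by apply: Ik3.
  rewrite -ExZr// -[X in X + _](Ex_cst P) -ExD; [|exact: Int_cst|exact: IntZr].
  apply: Ex_le => //; first by apply: IntD; [exact: Int_cst|exact: IntZr].
  move=> w; rewrite /capped_cube -[xi j w ^+ 2]real_normK ?num_real//.
  have := normr_ge0 (xi j w); move: `|xi j w| => t t0.
  have s0 := sqr_ge0 t.
  have [te|et] := leP t e.
    apply: (@le_trans _ _ (e ^+ 2)); first by rewrite lerXn2r ?nnegrE// ltW.
    by rewrite lerDl divr_ge0//; [rewrite mulr_ge0// le_min t0 ler01|exact: ltW].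
  apply: (@le_trans _ _ (t ^+ 2 * Num.min 1 t / e)); last by rewrite lerDr sqr_ge0.
  by rewrite -mulrA ler_peMr// ler_pdivlMr// mul1r le_min e1 ltW.
have l0' : \sum_(j < n) Ex (k3 1 j) = 0 by exact: l0.
rewrite big_split/= [X in _ + X](_ : _ = 0); last by rewrite -mulr_suml l0' mul0r.
rewrite addr0 sumr_const card_ord /e => h.
have n0 : 0 < (n.+1%:R : R) by rewrite ltr0n.
have : n.+1%:R ^+ 2 <= (n%:R : R).
  have e2 : n.+1%:R^-1 ^+ 2 *+ n = n%:R / n.+1%:R ^+ 2 :> R by rewrite exprVn mulr_natl.
  by move: h; rewrite e2 ler_pdivlMr ?exprn_gt0// mul1r.
by rewrite -natrX ler_nat leqNgt expnS expn1 mulSn addSn ltnS leq_addr.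
Qed.

(** Write the capped cube as W h(W) with h(x) = x min(m, |x|) and remove one summand at a time. The
    increments of h are controlled by [hlip], and E|W| <= 1 for the remaining sum gives the additive
    constant 2. *)
Lemma cubic_tail m (Q : pred 'I_n) : 0 <= m ->
  Int (fun w => W Q w ^+ 2 * Num.min m `|W Q w|) /\
  Ex (fun w => W Q w ^+ 2 * Num.min m `|W Q w|) <= 2 * lya m + 2.
Proof.
move=> m0; pose h (x : R) := x * Num.min m `|x|.
have mh : measurable_fun setT h.
  apply: measurable_funM; first exact: measurable_id.
  by apply: measurable_minr; [exact: measurable_cst|exact: normr_measurable].
have hb x : `|h x| <= m * `|x|.
  by rewrite /h normrM mulrC ler_wpM2r// ger0_norm ?le_min ?m0 ?normr_ge0// ge_min lexx.
have hlip v t : `|h (v + t) - h v| <= 2 * `|t| * (`|v| + Num.min m `|t|).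
  rewrite /h; set p1 := Num.min m `|v + t|; set p := Num.min m `|v|; set q := Num.min m `|t|.
  have n1 : `|v + t| <= `|v| + `|t| by exact: ler_normD.
  have n2 : `|v| <= `|v + t| + `|t| by rewrite -{1}(addrK t v) ler_normB.
  have v0 := normr_ge0 v; have t0 := normr_ge0 t; have vt0 := normr_ge0 (v + t).
  have p10 : 0 <= p1 by rewrite le_min m0 vt0.
  have p1le : p1 <= `|v| + q.
    by rewrite /p1 /q /Num.min; case: ltP => a; case: ltP => b; lra.
  have p1p : `|p1 - p| <= `|t|.
    by rewrite ler_norml /p1 /p /Num.min; case: ltP => a; case: ltP => b; apply/andP; split; lra.
  have q0 : 0 <= q by rewrite le_min m0 t0.
  rewrite (_ : _ - _ = t * p1 + v * (p1 - p)); last ring.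
  apply: (le_trans (ler_normD _ _)); rewrite !normrM (ger0_norm p10).
  have := ler_wpM2l t0 p1le; have := ler_wpM2l v0 p1p; have := mulr_ge0 t0 q0; lra.
have IW : forall Q, Int (W Q) by move=> Q'; apply: Int_of_sq.
have mhW Q' : Mfun (fun w => h (W Q' w)) by exact: Mfun_comp.
have IhW2 Q' : Int (fun w => h (W Q' w) ^+ 2).
  apply: (@Int_le _ _ _ _ _ (fun w => m ^+ 2 * W Q' w ^+ 2)); first exact: MfunX.
    move=> w; rewrite -[W Q' w ^+ 2]real_normK ?num_real// -exprMn; apply: normX2_le.
    exact: hb.
  exact: IntZl.
have Ixh j Q' : Int (fun w => xi j w * h (W Q' w)) by exact: Int_mul2.
have e1 : (fun w => W Q w ^+ 2 * Num.min m `|W Q w|) = (fun w => \sum_(j < n | Q j) xi j w * h (W Q w)).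
  by apply/funext => w; rewrite -mulr_suml /h mulrA -expr2.
rewrite e1; split; first exact: Int_sum.
rewrite Ex_sum//; apply: (@le_trans _ _ (\sum_(j < n | Q j) (2 * Ex (k3 m j) + 2 * sig j))); last first.
  rewrite big_split/= -!mulr_sumr; apply: lerD.
    rewrite ler_wpM2l// /lyapunov [leRHS](bigID Q)/= lerDl; apply: sumr_ge0 => j _.
    by apply: Ex_ge0 => w; exact: k3_ge0.
  by have := sum_sig_le1 sum_sig Q; lra.
apply: ler_sum => j Qj.
have offh : off j (fun w => h (W (Qm Q j) w)) by apply: off_comp => //; exact: (off_Qm D Q j oxi).
have offn : off j (fun w => `|W (Qm Q j) w|) by apply: off_comp; [exact: normr_measurable|exact: (off_Qm D Q j oxi)].
have Ih : Int (fun w => h (W (Qm Q j) w)) by exact: Int_of_sq.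
have [I1 E1] := on_indep indep (oxi j) offh (Ixi1 j) Ih.
have on2 : on j (fun w => xi j w ^+ 2) by exact: onX.
have [I2 E2] := on_indep indep on2 offn (Ixi j) (Int_norm (IW (Qm Q j))).
have -> : Ex (fun w => xi j w * h (W Q w)) = Ex (fun w => xi j w * h (W Q w) - xi j w * h (W (Qm Q j) w)).
  by rewrite ExB// E1 xi0 mul0r subr0.
have Ik : Int (k3 m j) by exact: Ik3.
apply: (@le_trans _ _ (Ex (fun w => 2 * k3 m j w + 2 * (xi j w ^+ 2 * `|W (Qm Q j) w|)))).
  apply: Ex_le; [exact: IntB|by apply: IntD; exact: IntZl|move=> w].
  apply: (le_trans (ler_norm _)); rewrite -mulrBr normrM (Sm_D1 xi w Qj) [xi j w + _]addrC.
  apply: (le_trans (ler_wpM2l (normr_ge0 _) (hlip _ _))).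
  by rewrite /capped_cube -[xi j w ^+ 2]real_normK ?num_real// le_eqVlt; apply/orP; left; apply/eqP; ring.
rewrite ExD; [|exact: IntZl|exact: IntZl].
rewrite (ExZl 2 Ik) (ExZl 2 I2) E2 lerD2l ler_wpM2l// -[leRHS]mulr1 ler_wpM2l//.
  by apply: Ex_ge0 => w; exact: sqr_ge0.
apply: Ex_abs_le => //; rewrite expr1n; exact: (Ex_sq_Sm_le indep).
Qed.

Lemma tail_W m c (Q : pred 'I_n) : 0 < m -> 0 < c <= 1 ->
  Ex (fun w => (c * m <= `|W Q w|)%R%:R) <= (2 * lya m + 2) / (c ^+ 3 * m ^+ 3).
Proof.
move=> m0 /andP[c0 c1]; have [I1 E1] := cubic_tail Q (ltW m0).
have p0 : 0 < c ^+ 3 * m ^+ 3 by rewrite mulr_gt0 ?exprn_gt0.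
rewrite ler_pdivlMr//; apply: le_trans E1; rewrite -ExZr; last first.
  by apply: Int_bool; apply: measurable_fun_ler; [exact: measurable_cst|exact: Mfun_norm].
apply: Ex_le => //.
  by apply: IntZr; apply: Int_bool; apply: measurable_fun_ler; [exact: measurable_cst|exact: Mfun_norm].
move=> w; case: (leP (c * m) `|W Q w|) => h; last first.
  by rewrite mul0r mulr_ge0 ?sqr_ge0// le_min normr_ge0 ltW.
rewrite mul1r (_ : c ^+ 3 * m ^+ 3 = (c * m) ^+ 2 * (c * m)); last ring.
have cm0 : 0 <= c * m by rewrite mulr_ge0// ltW.
apply: ler_pM => //; first exact: sqr_ge0.
  by rewrite -[leRHS]real_normK ?num_real// lerXn2r ?nnegrE.
by rewrite le_min h andbT ler_piMl// ltW.
Qed.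

Lemma P_xi_gt1 j : Ex (fun w => (1 < `|xi j w|)%R%:R) <= Ex (k3 1 j).
Proof.
apply: Ex_le; [by apply: Int_bool; apply: measurable_fun_ltr; [exact: measurable_cst|exact: Mfun_norm]|by apply: Ik3|move=> w].
case: (ltP 1 `|xi j w|) => h; last by apply: k3_ge0.
rewrite /capped_cube (min_l (ltW h)) mulr1 -[xi j w ^+ 2]real_normK ?num_real//.
by apply: exprn_ege1; exact: ltW.
Qed.

Section at_z.
Variable z : R.
Let m := 1 + `|z|.
Let m1 : 1 <= m. Proof. by rewrite lerDl normr_ge0. Qed.
Let m0 : 0 < m. Proof. exact: lt_le_trans m1. Qed.
Let th := lya m / m ^+ 3.

(** The cube of e^{|z|/12} >= (1 + |z|) / 12; hence 1728 = 12^3. *)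
Lemma exp_le_cube : expR (- (`|z| / 4)) <= 1728 / m ^+ 3.
Proof.
rewrite ler_pdivlMr ?exprn_gt0// expRN mulrC ler_pdivrMr ?expR_gt0//.
have -> : expR (`|z| / 4) = expR (`|z| / 12) ^+ 3 by rewrite -expRM_natl; congr expR; field.
rewrite (_ : 1728 = 12 ^+ 3); last by rewrite -natrX.
have z0 := normr_ge0 z.
rewrite -exprMn lerXn2r ?nnegrE ?mulr_ge0 ?expR_ge0 ?ltW//.
by have := expR_ge1Dx (`|z| / 12); rewrite /m; lra.
Qed.

Lemma large_xi : \sum_(i < n) Ex (fun w => ((`|z| + 1) / 3 < `|xi i w|)%R%:R) <= 27 * th.
Proof.
rewrite /th /lyapunov mulrA ler_pdivlMr ?exprn_gt0// mulr_suml mulr_sumr; apply: ler_sum => i _.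
have mb : measurable_fun setT (fun w => (`|z| + 1) / 3 < `|xi i w|)%R.
  by apply: measurable_fun_ltr; [exact: measurable_cst|exact: Mfun_norm].
have Ik : Int (k3 m i) by exact: (Ik3 oxi Ixi i (ltW m0)).
rewrite -ExZr; last exact: Int_bool.
rewrite -ExZl//; apply: Ex_le; [by apply: IntZr; exact: Int_bool|exact: IntZl|move=> w].
case: ltP => h; last by rewrite mul0r mulr_ge0// k3_ge0// ltW.
rewrite mul1r /capped_cube -[xi i w ^+ 2]real_normK ?num_real//.
have h1 : m / 3 <= `|xi i w| by rewrite ltW// /m addrC.
have m30 : 0 <= m / 3 by rewrite divr_ge0// ltW.
rewrite (_ : m ^+ 3 = 27 * ((m / 3) ^+ 2 * (m / 3))); last by field.
rewrite ler_wpM2l//; apply: ler_pM => //; first exact: sqr_ge0.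
  by rewrite lerXn2r ?nnegrE.
by rewrite le_min h1 andbT; lra.
Qed.

(** For m <= 6 the bound on the second factors alone suffices. For m > 6 the threshold (m - 3) / 3
    is at least m / 6, and the cubic tail gives 216 (2 lya m + 2) lya 1 <= 864 lya m. *)
Lemma large_others : \sum_(i < n) Ex (fun w => ((`|z| - 2) / 3 < `|W predT w - xi i w|)%R%:R) * Ex (fun w => (1 < `|xi i w|)%R%:R)
  <= 864 * th.
Proof.
have z0 := normr_ge0 z.
have lm := lya_mono m1; have l1 := lya1_le1 oxi Ixi sum_sig; have lm0 := lya_ge0 P xi (ltW m0).
have l10 : 0 <= lya 1 by apply: lya_ge0.
have mb i : measurable_fun setT (fun w => (`|z| - 2) / 3 < `|W predT w - xi i w|)%R.
  by apply: measurable_fun_ltr; [exact: measurable_cst|apply: Mfun_norm; exact: MfunB].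
have [m6|m6] := leP m 6.
  apply: (@le_trans _ _ (lya 1)).
    apply: ler_sum => i _; rewrite -[leRHS]mul1r; apply: ler_pM; try (by apply: Ex_ge0 => w).
      rewrite -[leRHS](Ex_cst P); apply: Ex_le; [exact: Int_bool|exact: Int_cst|move=> w].
      by rewrite lern1; case: (_ < _).
    exact: P_xi_gt1.
  rewrite /th mulrA ler_pdivlMr ?exprn_gt0//.
  have : m ^+ 3 <= 6 ^+ 3 by rewrite lerXn2r ?nnegrE// ltW.
  by rewrite -natrX => h; have := ler_wpM2l l10 h; rewrite (_ : (6 ^ 3)%N = 216%N)//; lra.
have p0 : 0 < m ^+ 3 by rewrite exprn_gt0.
apply: (@le_trans _ _ (\sum_(i < n) (2 * lya m + 2) / ((6^-1) ^+ 3 * m ^+ 3) * Ex (k3 1 i))).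
  apply: ler_sum => i _; apply: ler_pM; try (by apply: Ex_ge0 => w); last exact: P_xi_gt1.
  have c6 : 0 < (6^-1 : R) <= 1 by apply/andP; split; lra.
  apply: le_trans (tail_W (predC1 i) m0 c6); apply: Ex_le.
  - exact: Int_bool.
  - by apply: Int_bool; apply: measurable_fun_ler; [exact: measurable_cst|exact: Mfun_norm].
  move=> w; rewrite ler_nat; case: ltP => //= h; rewrite lt0b.
  have eW : W predT w = xi i w + W (predC1 i) w by rewrite /Sm (bigD1 i).
  rewrite eW [xi i w + _]addrC addrK in h.
  by apply: ltW; apply: le_lt_trans h; rewrite /m in m6 *; lra.
rewrite -mulr_sumr -/(lya 1) exprVn invfM invrK /th.
rewrite (_ : 864 * (lya m / m ^+ 3) = 864 * lya m * (m ^+ 3)^-1); last ring.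
rewrite (_ : _ * _ * lya 1 = 6 ^+ 3 * ((2 * lya m + 2) * lya 1) * (m ^+ 3)^-1); last ring.
rewrite ler_wpM2r//; first by rewrite invr_ge0 ltW.
rewrite -natrX (_ : (6 ^ 3)%N = 216%N)//.
have := ler_wpM2l lm0 l1; lra.
Qed.

Lemma mgf_tt_shift i (b : R -> bool) : (forall w, b w -> `|z| <= w) -> measurable_fun setT b ->
  Ex (fun w => (b (Sm (predC1 i) tt w))%:R) <= expR 2 * expR (- (`|z| / 2)).
Proof.
move=> bz mb; set S := Sm (predC1 i) tt.
have mS : Mfun S by exact: (mV oxi).
apply: (@le_trans _ _ (Ex (fun w => expR (2^-1 * Sm (predC1 i) (fun j w => 1 * tt j w) w) * expR (- (`|z| / 2))))).
  have I1 : Int (fun w => expR (2^-1 * Sm (predC1 i) (fun j w => 1 * tt j w) w)).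
    apply: (@Int_expR_Sm _ _ _ _ _ X); first by lra.
      by move=> j; apply: onM; [exact: on_cst|exact: ott].
    by move=> j w; rewrite mul1r; exact: le_trans (ler_norm _) (tt_le1 xi j w).
  apply: Ex_le; [by apply: Int_bool; exact: (measurableT_comp mb mS)|exact: IntZr|move=> w].
  case: (boolP (b (S w))) => [/bz h|_]; last by rewrite mulr_ge0 ?expR_ge0.
  rewrite -expRD -[leLHS]expR0 ler_expR /Sm -mulr_sumr -/(S w) mul1r.
  by rewrite -/(Sm (predC1 i) tt w) -/(S w); lra.
rewrite ExZr; last first.
  apply: (@Int_expR_Sm _ _ _ _ _ X); first by lra.
    by move=> j; apply: onM; [exact: on_cst|exact: ott].
  by move=> j w; rewrite mul1r; exact: le_trans (ler_norm _) (tt_le1 xi j w).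
rewrite ler_wpM2r ?expR_ge0//; apply: (mgf_tt indep oxi Ixi xi0 sum_sig); first exact: normr1.
by apply/andP; split; lra.
Qed.

(** Truncation matters only if some |xi i| > 1. Then xi i is very large, or the remaining sum is
    large, or the remaining truncated sum reaches [z]; in the last two cases independence yields a
    product. *)
Lemma truncation_error (b : R -> bool) : 0 <= z -> measurable_fun setT b ->
  (forall w, w < z -> b w) -> (forall w, z < w -> ~~ b w) ->
  `|Ex (fun w => (b (W predT w))%:R) - Ex (fun w => (b (Sm predT tt w))%:R)| <= (891 + 1728 * expR 2) * th.
Proof.
move=> z0 mb bl br; have zn : `|z| = z by exact: ger0_norm.
have mV := mV oxi.
pose B0 w := (z <= w)%R.
have mB0 : measurable_fun setT B0 by apply: measurable_fun_ler; [exact: measurable_cst|exact: measurable_id].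
pose a1 i w := ((`|z| + 1) / 3 < `|xi i w|)%R.
pose a2 i w := (((`|z| - 2) / 3 < `|W predT w - xi i w|) && (1 < `|xi i w|))%R.
pose a3 i w := ((1 < `|xi i w|)%R && B0 (Sm (predC1 i) tt w)).
have mg1 i : measurable_fun setT (fun w => 1 < `|xi i w|)%R.
  by apply: measurable_fun_ltr; [exact: measurable_cst|exact: Mfun_norm].
have ma1 i : measurable_fun setT (a1 i).
  by apply: measurable_fun_ltr; [exact: measurable_cst|exact: Mfun_norm].
have mo i : measurable_fun setT (fun w => (`|z| - 2) / 3 < `|W predT w - xi i w|)%R.
  by apply: measurable_fun_ltr; [exact: measurable_cst|apply: Mfun_norm; exact: MfunB].
have ma2 i : measurable_fun setT (a2 i) by exact: measurable_and.
have mB i : measurable_fun setT (fun w => B0 (Sm (predC1 i) tt w)) by exact: (measurableT_comp mB0 (mV _)).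
have ma3 i : measurable_fun setT (a3 i) by exact: measurable_and.
have ib (c : Omega -> bool) : measurable_fun setT c -> Int (fun w => (c w)%:R) by exact: Int_bool.
have Ib1 : Int (fun w => (b (W predT w))%:R) by apply: ib; exact: (measurableT_comp mb (mW predT)).
have Ib2 : Int (fun w => (b (Sm predT tt w))%:R) by apply: ib; exact: (measurableT_comp mb (mV predT)).
rewrite -ExB//; apply: (le_trans (Ex_norm (IntB Ib1 Ib2))).
apply: (@le_trans _ _ (Ex (fun w => \sum_(i < n) ((a1 i w)%:R + (a2 i w)%:R + (a3 i w)%:R)))).
  have Is : Int (fun w => \sum_(i < n) ((a1 i w)%:R + (a2 i w)%:R + (a3 i w)%:R) : R).
    by apply: Int_sum => i _; apply: IntD; [apply: IntD|]; exact: ib.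
  apply: Ex_le => //; first exact/Int_norm/IntB.
  move=> w; have s0 : 0 <= \sum_(i < n) ((a1 i w)%:R + (a2 i w)%:R + (a3 i w)%:R) :> R.
    by apply: sumr_ge0 => i _; rewrite -!natrD ler0n.
  have [->|bne] := eqVneq (b (W predT w)) (b (Sm predT tt w)); first by rewrite subrr normr0.
  apply: (@le_trans _ _ 1); first by case: (b (W predT w)) bne; case: (b (Sm predT tt w)) => //=; rewrite ?subr0 ?sub0r ?normrN normr1.
  have [i hi] : exists i, 1 < `|xi i w|.
    apply: contrapT => /forallNP hn; move/eqP: bne; apply; congr b.
    rewrite /Sm; apply: eq_bigr => i _; rewrite /trunc.
    by have /negP := hn i; rewrite -leNgt => ->; rewrite mulr1.
  rewrite (bigD1 i)//=; apply: (@le_trans _ _ ((a1 i w)%:R + (a2 i w)%:R + (a3 i w)%:R)); last first.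
    by rewrite lerDl; apply: sumr_ge0 => j _; rewrite -!natrD ler0n.
  rewrite -!natrD ler1n /a1 /a2 /a3 hi andbT /= !addn_gt0 !lt0b.
  have [//|h1] := ltP ((`|z| + 1) / 3) `|xi i w|.
  have [//|h2] := ltP ((`|z| - 2) / 3) `|W predT w - xi i w|.
  rewrite /=; have eV : Sm predT tt w = Sm (predC1 i) tt w.
    by rewrite /Sm (bigD1 i)//= /trunc leNgt hi mulr0 add0r.
  rewrite /B0 -eV; have [//|h3] := leP z (Sm predT tt w).
  (* Outside the first two events W <= (2 z - 1) / 3 < z, so both half-line indicators are 1. *)
  have Wz : W predT w < z.
    have := ler_norm (W predT w - xi i w); have := ler_norm (xi i w); rewrite zn in h1 h2; lra.
  by move/eqP: bne; rewrite (bl _ h3) (bl _ Wz).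
rewrite Ex_sum; last by move=> i _; apply: IntD; [apply: IntD|]; exact: ib.
have split3 i : Ex (fun w => (a1 i w)%:R + (a2 i w)%:R + (a3 i w)%:R) =
    Ex (fun w => (a1 i w)%:R) + Ex (fun w => (a2 i w)%:R) + Ex (fun w => (a3 i w)%:R).
  by rewrite ExD; [rewrite ExD//; exact: ib|apply: IntD; exact: ib|exact: ib].
under eq_bigr do rewrite split3.
rewrite !big_split/= (_ : (891 + _) * th = 27 * th + 864 * th + 1728 * expR 2 * th); last by ring.
apply: lerD; first apply: lerD; first exact: large_xi.
  apply: le_trans large_others; apply: ler_sum => i _; rewrite /a2.
  have iQ : ~~ predC1 i i by rewrite /= eqxx.
  have eW w : W predT w - xi i w = W (predC1 i) w.
    by have -> : W predT w = xi i w + W (predC1 i) w; [rewrite /Sm (bigD1 i)|rewrite addrAC subrr add0r].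
  have o1 : on i (fun w => (1 < `|xi i w|)%R%:R) by apply: on_ltr; [exact: on_cst|exact: on_norm].
  have o2 : off i (fun w => ((`|z| - 2) / 3 < `|W predT w - xi i w|)%R%:R).
    rewrite (_ : (fun w => _) = (fun w => ((`|z| - 2) / 3 < `|W (predC1 i) w|)%R%:R)).
      apply: (@off_comp _ _ _ _ _ X D i (fun y => ((`|z| - 2) / 3 < `|y|)%R%:R)); last exact: off_Sm.
      by apply: Mfun_ltr; [exact: measurable_cst|exact: normr_measurable].
    by apply/funext => w; rewrite eW.
  have [I3 E3] := on_indep indep o1 o2 (ib _ (mg1 i)) (ib _ (mo i)).
  rewrite [leRHS]mulrC -E3 le_eqVlt; apply/orP; left; apply/eqP; congr Ex; apply/funext => w.
  by rewrite -natrM mulnb andbC.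
apply: (@le_trans _ _ (\sum_(i < n) Ex (k3 1 i) * (expR 2 * expR (- (`|z| / 2))))).
  apply: ler_sum => i _; rewrite /a3.
  have iQ : ~~ predC1 i i by rewrite /= eqxx.
  have o1 : on i (fun w => (1 < `|xi i w|)%R%:R) by apply: on_ltr; [exact: on_cst|exact: on_norm].
  have o2 : off i (fun w => (B0 (Sm (predC1 i) tt w))%:R).
    apply: (@off_comp _ _ _ _ _ X D i (fun y => (B0 y)%:R)); first exact: Mfun_bool.
    by apply: off_Sm => //; exact: ott.
  have [I3 E3] := on_indep indep o1 o2 (ib _ (mg1 i)) (ib _ (mB i)).
  rewrite (_ : (fun w => (_ && _)%:R) = (fun w => (1 < `|xi i w|)%R%:R * (B0 (Sm (predC1 i) tt w))%:R)); last first.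
    by apply/funext => w; rewrite -natrM mulnb.
  rewrite E3; apply: ler_pM; try (by apply: Ex_ge0 => w); first exact: P_xi_gt1.
  by apply: mgf_tt_shift => // w; rewrite zn.
rewrite -mulr_suml -/(lya 1) /th.
have lm := lya_mono m1; have l10 : 0 <= lya 1 by apply: lya_ge0.
have e2 : expR (- (`|z| / 2)) <= 1728 / m ^+ 3.
  by apply: le_trans exp_le_cube; rewrite ler_expR; have := normr_ge0 z; lra.
rewrite (_ : 1728 * expR 2 * (lya m / m ^+ 3) = lya m * (expR 2 * (1728 / m ^+ 3))); last by ring.
by apply: ler_pM => //; rewrite ler_wpM2l ?expR_ge0.
Qed.

Hypothesis gam1 : lya 1 <= 1 / 10.

Lemma nonuniform_Berry_Esseen_pos (b : R -> bool) : 0 <= z -> measurable_fun setT b ->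
  (forall w, w < z -> b w) -> (forall w, z < w -> ~~ b w) ->
  `|Ex (fun w => (b (W predT w))%:R) - gcdf z| <= (891 + 1728 * expR 2 + 1728 * BE_const R) * th.
Proof.
move=> z0 mb bl br; rewrite -(subrKA (Ex (fun w => (b (Sm predT tt w))%:R))).
apply: (le_trans (ler_normD _ _)).
rewrite (_ : (891 + 1728 * expR 2 + 1728 * BE_const R) * th =
  (891 + 1728 * expR 2) * th + 1728 * BE_const R * th); last by rewrite mulrDl.
apply: lerD; first exact: truncation_error.
apply: (le_trans (truncated_Berry_Esseen indep oxi Ixi xi0 sum_sig lya1_gt0 gam1 z0 mb bl br)).
have lm := lya_mono m1; have l10 : 0 <= lya 1 by apply: lya_ge0.
have e2 := exp_le_cube; have zn : `|z| = z by exact: ger0_norm.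
rewrite zn in e2; rewrite /th (_ : 1728 * _ * _ = BE_const R * (1728 / m ^+ 3) * lya m); last by ring.
apply: ler_pM => //; first by rewrite mulr_ge0 ?expR_ge0// BE_const_ge0.
by rewrite ler_wpM2l// BE_const_ge0.
Qed.

End at_z.

End tails.

Section two_sided.
Context d (Omega : measurableType d) (R : realType) (P : probability Omega R).
Context (n : nat) (X D : 'I_n -> {RV P >-> R}).
Hypothesis indep : forall i, independent2 P (X i) (fun w => (D i w, sample_but X i w)).
Local Notation Ex := (Ex P).
Local Notation Int := (Int P).
Variables (xi : 'I_n -> Omega -> R).
Hypothesis oxi : forall j, on X j (xi j).
Hypothesis Ixi : forall j, Int (fun w => xi j w ^+ 2).
Hypothesis xi0 : forall j, Ex (xi j) = 0.
Hypothesis sum_sig : \sum_(j < n) Ex (fun w => xi j w ^+ 2) = 1.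
Local Notation lya := (lyapunov P xi).
Local Notation W := (Sm predT xi).
Variable z : R.
Let m := 1 + `|z|.
Let th := lya m / m ^+ 3.
Hypothesis gam1 : lya 1 <= 1 / 10.

(** For z < 0 the complement of W <= z is the complement of the strict event -W < -z reversed in
    sign: P(W <= z) = 1 - P(-W < -z), so the case z >= 0 is applied with an open half-line. *)
Lemma nonuniform_Berry_Esseen : `|Ex (fun w => (W w <= z)%R%:R) - gcdf z| <=
  (891 + 1728 * expR 2 + 1728 * BE_const R) * th.
Proof.
have [z0|/ltW z0] := leP 0 z.
  apply: (@nonuniform_Berry_Esseen_pos _ _ _ _ _ X D indep xi oxi Ixi xi0 sum_sig z gam1 (fun w => w <= z)) => //.
  - by apply: measurable_fun_ler; [exact: measurable_id|exact: measurable_cst].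
  - by move=> w /ltW.
  - by move=> w; rewrite -ltNge.
pose xi' j w := - xi j w.
have oxi' j : on X j (xi' j).
  rewrite (_ : xi' j = (fun w => 0 - xi j w)); first by apply: onB => //; exact: on_cst.
  by apply/funext => w; rewrite sub0r.
have sq' j : (fun w => xi' j w ^+ 2) = (fun w => xi j w ^+ 2) by apply/funext => w; rewrite sqrrN.
have Ixi' j : Int (fun w => xi' j w ^+ 2) by rewrite sq'.
have Ixi1 j : Int (xi j) by apply: Int_of_sq => //; exact: on_Mfun (oxi j).
have xi0' j : Ex (xi' j) = 0 by rewrite ExN ?xi0 ?oppr0.
have sum_sig' : \sum_(j < n) Ex (fun w => xi' j w ^+ 2) = 1.
  by rewrite -sum_sig; apply: eq_bigr => j _; rewrite sq'.
have lya' c : lyapunov P xi' c = lya c.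
  apply: eq_bigr => j _; congr Ex; apply/funext => w.
  by rewrite /capped_cube /xi' sqrrN normrN.
have mW : Mfun W by exact: Mfun_Sm oxi.
have := @nonuniform_Berry_Esseen_pos _ _ _ _ _ X D indep xi' oxi' Ixi' xi0' sum_sig' (- z) _ (fun w => w < - z).
rewrite !lya' normrN -/m -/th gcdfN oppr_ge0 => h.
have mb : measurable_fun setT (fun w : R => w < - z)%R.
  by apply: measurable_fun_ltr; [exact: measurable_id|exact: measurable_cst].
have {}h := h gam1 z0 mb (fun w wz => wz) (fun w wz => ltac:(by rewrite -leNgt ltW)).
suff e : Ex (fun w => (W w <= z)%R%:R) = 1 - Ex (fun w => (Sm predT xi' w < - z)%R%:R).
  by move: h; rewrite distrC e; congr (`|_| <= _); ring.
have mW' : Mfun (Sm predT xi') by exact: Mfun_Sm oxi'.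
rewrite -[X in X - _](Ex_cst P) -ExB; [|exact: Int_cst|apply: Int_bool; apply: measurable_fun_ltr => //; exact: measurable_cst].
congr Ex; apply/funext => w; rewrite /Sm sumrN ltrN2.
by case: leP => _; rewrite ?subr0 ?subrr.
Qed.

End two_sided.

Lemma gcdf_indicator (R : realType) : exists2 C : R, 0 <= C &
  forall z : R, `|gcdf z - (0 <= z)%R%:R| <= C * expR (- (`|z| / 4)).
Proof.
have [C C0 h] := gcdf_tailR R.
pose c : R := normal_peak 1; have c0 : 0 < c by exact: gpeak_gt0.
exists (C * c * expR 1); first by rewrite !mulr_ge0 ?expR_ge0// ltW.
have key z : 0 <= z -> 1 - gcdf z <= C * c * expR 1 * expR (- (z / 4)).
  move=> z0; apply: (le_trans (h z z0)); rewrite gpdfE -/c -!mulrA.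
  rewrite ler_wpM2l//; first exact: ltW.
  rewrite ler_wpM2l//; first exact: ltW.
  by rewrite -expRD ler_expR; have := sqr_ge0 (z - 1 / 4); nra.
move=> z; have [z0|z0] := leP 0 z.
  by rewrite [`|z|]ger0_norm// distrC ger0_norm ?sgcdf_ge0//; exact: key.
rewrite subr0 ger0_norm ?gcdf_ge0// ltr0_norm// -(opprK z) gcdfN opprK.
by rewrite -[X in expR (- (X / 4))]opprK opprK; apply: key; rewrite oppr_ge0 ltW.
Qed.

(** * The case of a Lyapunov sum bounded below *)

Section crude.
Context d (Omega : measurableType d) (R : realType) (P : probability Omega R).
Context (n : nat) (X D : 'I_n -> {RV P >-> R}).
Hypothesis indep : forall i, independent2 P (X i) (fun w => (D i w, sample_but X i w)).
Local Notation Ex := (Ex P).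
Local Notation Int := (Int P).
Variables (xi : 'I_n -> Omega -> R).
Hypothesis oxi : forall j, on X j (xi j).
Hypothesis Ixi : forall j, Int (fun w => xi j w ^+ 2).
Hypothesis xi0 : forall j, Ex (xi j) = 0.
Hypothesis sum_sig : \sum_(j < n) Ex (fun w => xi j w ^+ 2) = 1.
Local Notation lya := (lyapunov P xi).
Local Notation W := (Sm predT xi).
Variable z : R.
Let m := 1 + `|z|.
Let th := lya m / m ^+ 3.

(** Both distribution functions are compared with the indicator of z >= 0. Since lya m >= 1/10,
    additive constants in the tail bounds are themselves of order lya m. *)
Lemma crude_bound CP (Delta : Omega -> R) : 0 <= CP ->
  (forall z : R, `|gcdf z - (0 <= z)%R%:R| <= CP * expR (- (`|z| / 4))) ->
  1 / 10 <= lya 1 -> Mfun Delta ->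
  `|Ex (fun w => (W w + Delta w <= z)%R%:R) - gcdf z| <=
  Ex (fun w => ((`|z| + 1) / 3 < `|Delta w|)%R%:R) + (864 + 1728 * 10 * CP) * th.
Proof.
move=> CP0 hP l1 mD; have z0 := normr_ge0 z.
have m1 : 1 <= m by rewrite lerDl.
have m0 : 0 < m by exact: lt_le_trans m1.
have p0 : 0 < m ^+ 3 by rewrite exprn_gt0.
have lm := lya_mono oxi Ixi m1.
have mW : Mfun W by exact: Mfun_Sm oxi.
have mT : Mfun (fun w => W w + Delta w) by exact: MfunD.
have mc c := @measurable_cst _ _ Omega R setT c.
have ma : measurable_fun setT (fun w => (W w + Delta w <= z)%R) by apply: measurable_fun_ler; [exact: mT|exact: mc].
have mx : measurable_fun setT (fun w => ((`|z| + 1) / 3 < `|Delta w|)%R).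
  by apply: measurable_fun_ltr; [exact: mc|exact: Mfun_norm].
have mw : measurable_fun setT (fun w => (3^-1 * m <= `|W w|)%R).
  by apply: measurable_fun_ler; [exact: mc|exact: Mfun_norm].
have ib (c : Omega -> bool) : measurable_fun setT c -> Int (fun w => (c w)%:R) by exact: Int_bool.
set A := Ex _; set px := Ex _.
have px0 : 0 <= px by apply: Ex_ge0.
have t1 : `|A - (0 <= z)%R%:R| <= px + 594 * th.
  have [m3|m3] := leP m 3.
    apply: (@le_trans _ _ 1).
      have A0 : 0 <= A by apply: Ex_ge0.
      have A1 : A <= 1.
        rewrite -[leRHS](Ex_cst P); apply: Ex_le; [exact: ib|exact: Int_cst|move=> w].
        by rewrite lern1; case: (_ <= _).
      by case: (0 <= z); rewrite /= ler_norml; apply/andP; split; lra.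
    have : m ^+ 3 <= 3 ^+ 3 by rewrite lerXn2r ?nnegrE// ltW.
    rewrite -natrX (_ : (3 ^ 3)%N = 27%N)// => m27.
    apply: (@le_trans _ _ (594 * th)); last by rewrite lerDr.
    rewrite /th mulrA ler_pdivlMr// mul1r; lra.
  have -> : (0 <= z)%R%:R = Ex (fun=> (0 <= z)%R%:R) by rewrite Ex_cst.
  rewrite -ExB; [|exact: ib|exact: Int_cst].
  have Id : Int (fun w => (W w + Delta w <= z)%R%:R - (0 <= z)%R%:R) by apply: IntB; [exact: ib|exact: Int_cst].
  apply: (le_trans (Ex_norm Id)).
  apply: (@le_trans _ _ (Ex (fun w => ((`|z| + 1) / 3 < `|Delta w|)%R%:R + (3^-1 * m <= `|W w|)%R%:R))).
    apply: Ex_le; [exact: Int_norm|by apply: IntD; exact: ib|move=> w].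
    have s0 : 0 <= ((`|z| + 1) / 3 < `|Delta w|)%R%:R + (3^-1 * m <= `|W w|)%R%:R :> R by rewrite -natrD ler0n.
    have tri := ler_normD (W w) (Delta w).
    have [->|bne] := eqVneq (W w + Delta w <= z) (0 <= z); first by rewrite subrr normr0.
    apply: (@le_trans _ _ 1).
      by case: (_ <= z) bne; case: (0 <= z) => //=; rewrite ?subr0 ?sub0r ?normrN normr1.
    rewrite -natrD ler1n addn_gt0 !lt0b.
    have [//|h1] := ltP ((`|z| + 1) / 3) `|Delta w|.
    (* A discrepancy with the indicator forces |T| >= |z|; with |Delta| <= m / 3 this leaves |W| >=
       (2 m - 3) / 3 >= m / 3, as m > 3. *)
    have Tz : `|z| <= `|W w + Delta w|.
      have [zp|zn] := leP 0 z.
        have h : z < W w + Delta w by rewrite ltNge; apply/negP => h; move: bne; rewrite h zp.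
        by have := ler_norm (W w + Delta w); rewrite [`|z|]ger0_norm//; lra.
      have h : W w + Delta w <= z by rewrite leNgt; apply/negP => h; move: bne; rewrite leNgt h leNgt zn.
      by have := ler_norm (- (W w + Delta w)); rewrite normrN [`|z|]ltr0_norm//; lra.
    by rewrite /=; rewrite /m in m3 *; lra.
  rewrite ExD; [|exact: ib|exact: ib]; rewrite lerD2l.
  have c3 : 0 < (3^-1 : R) <= 1 by apply/andP; split; lra.
  apply: (le_trans (tail_W indep oxi Ixi xi0 sum_sig predT m0 c3)).
  rewrite /th mulrA exprVn invfM invrK mulrA ler_wpM2r//; first by rewrite invr_ge0 ltW.
  rewrite -natrX (_ : (3 ^ 3)%N = 27%N)//; lra.
have t2 := hP z; have e4 := @exp_le_cube R z.
have t3 : CP * expR (- (`|z| / 4)) <= 1728 * 10 * CP * th.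
  apply: (le_trans (ler_wpM2l CP0 e4)).
  rewrite /th -/m !mulrA ler_wpM2r//; first by rewrite invr_ge0 ltW.
  by have := ler_wpM2l CP0 (le_trans l1 lm); lra.
have th0 : 0 <= th by rewrite /th divr_ge0//; [exact: (lya_ge0 P xi (ltW m0))|exact: ltW].
rewrite distrC in t2.
rewrite -(subrKA (0 <= z)%R%:R); apply: (le_trans (ler_normD _ _)).
apply: (le_trans (lerD t1 (le_trans t2 t3))); lra.
Qed.

End crude.

(** Below [m] this is t^{3 - p} <= m^{3 - p}; above it, m^{p - 2} <= t^{p - 2}. *)
Lemma cubic_le_powR (R : realType) (m t p : R) : 1 <= m -> 0 <= t -> 2 < p <= 3 ->
  t ^+ 2 * Num.min m t <= m `^ (3 - p) * t `^ p.
Proof.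
move=> m1 t0 /andP[p2 p3]; have m0 : 0 < m by exact: lt_le_trans m1.
have [tm|mt] := leP t m.
  rewrite -exprSr -powR_mulrn//.
  have -> : t `^ 3%:R = t `^ (3 - p) * t `^ p.
    by rewrite -powRD; [congr (_ `^ _); ring|apply/implyP => /eqP; lra].
  rewrite ler_wpM2r ?powR_ge0//; apply: ge0_ler_powR; rewrite ?nnegrE ?subr_ge0//.
  exact: ltW.
have tp : 0 < t by exact: lt_trans mt.
have -> : t `^ p = t ^+ 2 * t `^ (p - 2).
  rewrite -powR_mulrn// -powRD; first by congr powR; ring.
  by apply/implyP => _; rewrite gt_eqF.
rewrite mulrCA ler_wpM2l ?sqr_ge0//.
have {1}-> : m = m `^ (3 - p) * m `^ (p - 2).
  rewrite -powRD; last by apply/implyP => _; rewrite gt_eqF.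
  by rewrite (_ : 3 - p + (p - 2) = 1) ?powRr1 ?ltW//; ring.
by rewrite ler_wpM2l ?powR_ge0// ge0_ler_powR ?nnegrE ?subr_ge0 ?ltW.
Qed.

(** * Assembly of the normal approximation *)

Section normal_approximation.
Context d (Omega : measurableType d) (R : realType) (P : probability Omega R).
Context (n : nat) (X : 'I_n -> {RV P >-> R}) (T : {mfun n.-tuple R >-> R}) (g : 'I_n -> {mfun R >-> R}).
Context (D : 'I_n -> {RV P >-> R}).
Hypothesis indep : forall i, independent2 P (X i) (fun w => (D i w, sample_but X i w)).
Hypothesis Eg : forall i, ('E_P[gX X g i] = 0)%E.
Hypothesis Eg2 : (\sum_(i < n) 'E_P[fun w => (gX X g i w ^+ 2)%R] = 1)%E.
Local Notation xi := (gX X g).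
Local Notation Delta := (remainder X T g).
Local Notation Ex := (Ex P).
Local Notation Int := (Int P).
Local Notation lya := (lyapunov P xi).
Local Notation L := (L2remainder X T g).
Local Notation Lc := (L2coupling X T g D).

Let oxi := on_gX X g.
Let Ixi := Int_gX_sq Eg2.
Let xi0 := Ex_gX Eg Eg2.
Let sum_sig := sum_Ex_gX_sq Eg2.

(** Pointwise, t min(d, t) >= t^2 - t^2 min(1, t) / d as long as d <= 1, which the hypothesis
    ensures for d = 2 lya 1. The sum is then at least 1 - lya 1 / d = 1/2. *)
Lemma small_delta_condition : lya 1 <= 1 / 2 -> 1 / 2 <= \sum_(j < n) Ex (capped_square xi (2 * lya 1) j).
Proof.
move=> l1; have l0 : 0 < lya 1 by exact: lya1_gt0 oxi Ixi sum_sig.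
have d0 : 0 < 2 * lya 1 by rewrite mulr_gt0.
have Ik j : Int (capped_cube xi 1 j) by exact: (Ik3 oxi Ixi).
apply: (@le_trans _ _ (1 - lya 1 / (2 * lya 1))).
  by rewrite (_ : lya 1 / (2 * lya 1) = 1 / 2); [lra|field; rewrite gt_eqF].
set dd := 2 * lya 1 in d0 *.
have -> : lya 1 / dd = \sum_(j < n) Ex (capped_cube xi 1 j) / dd by rewrite -mulr_suml.
rewrite -[X in X - _]sum_sig -sumrB; apply: ler_sum => j _.
rewrite -ExZr// -ExB//; last exact: IntZr.
apply: Ex_le; [by apply: IntB => //; exact: IntZr|exact: (Iuu oxi Ixi j (ltW d0))|move=> w].
rewrite /capped_cube /capped_square -[xi j w ^+ 2]real_normK ?num_real//.
have := normr_ge0 (xi j w); move: `|xi j w| => t t0.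
have s0 := sqr_ge0 t.
have q0 : 0 <= Num.min 1 t by rewrite le_min t0 ler01.
have [dt|td] := leP dd t; last by rewrite -expr2 lerBlDr lerDl divr_ge0 ?mulr_ge0// ltW.
apply: (@le_trans _ _ 0); last by rewrite mulr_ge0// ltW.
rewrite subr_le0 -mulrA ler_peMr// ler_pdivlMr// mul1r le_min dt andbT /dd; lra.
Qed.

Lemma L2remainder_ge0 : (0 <= L)%E. Proof. exact: Lnorm_ge0. Qed.
Lemma L2coupling_ge0 : (0 <= Lc)%E.
Proof. by apply: sume_ge0 => j _; apply: mule_ge0; exact: Lnorm_ge0. Qed.

Section at_z.
Variables (z CP : R).
Hypothesis CP0 : 0 <= CP.
Hypothesis hP : forall z : R, `|gcdf z - (0 <= z)%R%:R| <= CP * expR (- (`|z| / 4)).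
Let m := 1 + `|z|.
Let m1 : 1 <= m. Proof. by rewrite lerDl. Qed.
Let m0 : 0 < m. Proof. exact: lt_le_trans m1. Qed.
Let lm0 : 0 <= lya m. Proof. exact: (lya_ge0 P xi (ltW m0)). Qed.
Let im0 : 0 <= (m ^+ 3)^-1. Proof. by rewrite invr_ge0 exprn_ge0// ltW. Qed.
Let Y := (L + Lc + (lya m)%:E)%E.

Let Y0 : (0 <= Y)%E.
Proof. by rewrite !adde_ge0 ?L2remainder_ge0 ?L2coupling_ge0. Qed.

Let lyaY : ((lya m)%:E <= Y)%E.
Proof. by rewrite /Y leeDr// adde_ge0 ?L2remainder_ge0 ?L2coupling_ge0. Qed.

(** One summand for each ingredient: the crude case; gammaz (891 = 27 + 864) with tau, where 44 = 22
    * 2 comes from delta = 2 lya 1; and the Berry-Esseen bound for W. *)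
Definition final_const : R := (864 + 1728 * 10 * CP) + (891 + 1728 * 44) + (891 + 1728 * expR 2 + 1728 * BE_const R).

Lemma final_const_ge0 : 0 <= final_const.
Proof.
have h1 := BE_const_ge0 R; have h2 := expR_ge0 (2 : R).
by move: CP0; rewrite /final_const; lra.
Qed.

Let pD := P [set w | (`|Delta w| > (`|z| + 1) / 3)%R].

Let real_part (c : R) : 0 <= c -> ((c * (lya m / m ^+ 3))%:E <= (c / m ^+ 3)%:E * Y)%E.
Proof.
move=> c0; rewrite (_ : c * _ = c / m ^+ 3 * lya m); last by rewrite mulrA [LHS]mulrAC.
by rewrite EFinM lee_wpmul2l// lee_fin mulr_ge0.
Qed.

Let monoY (c c' : R) : c <= c' -> ((c / m ^+ 3)%:E * Y <= (c' / m ^+ 3)%:E * Y)%E.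
Proof. by move=> cc; rewrite lee_wpmul2r// lee_fin ler_wpM2r. Qed.

Lemma tau_le : (tau X T g D (2 * lya 1) <= 44%:E * Y)%E.
Proof.
rewrite /tau /Y !ge0_muleDr ?adde_ge0 ?L2remainder_ge0 ?L2coupling_ge0 ?lee_fin//.
rewrite [leRHS]addeC -[leLHS]addeA; apply: leeD.
  by rewrite -EFinM lee_fin; have := lya_mono oxi Ixi m1; lra.
apply: leeD; apply: lee_wpmul2r; rewrite ?L2remainder_ge0 ?L2coupling_ge0// lee_fin; lra.
Qed.

Lemma normal_bound :
  (`| P [set w | (stat X T w <= z)%R] - Phi z | <= pD + (final_const / m ^+ 3)%:E * Y)%E.
Proof.
have mD := Mfun_remainder X T g.
have B0 := BE_const_ge0 R; have E0 := expR_ge0 (2 : R).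
have pDE : pD = (Ex (fun w => ((`|z| + 1) / 3 < `|Delta w|)%R%:R))%:E by exact: P_norm_gt.
have PE := P_stat_le X T g z.
have [l1|l1] := leP (lya 1) (1 / 10); last first.
  have h := crude_bound indep oxi Ixi xi0 sum_sig z CP0 hP (ltW l1) mD.
  rewrite PE Phi_fin -EFinB abse_EFin pDE.
  apply: (@le_trans _ _ ((Ex (fun w => ((`|z| + 1) / 3 < `|Delta w|)%R%:R))%:E +
    ((864 + 1728 * 10 * CP) * (lya m / m ^+ 3))%:E)%E); first by rewrite -EFinD lee_fin.
  apply: leeD => //.
  have c0 : 0 <= 864 + 1728 * 10 * CP by move: CP0; lra.
  apply: (le_trans (real_part c0)); apply: monoY.
  by rewrite /final_const; lra.
have l0 : 0 < lya 1 by exact: lya1_gt0 oxi Ixi sum_sig.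
have d0 : 0 < 2 * lya 1 by rewrite mulr_gt0.
have l2 : lya 1 <= 1 / 2 by lra.
have h1 := stat_linear_bound T indep Eg Eg2 z d0 (small_delta_condition l2).
have h2 := nonuniform_Berry_Esseen indep oxi Ixi xi0 sum_sig z l1.
apply: (@le_trans _ _ (`| P [set w | (stat X T w <= z)%R] - P [set w | (linear_part X g w <= z)%R] | +
    ((891 + 1728 * expR 2 + 1728 * BE_const R) * (lya m / m ^+ 3))%:E)%E).
  rewrite PE P_linear_le Phi_fin -!EFinB !abse_EFin -EFinD lee_fin.
  rewrite -(subrKA (Ex (fun w => (Sm predT xi w <= z)%R%:R))).
  by apply: (le_trans (ler_normD _ _)); rewrite lerD2l.
have g1 : (gammaz X T g z <= pD + (891 * (lya m / m ^+ 3))%:E)%E.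
  rewrite gammazE leeD2l// lee_fin /gammaz_tail.
  rewrite (_ : 891 * _ = 27 * (lya m / m ^+ 3) + 864 * (lya m / m ^+ 3)); last by ring.
  by apply: lerD; [exact: large_xi oxi Ixi z|have hh := large_others indep oxi Ixi xi0 sum_sig z; exact: hh].
have g2 : ((expR (- (`|z| / 3)))%:E * tau X T g D (2 * lya 1) <= ((1728 * 44) / m ^+ 3)%:E * Y)%E.
  apply: (@le_trans _ _ ((1728 / m ^+ 3)%:E * (44%:E * Y))%E).
    apply: lee_pmul => //.
    - rewrite /tau; apply: adde_ge0; first apply: adde_ge0.
      + by rewrite lee_fin; lra.
      + by apply: mule_ge0; [rewrite lee_fin; lra|exact: L2remainder_ge0].
      by apply: mule_ge0; [rewrite lee_fin; lra|exact: L2coupling_ge0].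
    - rewrite lee_fin; apply: le_trans (exp_le_cube z); rewrite ler_expR.
      by have := normr_ge0 z; lra.
    - exact: tau_le.
  by rewrite muleA -EFinM mulrAC.
have c1 : 0 <= 891 + 1728 * expR 2 + 1728 * BE_const R by lra.
have c2 : 0 <= 891 :> R by lra.
apply: (le_trans (leeD (le_trans h1 (leeD (le_trans g1 (leeD (lexx _) (real_part c2))) g2)) (real_part c1))).
rewrite -!addeA leeD2l//.
have pos (c : R) : 0 <= c -> (0 <= (c / m ^+ 3)%:E)%E by move=> c0; rewrite lee_fin mulr_ge0.
have key (a b : R) : 0 <= a -> 0 <= b -> ((a / m ^+ 3)%:E * Y + (b / m ^+ 3)%:E * Y = ((a + b) / m ^+ 3)%:E * Y)%E.
  by move=> a0 b0; rewrite mulrDl EFinD ge0_muleDl ?pos.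
have c3 : 0 <= 1728 * 44 :> R by lra.
rewrite (key _ _ c3 c1) (key _ _ c2 (addr_ge0 c3 c1)).
by apply: monoY; move: CP0; rewrite /final_const; lra.
Qed.

End at_z.

End normal_approximation.

Section moments.
Context d (Omega : measurableType d) (R : realType) (P : probability Omega R).
Context (n : nat) (xi : 'I_n -> Omega -> R) (p m : R).
Hypothesis p23 : 2 < p <= 3.
Hypothesis m1 : 1 <= m.
Hypothesis mxi : forall i, Mfun (xi i).
Hypothesis Ixi : forall i, Int P (fun w => xi i w ^+ 2).
Hypothesis Ip : forall i, Int P (fun w => `|xi i w| `^ p).

(** The pointwise interpolation carries m^{3 - p}, and division by m^3 leaves m^{-p}. *)
Lemma lya_le_moments : lyapunov P xi m / m ^+ 3 <= m `^ (- p) * \sum_(i < n) Ex P (fun w => `|xi i w| `^ p).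
Proof.
have m0 : 0 < m by exact: lt_le_trans m1.
rewrite ler_pdivrMr ?exprn_gt0// mulrAC -[m ^+ 3]powR_mulrn; last exact: ltW.
rewrite -powRD; last first.
  by apply/implyP => _; rewrite gt_eqF.
rewrite mulr_sumr; apply: ler_sum => i _; rewrite -ExZl//; apply: Ex_le; [|exact: IntZl|].
  apply: (@Int_le _ _ _ _ _ (fun w => m * xi i w ^+ 2)); last exact: IntZl.
    by apply: MfunM; [exact: MfunX|apply: Mfun_min; [exact: Mfun_cst|exact: Mfun_norm]].
  by move=> w; rewrite ger0_norm ?(k3_ge0 _ _ _ (ltW m0))// (k3_le _ _ _ (ltW m0)).
move=> w; rewrite /capped_cube -[xi i w ^+ 2]real_normK ?num_real//.
by rewrite (addrC (- p)); exact: cubic_le_powR.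
Qed.

End moments.

Local Open Scope ereal_scope.

Theorem theorem2p2 (R : realType) :
  exists C : R,
  forall (d : measure_display) (Omega : measurableType d)
    (P : probability Omega R) (n : nat) (X : 'I_n -> {RV P >-> R})
    (T : {mfun n.-tuple R >-> R}) (g : 'I_n -> {mfun R >-> R})
    (Deltai : 'I_n -> {RV P >-> R}),
  mutually_independent P (fun i => X i : Omega -> R) ->
  (forall i, 'E_P[gX X g i] = 0) ->
  \sum_(i < n) 'E_P[fun w => (gX X g i w ^+ 2)%R] = 1 ->
  (forall i, independent2 P (X i)
               (fun w => (Deltai i w, sample_but X i w))) ->
  let W := linear_part X g in
  let Delta := remainder X T g in
  (forall delta : R, (0 < delta)%R ->
     \sum_(i < n) 'E_P[fun w => (`|gX X g i w|
                                 * Num.min delta `|gX X g i w|)%R]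
       >= (1 / 2)%:E ->
   forall z : R,
     `| P [set w | (stat X T w <= z)%R] - P [set w | (W w <= z)%R] |
     <= gammaz X T g z + (expR (- (`|z| / 3)))%:E * tau X T g Deltai delta)
  /\
  (forall p : R, (2 < p <= 3)%R ->
     (forall i, 'E_P[fun w => (`|gX X g i w| `^ p)%R] < +oo) ->
   forall z : R,
     `| P [set w | (stat X T w <= z)%R] - Phi z |
     <= P [set w | (`|Delta w| > (`|z| + 1) / 3)%R]
        + (C * (`|z| + 1) `^ (- p))%:E
          * (L2remainder X T g + L2coupling X T g Deltai
             + \sum_(i < n) 'E_P[fun w => (`|gX X g i w| `^ p)%R])).
Proof.
have [CP CP0 hP] := gcdf_indicator R.
exists (final_const CP) => d Omega P n X T g D _ Eg Eg2 indep W Delta; split.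
  by move=> dl dl0 /(truncated_condition Eg2 dl0) h z; exact: (stat_linear_bound T indep Eg Eg2).
move=> p p23 Ep z.
have C0 := final_const_ge0 CP0.
set m := (1 + `|z|)%R; have m1 : (1 <= m)%R by rewrite lerDl.
have m0 : (0 < m)%R by exact: lt_le_trans m1.
have mxi := Mfun_gX X g.
have Ip i : Int P (fun w => (`|gX X g i w| `^ p)%R).
  apply: Int_ge0_expectation; [|by move=> w; exact: powR_ge0|exact: Ep].
  by apply: (Mfun_comp (measurable_powR p)); exact: Mfun_norm.
apply: (le_trans (normal_bound T indep Eg Eg2 z CP0 hP)); rewrite leeD2l// -/m.
have L0 := L2remainder_ge0 X T g; have Lc0 := L2coupling_ge0 X T g D.
set b := (\sum_(i < n) Ex P (fun w => (`|gX X g i w| `^ p)))%R.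
have -> : \sum_(i < n) 'E_P[fun w => (`|gX X g i w| `^ p)%R] = b%:E.
  by rewrite -sumEFin; apply: eq_bigr => i _; rewrite expectation_Ex.
have b0 : (0 <= b)%R by apply: sumr_ge0 => i _; apply: Ex_ge0 => w; exact: powR_ge0.
have lm := lya_le_moments p23 m1 mxi (Int_gX_sq Eg2) Ip.
have lm0 := lya_ge0 P (gX X g) (ltW m0).
rewrite (addrC `|z|%R) -/m !(ge0_muleDr _ (adde_ge0 L0 Lc0)) ?lee_fin//.
apply: leeD.
  apply: lee_wpmul2r; first exact: adde_ge0.
  (* The L2 terms come with the better power m^{-3}, which is at most m^{-p} because p <= 3 and m >=
     1. *)
  rewrite lee_fin ler_wpM2l// -[(m ^+ 3)%R]powR_mulrn; last exact: ltW.
  rewrite -powRN ler_powR// lerN2.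
  by have /andP[] := p23.
rewrite -!EFinM lee_fin -!mulrA ler_wpM2l// mulrC; exact: lm.
Qed.
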